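(* Let $\Gamma$ be a finite group, $\theta:\Gamma\to O(\mathbb{R}^d)$ a point group, and let $(G,\sigma,p)$ be a $d$-dimensional tensegrity with $n\geq d+2$ vertices which is $\theta$-symmetric and generic modulo symmetry. Suppose also that $p$ affinely spans $\mathbb{R}^d$. If $(G,\sigma,p)$ is universally rigid, then it has a strictly proper equilibrium stress $\omega$ satisfying $L_{G,\omega}\succeq 0$ and $\operatorname{rank} L_{G,\omega}=n-d-1$.
   Context: Tensegrities: a $d$-dimensional tensegrity is a triple $(G,\sigma,p)$ with $G=(V,E)$ a finite simple graph, $\sigma:E\to\{-1,0,+1\}$, $p:V\to\mathbb{R}^d$; $E_0,E_+,E_-$ are the edges with sign $0,+1,-1$. $(G,\sigma,p)$ dominates $(G,\sigma,q)$ ($q:V\to\mathbb{R}^{d'}$) if $\|p_i-p_j\|\geq\|q_i-q_j\|$ on $E_+$, $=$ on $E_0$, $\leq$ on $E_-$; $p,q$ are congruent if $\|p_i-p_j\|=\|q_i-q_j\|$ for all $i,j\in V$. $(G,\sigma,p)$ is universally rigid if for every $d'\geq d$ (with $\mathbb{R}^d\subseteq\mathbb{R}^{d'}$) every $q:V\to\mathbb{R}^{d'}$ dominated by it is congruent to $p$. For $\omega:E\to\mathbb{R}$, $L_{G,\omega}=\sum_{ij\in E}\omega_{ij}(\mathbf{e}_i-\mathbf{e}_j)(\mathbf{e}_i-\mathbf{e}_j)^\top$; $\omega$ is an equilibrium stress if $\sum_{j\in N_G(i)}\omega_{ij}(p_i-p_j)=\mathbf{0}$ for all $i$; strictly proper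 if $\sigma(ij)\omega_{ij}\geq0$ for all edges with strict inequality for all edges in $E_+\cup E_-$. Symmetry: a $\Gamma$-gain graph on a finite set $\hat V$ is a set $\hat E$ of triples $(u,v,\gamma)\in\hat V\times\hat V\times\Gamma$ considered up to the identification $(u,v,\gamma)\sim(v,u,\gamma^{-1})$. Its lift is the undirected graph on $\Gamma\times\hat V$ in which $\{(\alpha,u),(\beta,v)\}$ is an edge iff $(u,v,\alpha^{-1}\beta)\in\hat E$. A point group is a homomorphism $\theta:\Gamma\to O(\mathbb{R}^d)$. A configuration $p:\Gamma\times\hat V\to\mathbb{R}^d$ is compatible with $\theta$ if $\theta(\gamma)p_{(\alpha,v)}=p_{(\gamma\alpha,v)}$ for all $\gamma,\alpha\in\Gamma$, $v\in\hat V$. $\mathcal{C}_\theta(V)$ is the set of configurations $V=\Gamma\times\hat V\to\mathbb{R}^d$ compatible with $\theta$ with $\sum_{i\in V}p_i=\mathbf{0}$. A tensegrity $(G,\sigma,p)$ with $V(G)=\Gamma\times\hat V$ is $\theta$-symmetric if each of $(V,E_0),(V,E_+),(V,E_-)$ is the lift of some $\Gamma$-gain graph on $\hat V$ and $p$ is compatible with $\theta$. Fix, for each equivalence class of real irreducible representations of $\Gamma$, a representative orthogonal matrix representation; let $\mathbb{Q}_{\theta,\Gamma}$ be the field generated over $\mathbb{Q}$ by the entries of all $\theta(\gamma)$ and of these representative matrices. For a semi-algebraic set $S$ defined over a field $K$, a point $x\in S$ is generic in $S$ (over $K$) if there is no polynomial $f$ with coefficients in $K$ with $f(x)=0$ and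 $f(y)\neq0$ for some $y\in S$. $(G,\sigma,p)$ is generic modulo symmetry if the translate of $p$ whose centroid is the origin is generic over $\mathbb{Q}_{\theta,\Gamma}$ in $\mathcal{C}_\theta(V)$. *)

(* Defs.v *)
From HB Require Import structures.
From mathcomp Require Import all_boot all_order all_algebra all_fingroup.
From mathcomp Require Import mxrepresentation.
From mathcomp Require Import mpoly.
From mathcomp Require Import reals.
Set Implicit Arguments. Unset Strict Implicit. Unset Printing Implicit Defensive.
Import Order.TTheory GRing.Theory Num.Theory.
Local Open Scope ring_scope.

Section Tensegrity.
Variable R : realType.

Definition sqnorm d (x : 'cV[R]_d) : R := (x^T *m x) 0 0.
Definition enorm d (x : 'cV[R]_d) : R := Num.sqrt (sqnorm x).

Definition orthogonal_mx d (A : 'M[R]_d) : Prop := A^T *m A = 1%:M.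

Definition affinely_spans (V : finType) d (p : V -> 'cV[R]_d) : Prop :=
  forall z : 'cV[R]_d, exists lam : V -> R,
    \sum_(i : V) lam i = 1 /\ z = \sum_(i : V) lam i *: p i.

Definition simple_graph (V : finType) (E : rel V) : Prop :=
  (forall i, ~~ E i i) /\ (forall i j, E i j = E j i).

Definition sign_function (V : finType) (E : rel V) (sigma : V -> V -> int) :
  Prop :=
  forall i j, E i j ->
    sigma i j = sigma j i /\ sigma i j \in [:: (-1)%R; 0%R; 1%R].

Definition edges_of_sign (V : finType) (E : rel V) (sigma : V -> V -> int)
  (s : int) : rel V := fun i j => E i j && (sigma i j == s).

Definition dominates (V : finType) (E : rel V) (sigma : V -> V -> int)
  d (p : V -> 'cV[R]_d) d' (q : V -> 'cV[R]_d') : Prop :=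
  forall i j, E i j ->
    (sigma i j = 1%R -> enorm (p i - p j) >= enorm (q i - q j)) /\
    (sigma i j = 0%R -> enorm (p i - p j) = enorm (q i - q j)) /\
    (sigma i j = (-1)%R -> enorm (p i - p j) <= enorm (q i - q j)).

Definition congruent (V : finType) d (p : V -> 'cV[R]_d) d' (q : V -> 'cV[R]_d')
  : Prop := forall i j, enorm (p i - p j) = enorm (q i - q j).

(* universal rigidity: for every d' >= d (R^d viewed inside R^d'), every
   configuration in R^d' dominated by (G,sigma,p) is congruent to p.
   Only distances are compared, so the embedding R^d <= R^d' is implicit. *)
Definition universally_rigid (V : finType) (E : rel V) (sigma : V -> V -> int)
  d (p : V -> 'cV[R]_d) : Prop :=
  forall d', (d <= d')%N -> forall q : V -> 'cV[R]_d',
    dominates E sigma p q -> congruent p q.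

Definition is_stress (V : finType) (E : rel V) (omega : V -> V -> R) : Prop :=
  forall i j, E i j -> omega i j = omega j i.

Definition equilibrium_stress (V : finType) (E : rel V) d (p : V -> 'cV[R]_d)
  (omega : V -> V -> R) : Prop :=
  forall i, \sum_(j : V | E i j) omega i j *: (p i - p j) = 0.

Definition strictly_proper (V : finType) (E : rel V) (sigma : V -> V -> int)
  (omega : V -> V -> R) : Prop :=
  forall i j, E i j ->
    0 <= (sigma i j)%:~R * omega i j /\
    (sigma i j != 0%R -> 0 < (sigma i j)%:~R * omega i j).

Definition basis_vec (V : finType) (i : V) : 'cV[R]_#|V| :=
  delta_mx (enum_rank i) 0.

(* L_{G,omega} = sum over edges ij of omega_ij (e_i - e_j)(e_i - e_j)^T;
   each unordered edge {i,j} is counted once (via the order on enum_rank) *)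
Definition stress_laplacian (V : finType) (E : rel V) (omega : V -> V -> R)
  : 'M[R]_#|V| :=
  \sum_(i : V) \sum_(j : V | E i j && (enum_rank i < enum_rank j)%N)
     omega i j *: ((basis_vec i - basis_vec j) *m (basis_vec i - basis_vec j)^T).

(* positive semidefinite (for a symmetric real matrix) *)
Definition psd n (A : 'M[R]_n) : Prop :=
  forall v : 'cV[R]_n, 0 <= (v^T *m A *m v) 0 0.

(* A Gamma-gain graph on Vhat: a set of triples (u,v,g), closed under the
   identification (u,v,g) ~ (v,u,g^-1). *)
Definition gain_graph (gT : finGroupType) (Vhat : finType)
  (Ehat : Vhat -> Vhat -> gT -> bool) : Prop :=
  forall u v g, Ehat u v g = Ehat v u (g^-1)%g.

Definition lift (gT : finGroupType) (Vhat : finType)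
  (Ehat : Vhat -> Vhat -> gT -> bool) : rel (gT * Vhat) :=
  fun x y => Ehat x.2 y.2 (x.1^-1 * y.1)%g.

Definition is_lift (gT : finGroupType) (Vhat : finType) (E : rel (gT * Vhat))
  : Prop :=
  exists Ehat : Vhat -> Vhat -> gT -> bool,
    gain_graph Ehat /\ forall x y, E x y = lift Ehat x y.

Definition point_group (gT : finGroupType) d
  (theta : mx_representation R [set: gT] d) : Prop :=
  forall g : gT, orthogonal_mx (theta g).

Definition compatible (gT : finGroupType) (Vhat : finType) d
  (theta : mx_representation R [set: gT] d) (p : gT * Vhat -> 'cV[R]_d) : Prop :=
  forall (g a : gT) (v : Vhat), theta g *m p (a, v) = p ((g * a)%g, v).

Definition C_theta (gT : finGroupType) (Vhat : finType) d
  (theta : mx_representation R [set: gT] d) (p : gT * Vhat -> 'cV[R]_d) : Prop :=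
  compatible theta p /\ \sum_(i : gT * Vhat) p i = 0.

Definition theta_symmetric (gT : finGroupType) (Vhat : finType)
  (E : rel (gT * Vhat)) (sigma : gT * Vhat -> gT * Vhat -> int) d
  (theta : mx_representation R [set: gT] d) (p : gT * Vhat -> 'cV[R]_d) : Prop :=
  is_lift (edges_of_sign E sigma 0%R) /\
  is_lift (edges_of_sign E sigma 1%R) /\
  is_lift (edges_of_sign E sigma (-1)%R) /\
  compatible theta p.

Definition irr_rep_system (gT : finGroupType) (I : finType) (deg : I -> nat)
  (rep : forall i : I, mx_representation R [set: gT] (deg i)) : Prop :=
  (forall i, mx_irreducible (rep i)) /\
  (forall i (g : gT), orthogonal_mx (rep i g)) /\
  (forall i j, mx_rsim (rep i) (rep j) -> i = j) /\
  (forall n (rG : mx_representation R [set: gT] n),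
      mx_irreducible rG -> exists i, mx_rsim rG (rep i)).

Definition is_subfield (S : R -> Prop) : Prop :=
  S 0 /\ S 1 /\ (forall x y, S x -> S y -> S (x - y)) /\
  (forall x y, S x -> S y -> S (x * y)) /\ (forall x, S x -> S x^-1).

Definition generated_field (gens : R -> Prop) : R -> Prop :=
  fun x => forall S, is_subfield S -> (forall y, gens y -> S y) -> S x.

Definition Q_theta_Gamma (gT : finGroupType) d
  (theta : mx_representation R [set: gT] d)
  (I : finType) (deg : I -> nat)
  (rep : forall i : I, mx_representation R [set: gT] (deg i)) : R -> Prop :=
  generated_field (fun y =>
    (exists (g : gT) (a b : 'I_d), y = theta g a b) \/
    (exists (i : I) (g : gT) (a b : 'I_(deg i)), y = rep i g a b)).

Definition coords (V : finType) d (p : V -> 'cV[R]_d) :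
  'I_#|{: V * 'I_d}| -> R :=
  fun k => let ia := enum_val k in p ia.1 ia.2 0.

Definition generic_in (V : finType) d (K : R -> Prop)
  (S : (V -> 'cV[R]_d) -> Prop) (x : V -> 'cV[R]_d) : Prop :=
  S x /\
  ~ (exists f : {mpoly R[#|{: V * 'I_d}|]},
       (forall m, K f@_m) /\ f.@[coords x] = 0 /\
       exists y, S y /\ f.@[coords y] != 0).

Definition centered (V : finType) d (p : V -> 'cV[R]_d) : V -> 'cV[R]_d :=
  fun i => p i - (#|V|%:R)^-1 *: \sum_(j : V) p j.

Definition generic_mod_symmetry (gT : finGroupType) (Vhat : finType) d
  (theta : mx_representation R [set: gT] d)
  (I : finType) (deg : I -> nat)
  (rep : forall i : I, mx_representation R [set: gT] (deg i))
  (p : gT * Vhat -> 'cV[R]_d) : Prop :=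
  generic_in (Q_theta_Gamma theta rep) (C_theta theta) (centered p).

End Tensegrity.

(* Main.v *)
Require Import Defs.
From HB Require Import structures.
From mathcomp Require Import all_boot all_order all_algebra all_fingroup.
From mathcomp Require Import mxrepresentation reals.
From mathcomp Require Import ring lra zify.
From mathcomp Require ordered_qelim qe_rcf_th qe_rcf.
Set Implicit Arguments. Unset Strict Implicit. Unset Printing Implicit Defensive.
Import Order.TTheory GRing.Theory Num.Theory.
Local Open Scope ring_scope.

(** The Gram matrix X0 of the centered configuration p, with zero slacks, is by
    universal rigidity the only point of the closed convex cone of
    Gamma-invariant centered positive semidefinite kernels with nonnegative
    slacks on the signed edges that has its image under the linear edge map A.
    As in Straszewicz' and Asplund's theorems on (k-)exposed points, maximizing
    a suitable quadratic function of the edge lengths, strictly convex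
    transversally to the image under A of the span W of the minimal face of X0,
    yields points of the cone arbitrarily close to X0 with a supporting
    functional, i.e. a positive semidefinite stress, whose face has image
    contained in A(W'), where W' is the analogue of W at the nearby
    configuration q in C_theta.  The existence of such a stress at q is a first
    order property of q, so by quantifier elimination, with control of the
    coefficients, its truth near the generic configuration p forces it at p.
    There universal rigidity shows that the face of the stress is the minimal
    face of X0, which gives both strict properness and the maximal rank. *)

(** * Extreme values *)

(** Uniqueness of the preimage of the image of X0 does not by itself give a supporting functional
    whose face is the minimal one: a linear image of a positive semidefinite cone can have
    non-exposed faces. Moving to a nearby point repairs this at the price of leaving p, and
    genericity brings the stress back. Slacks make domination an equality of linear images, so that
    universal rigidity becomes uniqueness of a preimage. The nearby kernel may have rank above d and
    nonzero slacks; the linear map [qof], which sends the Gram matrix of p back to p, still reads a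
    configuration q off it, and no rigidity is claimed at q. Restricting to invariant kernels keeps
    q in the set where p is generic and loses nothing: testing an invariant stress on group sums of
    rank one kernels shows that it is semidefinite on all vectors. Genericity speaks only of
    polynomials over the given field, so the constants of the eliminated formula matter; those that
    the elimination creates are rational. *)

Definition econt (R : realType) (I : finType) (g : (I -> R) -> R) :=
  forall t e, 0 < e -> exists2 d, 0 < d &
    forall u, (forall i, `|u i - t i| < d) -> `|g u - g t| < e.

Definition eclosed (R : realType) (I : finType) (S : (I -> R) -> Prop) :=
  forall t, (forall e, 0 < e -> exists2 u, S u & forall i, `|u i - t i| < e) ->
    S t.

Module EVT.
From mathcomp Require Import boolp classical_sets topology normedtype derive.
Import numFieldNormedType.Exports.
Local Open Scope classical_set_scope.

Lemma ball_coord (R : realType) n (v w : 'rV[R]_n.+1) e j :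
  ball v e w -> `|w ord0 j - v ord0 j| < e.
Proof.
rewrite mx_norm_ball /ball_ /= distrC => h.
apply: le_lt_trans h; rewrite [leRHS]/Num.norm /= mx_normrE.
have := le_bigmax 0 (fun ij : 'I_1 * 'I_n.+1 => `|(w - v) ij.1 ij.2|) (ord0, j).
by rewrite /= !mxE.
Qed.

(** The extra coordinate, fixed to 0, keeps the vectors of positive size when [I] is empty; fixing
    it keeps the transported set bounded. *)
Lemma extreme_value (R : realType) (I : finType) (S : (I -> R) -> Prop) g (b : R) :
  econt g -> eclosed S -> (exists t, S t) ->
  (forall t i, S t -> `|t i| <= b) ->
  exists2 t, S t & forall u, S u -> g u <= g t.
Proof.
move=> cg cS [t0 St0] bS.
pose n := #|I|.
pose toF (v : 'rV[R]_n.+1) i := v ord0 (lift ord0 (enum_rank i)).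
pose ofF (t : I -> R) : 'rV[R]_n.+1 :=
  \row_k (if unlift ord0 k is Some k' then t (enum_val k') else 0).
have toFK t : toF (ofF t) = t.
  by apply/funext => i; rewrite /toF mxE liftK enum_rankK.
pose A : set 'rV[R]_n.+1 := [set v | S (toF v) /\ v ord0 ord0 = 0].
have An0 : A !=set0.
  by exists (ofF t0); split; rewrite ?toFK // mxE unlift_none.
have Abnd : bounded_set A.
  exists (`|b|); split; first exact: num_real.
  move=> x bx v [Sv v0].
  rewrite /Num.norm /= mx_normrE; apply: bigmax_le; first exact: le_trans (ltW bx).
  move=> [i j] _ /=; rewrite (ord1 i).
  case: (unliftP ord0 j) => [k ->|->]; last first.
    by rewrite v0 normr0; apply: le_trans (ltW bx).
  have := bS _ (enum_val k) Sv; rewrite /toF enum_valK => h.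
  by apply: (le_trans h); apply: (le_trans (ler_norm b)); apply: ltW.
have Acl : closed A.
  move=> v clv; split.
    apply: cS => e e0.
    have /clv : nbhs v (ball v e) by apply: nbhsx_ballx.
    case=> w [[Sw _] bw]; exists (toF w) => // i.
    exact: ball_coord.
  apply/eqP; rewrite -normr_le0; apply/ler_addgt0Pl => e e0; rewrite addr0.
  have /clv : nbhs v (ball v e) by apply: nbhsx_ballx.
  case=> w [[_ w0] bw]; have := ball_coord ord0 bw.
  by rewrite w0 sub0r normrN => /ltW.
have Ac : compact A := bounded_closed_compact Abnd Acl.
have gc : {within A, continuous (g \o toF)}.
  apply: continuous_subspaceT => v.
  move=> P /nbhs_ballP [e /= e0 heP].
  have [d d0 hd] := cg (toF v) e e0.
  have : nbhs v (ball v d) by exact: nbhsx_ballx.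
  rewrite nbhs_simpl /=; apply: filterS => w bw /=; apply: heP.
  rewrite /ball /= distrC; apply: hd => i.
  exact: ball_coord.
have [c] := compact_EVT_max An0 Ac gc.
rewrite inE => -[Sc c0] hc.
exists (toF c) => // u Su.
have := hc (ofF u); rewrite /= toFK; apply.
by rewrite inE; split; rewrite ?toFK // mxE unlift_none.
Qed.
End EVT.

From mathcomp Require Import mpoly.

(** * Calculus of continuous functions and closed sets *)

Section Continuity.
Variables (R : realType) (I : finType).
Implicit Types (f g : (I -> R) -> R) (t u : I -> R).

Lemma econt_ext f g : f =1 g -> econt f -> econt g.
Proof.
move=> fg cf t e e0; have [d d0 hd] := cf t e e0.
by exists d => // u /hd; rewrite !fg.
Qed.

Lemma econt_const c : econt (fun _ : I -> R => c).
Proof. by move=> t e e0; exists 1 => // u _; rewrite subrr normr0. Qed.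

Lemma econt_coord i : econt (fun t : I -> R => t i).
Proof. by move=> t e e0; exists e. Qed.

Lemma econtD f g : econt f -> econt g -> econt (fun t => f t + g t).
Proof.
move=> cf cg t e e0; have e2 : 0 < e / 2 by lra.
have [d1 d10 h1] := cf t _ e2; have [d2 d20 h2] := cg t _ e2.
exists (Num.min d1 d2) => [|u hu]; first by rewrite lt_min d10.
rewrite opprD addrACA (splitr e); apply: le_lt_trans (ler_normD _ _) _.
by rewrite ltrD ?h1 ?h2 // => i; move: (hu i); rewrite lt_min => /andP[].
Qed.

Lemma econtM f g : econt f -> econt g -> econt (fun t => f t * g t).
Proof.
move=> cf cg t e e0.
pose m := `|f t| + `|g t| + 1.
have m1 : 1 <= m by rewrite /m lerDr addr_ge0.
(* With both differences below [e1 <= 1], the error is at most [e1 * m], which is at most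
   [e / 2]. *)
pose e1 := Num.min 1 (e / (2 * m)).
have e10 : 0 < e1 by rewrite lt_min ltr01 divr_gt0 //; nra.
have e1m : e1 * (2 * m) <= e.
  by rewrite -ler_pdivlMr ?ge_min ?lexx ?orbT //; nra.
have e11 : e1 <= 1 by rewrite ge_min lexx.
have [d1 d10 h1] := cf t _ e10; have [d2 d20 h2] := cg t _ e10.
exists (Num.min d1 d2) => [|u hu]; first by rewrite lt_min d10.
have {}h1 : `|f u - f t| < e1.
  by apply: h1 => i; move: (hu i); rewrite lt_min => /andP[].
have {}h2 : `|g u - g t| < e1.
  by apply: h2 => i; move: (hu i); rewrite lt_min => /andP[].
have -> : f u * g u - f t * g t = (f u - f t) * (g u - g t) +
  (f t * (g u - g t) + g t * (f u - f t)) by ring.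
apply: le_lt_trans (ler_normD _ _) _.
apply: le_lt_trans (lerD (lexx _) (ler_normD _ _)) _; rewrite !normrM.
have := normr_ge0 (f t); have := normr_ge0 (g t).
have := normr_ge0 (f u - f t); have := normr_ge0 (g u - g t).
move: m1 e1m; rewrite /m; move: `|_ - _| `|_ - _| `|f t| `|g t| h1 h2.
move=> a b c d' h1 h2 m1 e1m a0 b0 c0 d0.
have h3 : a * b <= e1 by nra.
have h4 : d' * a <= d' * e1 by nra.
have h5 : c * b <= c * e1 by nra.
nra.
Qed.

Lemma econtN f : econt f -> econt (fun t => - f t).
Proof.
move=> cf; apply: econt_ext (econtM (econt_const (-1)) cf) => t.
by rewrite mulN1r.
Qed.

Lemma econtB f g : econt f -> econt g -> econt (fun t => f t - g t).
Proof. by move=> cf cg; apply: econtD => //; apply: econtN. Qed.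

Lemma econt_sum (A : Type) (s : seq A) (P : pred A) (F : A -> (I -> R) -> R) :
  (forall a, econt (F a)) -> econt (fun t => \sum_(a <- s | P a) F a t).
Proof.
move=> cF; elim: s => [|a s IHs].
  by apply: econt_ext (econt_const 0) => t; rewrite big_nil.
case Pa: (P a).
  by apply: econt_ext (econtD (cF a) IHs) => t; rewrite big_cons Pa.
by apply: econt_ext IHs => t; rewrite big_cons Pa.
Qed.

Lemma econt_prod (A : Type) (s : seq A) (P : pred A) (F : A -> (I -> R) -> R) :
  (forall a, econt (F a)) -> econt (fun t => \prod_(a <- s | P a) F a t).
Proof.
move=> cF; elim: s => [|a s IHs].
  by apply: econt_ext (econt_const 1) => t; rewrite big_nil.
case Pa: (P a).
  by apply: econt_ext (econtM (cF a) IHs) => t; rewrite big_cons Pa.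
by apply: econt_ext IHs => t; rewrite big_cons Pa.
Qed.

Lemma econt_det n (F : (I -> R) -> 'M[R]_n) :
  (forall i j, econt (fun t => F t i j)) -> econt (fun t => \det (F t)).
Proof.
move=> cF; apply: econt_sum => s.
apply: econtM; first exact: econt_const.
by apply: econt_prod => i; apply: cF.
Qed.

Lemma econt_exp f n : econt f -> econt (fun t => f t ^+ n).
Proof.
move=> cf; elim: n => [|n IHn]; first exact: econt_const.
by apply: econt_ext (econtM cf IHn) => t; rewrite exprS.
Qed.

Lemma eclosed_ge0 f : econt f -> eclosed (fun t => 0 <= f t).
Proof.
move=> cf t ht; rewrite leNgt; apply/negP => ft.
have [|d d0 hd] := cf t (- f t); first by rewrite oppr_gt0.
have [u fu /hd] := ht d d0; rewrite ltr_norml opprK => /andP[_].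
by rewrite ltrBlDr addNr ltNge fu.
Qed.

Lemma eclosed_and (S T : (I -> R) -> Prop) :
  eclosed S -> eclosed T -> eclosed (fun t => S t /\ T t).
Proof.
move=> cS cT t ht; split; [apply: cS => e e0|apply: cT => e e0];
by have [u [Su Tu] hu] := ht e e0; exists u.
Qed.

Lemma eclosed_forall (A : Type) (S : A -> (I -> R) -> Prop) :
  (forall a, eclosed (S a)) -> eclosed (fun t => forall a, S a t).
Proof.
by move=> cS t ht a; apply: cS => e e0; have [u Su hu] := ht e e0; exists u.
Qed.

Lemma eclosed_iff (S T : (I -> R) -> Prop) :
  (forall t, S t <-> T t) -> eclosed S -> eclosed T.
Proof.
move=> ST cS t ht; apply/ST/cS => e e0; have [u /ST Su hu] := ht e e0.
by exists u.
Qed.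

Lemma eclosed_imp (P : Prop) (S : (I -> R) -> Prop) :
  eclosed S -> eclosed (fun t => P -> S t).
Proof.
by move=> cS t ht p; apply: cS => e e0; have [u Su hu] := ht e e0; exists u; auto.
Qed.

Lemma eclosed_eq f g : econt f -> econt g -> eclosed (fun t => f t = g t).
Proof.
move=> cf cg.
have c1 := eclosed_ge0 (econtB cf cg); have c2 := eclosed_ge0 (econtB cg cf).
apply: eclosed_iff (eclosed_and c1 c2) => t; rewrite !subr_ge0; split.
  by move=> [h1 h2]; apply: le_anti; rewrite h1 h2.
by move=> ->.
Qed.

Lemma evt_lower (S : (I -> R) -> Prop) g b :
  econt g -> eclosed S -> (forall t i, S t -> `|t i| <= b) ->
  (forall t, S t -> 0 < g t) ->
  exists2 c, 0 < c & forall t, S t -> c <= g t.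
Proof.
move=> cg cS bS gS; have [ex|nex] := boolp.EM (exists t, S t).
  have [t St ht] := EVT.extreme_value (econtN cg) cS ex bS.
  by exists (g t); [exact: gS|move=> u /ht; rewrite lerN2].
by exists 1 => // t St; case: nex; exists t.
Qed.

Lemma evt_upper (S : (I -> R) -> Prop) g b :
  econt g -> eclosed S -> (forall t i, S t -> `|t i| <= b) ->
  exists2 c, 0 < c & forall t, S t -> g t <= c.
Proof.
move=> cg cS bS; have [ex|nex] := boolp.EM (exists t, S t).
  have [t St ht] := EVT.extreme_value cg cS ex bS.
  exists (`|g t| + 1) => [|u Su]; first by rewrite ltr_wpDl.
  by rewrite (le_trans (ht _ Su)) // (le_trans (ler_norm _)) // lerDl.
by exists 1 => // t St; case: nex; exists t.
Qed.

(** * Linear functionals given by their coefficients *)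

Definition lin (f : (I -> R) -> R) :=
  exists c : I -> R, forall t, f t = \sum_i c i * t i.

Lemma lin_coord i : lin (fun t => t i).
Proof.
exists (fun j => (j == i)%:R) => t.
rewrite (bigD1 i) //= eqxx mul1r big1 ?addr0 // => j /negPf ->.
by rewrite mul0r.
Qed.

Lemma lin0 : lin (fun=> 0).
Proof. by exists (fun=> 0) => t; rewrite big1 // => i _; rewrite mul0r. Qed.

Lemma linD f g : lin f -> lin g -> lin (fun t => f t + g t).
Proof.
move=> [c hc] [d hd]; exists (fun i => c i + d i) => t.
by rewrite hc hd -big_split; apply: eq_bigr => i _; rewrite mulrDl.
Qed.

Lemma linZ a f : lin f -> lin (fun t => a * f t).
Proof.
move=> [c hc]; exists (fun i => a * c i) => t.
by rewrite hc mulr_sumr; apply: eq_bigr => i _; rewrite mulrA.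
Qed.

Lemma lin_ext f g : f =1 g -> lin f -> lin g.
Proof. by move=> fg [c hc]; exists c => t; rewrite -fg. Qed.

Lemma linB f g : lin f -> lin g -> lin (fun t => f t - g t).
Proof.
move=> lf lg; apply: lin_ext (linD lf (linZ (-1) lg)) => t.
by rewrite mulN1r.
Qed.

Lemma lin_sum (A : Type) (s : seq A) (P : pred A) (F : A -> (I -> R) -> R) :
  (forall a, lin (F a)) -> lin (fun t => \sum_(a <- s | P a) F a t).
Proof.
move=> cF; elim: s => [|a s IHs].
  by apply: lin_ext lin0 => t; rewrite big_nil.
case Pa: (P a).
  by apply: lin_ext (linD (cF a) IHs) => t; rewrite big_cons Pa.
by apply: lin_ext IHs => t; rewrite big_cons Pa.
Qed.

Lemma lin_econt f : lin f -> econt f.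
Proof.
move=> [c hc]; apply: econt_ext (fun t => esym (hc t)) _.
apply: econt_sum => i; apply: econtM; [exact: econt_const|exact: econt_coord].
Qed.

Lemma lin_comb f a b t u :
  lin f -> f (fun i => a * t i + b * u i) = a * f t + b * f u.
Proof.
move=> [c hc]; rewrite !hc !mulr_sumr -big_split; apply: eq_bigr => i _ /=.
by ring.
Qed.

Lemma lin_comb1 f b t u : lin f -> f (fun i => t i + b * u i) = f t + b * f u.
Proof.
move=> lf; have := lin_comb 1 b t u lf; rewrite mul1r => <-; congr f.
by apply: boolp.funext => i; rewrite mul1r.
Qed.

Lemma lin_sub f t u : lin f -> f (fun i => t i - u i) = f t - f u.
Proof.
move=> lf; have := lin_comb1 (-1) t u lf; rewrite mulN1r => <-; congr f.
by apply: boolp.funext => i; rewrite mulN1r.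
Qed.

Lemma lin_f0 f : lin f -> f (fun=> 0) = 0.
Proof. by move=> [c ->]; rewrite big1 // => i _; rewrite mulr0. Qed.

Lemma lin_scale f b u : lin f -> f (fun i => b * u i) = b * f u.
Proof.
move=> lf; have := lin_comb1 b (fun=> 0) u lf; rewrite lin_f0 // add0r => <-.
by congr f; apply: boolp.funext => i; rewrite add0r.
Qed.

Lemma lin_fsum f (B : finType) (c : B -> R) (w : B -> I -> R) :
  lin f -> f (fun i => \sum_b c b * w b i) = \sum_b c b * f (w b).
Proof.
move=> [d hd]; rewrite hd; under eq_bigr do rewrite mulr_sumr.
rewrite exchange_big; apply: eq_bigr => b _; rewrite hd mulr_sumr.
by apply: eq_bigr => i _; ring.
Qed.

End Continuity.

(** * Exposed points near a point with a unique preimage *)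

Section ExposedPerturbation.
Variables (R : realType) (I J B : finType).
Variables (K : (I -> R) -> Prop) (A : (I -> R) -> J -> R).
Variables (t0 : I -> R) (tau : (I -> R) -> R) (w : B -> I -> R).
Hypotheses (closedK : eclosed K)
  (coneK : forall t u a b, K t -> K u -> 0 <= a -> 0 <= b ->
     K (fun i => a * t i + b * u i))
  (linA : forall j, lin (A^~ j)) (lin_tau : lin tau)
  (Kt0 : K t0)
  (uniq_t0 : forall t, K t -> (forall j, A t j = A t0 j) -> forall i, t i = t0 i)
  (tau_ge0 : forall t, K t -> 0 <= tau t)
  (tau_t0 : tau t0 = 0)
  (tau_face : forall t, K t -> tau t = 0 ->
     exists c : B -> R, forall i, t i = \sum_b c b * w b i).

Let dotJ (x y : J -> R) := \sum_j x j * y j.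
Let dst (t : I -> R) := \sum_i (t i - t0 i) ^+ 2.
Let dA (t : I -> R) j := A t j - A t0 j.
(** This form vanishes exactly on the vectors orthogonal to all [A (w b)]. Subtracting a multiple of
    it penalizes motion along the image of the face and leaves the transversal directions strictly
    convex. *)
Let h (x : J -> R) := \sum_b dotJ x (A (w b)) ^+ 2.

Let A_comb a b t u j : A (fun i => a * t i + b * u i) j = a * A t j + b * A u j.
Proof. exact: lin_comb a b t u (linA j). Qed.

Let A_comb1 b t u j : A (fun i => t i + b * u i) j = A t j + b * A u j.
Proof. exact: lin_comb1 b t u (linA j). Qed.

Let A_scale b u j : A (fun i => b * u i) j = b * A u j.
Proof. exact: lin_scale b u (linA j). Qed.

Let tau_comb a b t u : tau (fun i => a * t i + b * u i) = a * tau t + b * tau u.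
Proof. exact: lin_comb. Qed.

Let h_ge0 x : 0 <= h x.
Proof. by apply: sumr_ge0 => b _; apply: sqr_ge0. Qed.

Let dot_ge0 x : 0 <= dotJ x x.
Proof. by apply: sumr_ge0 => b _; rewrite -expr2 sqr_ge0. Qed.

Let dot_eq0 x : dotJ x x = 0 -> forall j, x j = 0.
Proof.
move=> /eqP; rewrite psumr_eq0; last by move=> j _; rewrite -expr2 sqr_ge0.
by move=> /allP x0 j; have /= := x0 j (mem_index_enum _); rewrite mulf_eq0 orbb => /eqP.
Qed.

Let dotC x y : dotJ x y = dotJ y x.
Proof. by apply: eq_bigr => j _; rewrite mulrC. Qed.

Let dotDZ x y a z : dotJ (fun j => x j + a * y j) z = dotJ x z + a * dotJ y z.
Proof. by rewrite mulr_sumr -big_split; apply: eq_bigr => j _ /=; ring. Qed.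

Let hDZ x y a : h (fun j => x j + a * y j) =
  h x + 2 * a * (\sum_b dotJ x (A (w b)) * dotJ y (A (w b))) + a ^+ 2 * h y.
Proof.
rewrite /h !mulr_sumr -!big_split; apply: eq_bigr => b _ /=.
by rewrite dotDZ; ring.
Qed.

Let dotDZ2 x y a : dotJ (fun j => x j + a * y j) (fun j => x j + a * y j) =
  dotJ x x + 2 * a * dotJ x y + a ^+ 2 * dotJ y y.
Proof.
by rewrite /dotJ !mulr_sumr -!big_split; apply: eq_bigr => j _ /=; ring.
Qed.

Let econt_dA j : econt (fun t => dA t j).
Proof. by apply: econtB; [exact: lin_econt|exact: econt_const]. Qed.

Let econt_dst : econt dst.
Proof.
apply: econt_sum => i; apply: econt_exp; apply: econtB; first exact: econt_coord.
exact: econt_const.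
Qed.

Let econt_dot a : econt (fun t => dotJ a (dA t)).
Proof.
apply: econt_sum => j; apply: econtM; [exact: econt_const|exact: econt_dA].
Qed.

Let econt_dot2 : econt (fun t => dotJ (dA t) (dA t)).
Proof. by apply: econt_sum => j; apply: econtM; exact: econt_dA. Qed.

Let econt_h : econt (fun t => h (dA t)).
Proof.
apply: econt_sum => b; apply: econt_exp; apply: econt_sum => j.
apply: econtM; [exact: econt_dA|exact: econt_const].
Qed.

Let dst_coord t i : (t i - t0 i) ^+ 2 <= dst t.
Proof.
by rewrite /dst (bigD1 i) //= lerDl sumr_ge0 // => k _; apply: sqr_ge0.
Qed.

Let dst_eq0 t : (forall i, t i = t0 i) -> dst t = 0.
Proof. by move=> tt; rewrite /dst big1 // => i _; rewrite tt subrr expr0n. Qed.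

Let bounded_ball r : 0 < r ->
  {b | forall t i, dst t <= r ^+ 2 -> `|t i| <= b}.
Proof.
move=> r0; exists (r + \sum_i `|t0 i|) => t i dt.
have -> : t i = (t i - t0 i) + t0 i by rewrite subrK.
apply: le_trans (ler_normD _ _) _; apply: lerD; last first.
  by rewrite (bigD1 i) //= lerDl sumr_ge0.
rewrite -(ler_pXn2r (n := 2)) ?nnegrE ?normr_ge0 ?(ltW r0) // real_normK ?num_real //.
exact: le_trans (dst_coord t i) dt.
Qed.

(* The image of t0 is separated from the compact convex image of the points
   with c <= tau by the nearest point of the latter. *)
Let separating r c : 0 < r -> 0 < c -> exists a g, 0 < g /\
  forall t, K t -> dst t <= r ^+ 2 -> c <= tau t -> dotJ a (dA t) <= - g.
Proof.
move=> r0 c0; pose C t := K t /\ (0 <= r ^+ 2 - dst t /\ 0 <= tau t - c).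
have clC : eclosed C.
  apply: eclosed_and => //; apply: eclosed_and; apply: eclosed_ge0.
    by apply: econtB => //; apply: econt_const.
  by apply: econtB; [exact: lin_econt|exact: econt_const].
have [bb hbb] := bounded_ball r0.
have bC t i : C t -> `|t i| <= bb.
  by move=> [_ [+ _]]; rewrite subr_ge0; apply: hbb.
have [ex|nex] := boolp.EM (exists t, C t); last first.
  exists (fun=> 0), 1; split=> // t Kt dt ct; case: nex; exists t.
  by rewrite /C !subr_ge0.
have [t1 [Kt1 [dt1 ct1]] min1] := EVT.extreme_value (econtN econt_dot2) clC ex bC.
pose g := dotJ (dA t1) (dA t1).
exists (fun j => - dA t1 j), g; split.
  (* If the nearest point were the image of [t0] itself, uniqueness would give [t1 = t0], against
     [tau t0 = 0 < c <= tau t1]. *)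
  rewrite lt_neqAle dot_ge0 andbT eq_sym; apply/eqP => g0.
  have e1 i : t1 i = t0 i.
    apply: uniq_t0 => // j; apply/eqP; rewrite -subr_eq0; apply/eqP.
    exact: (dot_eq0 g0).
  move: ct1; have -> : t1 = t0 by apply: boolp.funext.
  by rewrite tau_t0 sub0r oppr_ge0 leNgt c0.
move=> t Kt dt ct.
have -> : dotJ (fun j => - dA t1 j) (dA t) = - dotJ (dA t1) (dA t).
  by rewrite -sumrN; apply: eq_bigr => j _; rewrite mulNr.
rewrite lerN2.
pose x := dotJ (dA t1) (dA t); pose y := dotJ (dA t) (dA t).
rewrite -/x leNgt; apply/negP => xg.
(* moving from t1 towards t decreases the distance to first order *)
have conv l : 0 <= l -> l <= 1 ->
    g <= (1 - l) ^+ 2 * g + 2 * (1 - l) * l * x + l ^+ 2 * y.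
  move=> l0 l1; pose tl := fun i => (1 - l) * t1 i + l * t i.
  have dAtl j : dA tl j = (1 - l) * dA t1 j + l * dA t j.
    by rewrite /dA /tl A_comb; ring.
  have Ctl : C tl.
    split; first by apply: coneK => //; rewrite subr_ge0.
    split.
      move: dt dt1; rewrite !subr_ge0 => dt dt1.
      apply: (@le_trans _ _ ((1 - l) * dst t1 + l * dst t)); last by nra.
      rewrite /dst !mulr_sumr -big_split; apply: ler_sum => i _ /=.
      have -> : tl i - t0 i = (1 - l) * (t1 i - t0 i) + l * (t i - t0 i).
        by rewrite /tl; ring.
      set p := t1 i - _; set q := t i - _.
      have : 0 <= (1 - l) * l * (p - q) ^+ 2.
        by apply: mulr_ge0; [apply: mulr_ge0 => //; rewrite subr_ge0|apply: sqr_ge0].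
      by nra.
    by rewrite /tl tau_comb subr_ge0; move: ct1; rewrite subr_ge0; nra.
  have := min1 _ Ctl; rewrite lerN2 => /le_trans; apply.
  have -> : dotJ (dA tl) (dA tl) = \sum_j ((1 - l) * dA t1 j + l * dA t j) ^+ 2.
    by apply: eq_bigr => j _; rewrite dAtl expr2.
  rewrite /g /x /y /dotJ !mulr_sumr -!big_split /=.
  by apply: ler_sum => j _; rewrite le_eqVlt; apply/orP; left; apply/eqP; ring.
have g0 : 0 <= g := dot_ge0 _.
have y0 : 0 <= y := dot_ge0 _.
(* The denominator exceeds [g - 2 * x + y], the coefficient of [l ^+ 2] in the bound of [conv], so
   that bound is at most [g - l * (g - x) < g]. The summand [2 * (g - x)] keeps [l <= 1]. *)
pose l := (g - x) / (2 * (g - x) + g + y + 1).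
have D0 : 0 < 2 * (g - x) + g + y + 1 by lra.
have gx : 0 < g - x by lra.
have l0 : 0 < l by apply: divr_gt0.
have lD : l * (2 * (g - x) + g + y + 1) = g - x.
  by rewrite /l divfK // gt_eqF.
have l1 : l <= 1.
  by rewrite /l ler_pdivrMr // mul1r; lra.
have := conv l (ltW l0) l1.
have -> : (1 - l) ^+ 2 * g + 2 * (1 - l) * l * x + l ^+ 2 * y =
  g - l * (2 * (g - x)) + l * (l * (2 * (g - x) + g + y + 1) - l * (g + 1)) 
  + l * (l * (g + 1) - l * (g + 1)) - l ^+2 * g by ring.
rewrite lD; have := mulr_gt0 l0 gx; have := mulr_ge0 (ltW l0) g0.
by nra.
Qed.

(** By compactness it is enough that [tau] and [h] have no common zero on the sphere. At such a
    zero, [dA t] lies in the span of the [A (w b)] and is orthogonal to it, so [A t = A t0] and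
    uniqueness puts [t] at the centre. The factor 2 guarantees that one of the two terms is at least
    [c]. *)
Let slice_gap r : 0 < r -> exists2 c, 0 < c &
  forall t, K t -> dst t = r ^+ 2 -> 2 * c <= tau t + h (dA t).
Proof.
move=> r0; pose T t := K t /\ dst t = r ^+ 2.
have clT : eclosed T.
  by apply: eclosed_and => //; apply: eclosed_eq => //; exact: econt_const.
have [bb hbb] := bounded_ball r0.
have bT t i : T t -> `|t i| <= bb by move=> [_ dt]; apply: hbb; rewrite dt.
have cF : econt (fun t => tau t + h (dA t)).
  by apply: econtD => //; exact: lin_econt.
have [|c c0 hc] := evt_lower cF clT bT.
  move=> t [Kt dt]; rewrite lt_neqAle addr_ge0 ?tau_ge0 // andbT.
  apply/eqP => /esym/eqP; rewrite paddr_eq0 ?tau_ge0 // => /andP[/eqP tt0 /eqP ht0].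
  have [c1 hc1] := tau_face Kt tt0; have [c2 hc2] := tau_face Kt0 tau_t0.
  have dAE j : dA t j = \sum_b (c1 b - c2 b) * A (w b) j.
    rewrite /dA -(lin_sub t t0 (linA j)) -(lin_fsum (fun b => c1 b - c2 b) w (linA j)).
    congr (A _ j); apply: boolp.funext => i; rewrite hc1 hc2 -sumrB.
    by apply: eq_bigr => b _; rewrite mulrBl.
  have z : dotJ (dA t) (dA t) = 0.
    have -> : dotJ (dA t) (dA t) = \sum_b (c1 b - c2 b) * dotJ (dA t) (A (w b)).
      rewrite {1}/dotJ; under eq_bigr do rewrite {2}dAE mulr_sumr.
      rewrite exchange_big; apply: eq_bigr => b _; rewrite mulr_sumr.
      by apply: eq_bigr => j _; ring.
    move/eqP: ht0; rewrite psumr_eq0; last by move=> b _; apply: sqr_ge0.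
    move=> /allP hb; rewrite big1 // => b _.
    have /= := hb b (mem_index_enum _); rewrite sqrf_eq0 => /eqP ->.
    by rewrite mulr0.
  have := dst_eq0 (uniq_t0 Kt _); rewrite dt => /(_ _)/eqP.
  rewrite sqrf_eq0 gt_eqF // => H; apply: notF; apply: H => j.
  by apply/eqP; rewrite -subr_eq0; apply/eqP; exact: (dot_eq0 z).
exists (c / 2); first by rewrite divr_gt0.
by move=> t Kt dt; have -> : 2 * (c / 2) = c by [field]; apply: hc.
Qed.

(* Asplund's argument.  The functional tau exposes the minimal face of t0, which
   is spanned by the w b.  The maximum of a quadratic function of A t that is
   strictly convex transversally to the A (w b) yields t1, and eta is its
   gradient; the last clause is the second order condition at t1. *)
Lemma exposed_perturbation r : 0 < r -> exists t1 eta,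
  [/\ K t1, forall i, `|t1 i - t0 i| < r,
      forall t, K t -> \sum_j eta j * A t j <= 0,
      \sum_j eta j * A t1 j = 0 &
      forall u l, 0 < l -> K (fun i => t1 i + l * u i) ->
        \sum_j eta j * A u j = 0 ->
        (forall b, \sum_j A u j * A (w b) j = 0) -> forall j, A u j = 0].
Proof.
move=> r0; have [c c0 hc] := slice_gap r0.
have [a [g [g0 ha]]] := separating r0 c0.
have [bb hbb] := bounded_ball r0.
pose D t := K t /\ 0 <= r ^+ 2 - dst t.
have clD : eclosed D.
  apply: eclosed_and => //; apply: eclosed_ge0.
  by apply: econtB => //; exact: econt_const.
have bD t i : D t -> `|t i| <= bb by move=> [_]; rewrite subr_ge0; exact: hbb.
have [C1 C10 hC1] := evt_upper (econt_dot a) clD bD.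
have [C2 C20 hC2] := evt_upper econt_dot2 clD bD.
(* Chosen so that the convex term [rho * dotJ x x] is at most [g / 2] on the ball and cannot cancel
   the separation gap [g]. *)
pose rho := g / (2 * C2).
have rho0 : 0 < rho by rewrite divr_gt0 // mulr_gt0.
have rhoC : rho * C2 = g / 2.
  by rewrite /rho; field; rewrite gt_eqF.
(* Chosen so that the penalty [M * h] outweighs the other two terms as soon as [h >= c]. *)
pose M := (C1 + g / 2 + 1) / c.
have M0 : 0 < M by rewrite divr_gt0 //; lra.
have Mc : M * c = C1 + g / 2 + 1 by rewrite /M divfK // gt_eqF.
pose Q x := dotJ a x + rho * dotJ x x - M * h x.
have cQ : econt (fun t => Q (dA t)).
  apply: econtB; last by apply: econtM => //; exact: econt_const.
  by apply: econtD => //; apply: econtM => //; exact: econt_const.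
have Dt0 : D t0 by split=> //; rewrite dst_eq0 // subr0 sqr_ge0.
(* On the sphere either [tau >= c], and separation makes [Q] negative, or [h >= c], and the penalty
   does. As [Q] is 0 at [t0], the maximum over the closed ball is attained in its interior. *)
have QT t : K t -> dst t = r ^+ 2 -> Q (dA t) < 0.
  move=> Kt dt; have Dt : D t by split=> //; rewrite dt subrr.
  have h1 := hC1 _ Dt; have h2 := hC2 _ Dt.
  have h3 := hc _ Kt dt; have h4 := h_ge0 (dA t); have h5 := dot_ge0 (dA t).
  have h6 : rho * dotJ (dA t) (dA t) <= g / 2 by rewrite -rhoC ler_pM2l.
  rewrite /Q; have [le_c|lt_c] := leP c (tau t).
    have := ha t Kt _ le_c; rewrite dt => /(_ (lexx _)) h7.
    have := mulr_ge0 (ltW M0) h4; lra.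
  have h8 : c <= h (dA t) by lra.
  have : M * c <= M * h (dA t) by rewrite ler_pM2l.
  by rewrite Mc; lra.
have [t1 [Kt1 dt1] max1] := EVT.extreme_value cQ clD (ex_intro _ _ Dt0) bD.
have Q0 : Q (dA t0) = 0.
  have -> : dA t0 = fun=> 0 by apply: boolp.funext => j; rewrite /dA subrr.
  have z x : dotJ x (fun=> 0) = 0 by rewrite /dotJ big1 // => j _; rewrite mulr0.
  rewrite /Q !z /h big1 => [|b _]; first by rewrite mulr0 mulr0 addr0 subr0.
  by rewrite dotC z expr0n.
have dlt : dst t1 < r ^+ 2.
  rewrite lt_neqAle; move: dt1; rewrite subr_ge0 => ->; rewrite andbT.
  apply/eqP => e; have := QT _ Kt1 e; rewrite ltNge.
  by have := max1 _ Dt0; rewrite Q0 => ->.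
pose eta j := a j + 2 * rho * dA t1 j -
  2 * M * \sum_b dotJ (dA t1) (A (w b)) * A (w b) j.
have etaE x : \sum_j eta j * x j = dotJ a x + 2 * rho * dotJ (dA t1) x -
    2 * M * \sum_b dotJ (dA t1) (A (w b)) * dotJ x (A (w b)).
  have -> : \sum_b dotJ (dA t1) (A (w b)) * dotJ x (A (w b)) =
      \sum_j (\sum_b dotJ (dA t1) (A (w b)) * A (w b) j) * x j.
    under [RHS]eq_bigr do rewrite mulr_suml.
    rewrite exchange_big; apply: eq_bigr => b _; rewrite [dotJ x _]/dotJ mulr_sumr.
    by apply: eq_bigr => j _; ring.
  rewrite /eta; pose sb j := \sum_b dotJ (dA t1) (A (w b)) * A (w b) j.
  rewrite -/(sb _) [dotJ a x]/dotJ [dotJ (dA t1) x]/dotJ.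
  rewrite ![_ * \sum_(j : J) _]mulr_sumr -big_split -sumrB.
  by apply: eq_bigr => j _ /=; rewrite -/(sb j); ring.
have Qexp u l : Q (dA (fun i => t1 i + l * u i)) = Q (dA t1) +
    l * (\sum_j eta j * A u j) + l ^+ 2 * (rho * dotJ (A u) (A u) - M * h (A u)).
  have -> : dA (fun i => t1 i + l * u i) = fun j => dA t1 j + l * A u j.
    by apply: boolp.funext => j; rewrite /dA A_comb1; ring.
  by rewrite /Q hDZ dotDZ2 etaE (dotC a) dotDZ !(dotC _ a); ring.
(* By convexity, short steps from [t1] along [u] stay in the cone, and they stay in the ball since
   [t1] is interior; maximality bounds the exact second order expansion of [Q]. *)
have second u l : 0 < l -> K (fun i => t1 i + l * u i) -> exists2 l1, 0 < l1 &
    forall k, 0 < k -> k <= l1 ->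
    \sum_j eta j * A u j + k * (rho * dotJ (A u) (A u) - M * h (A u)) <= 0.
  move=> l0 Ku.
  have cdist : econt (fun t => r ^+ 2 - dst t) by apply: econtB => //; exact: econt_const.
  have [|d d0 hd] := cdist t1 (r ^+ 2 - dst t1); first by rewrite subr_gt0.
  pose m := 1 + \sum_i `|u i|.
  have m0 : 0 < m by rewrite ltr_pwDl // sumr_ge0.
  exists (Num.min l (d / (2 * m))) => [|k k0 kl].
    by rewrite lt_min l0 divr_gt0 // mulr_gt0.
  have [kl' kd] : k <= l /\ k <= d / (2 * m).
    by move: kl; rewrite le_min => /andP[].
  have Kk : K (fun i => t1 i + k * u i).
    have -> : (fun i => t1 i + k * u i) =
        fun i => (1 - k / l) * t1 i + (k / l) * (t1 i + l * u i).
      by apply: boolp.funext => i; field; rewrite gt_eqF.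
    apply: coneK => //; last by rewrite divr_ge0 // ?(ltW k0) ?(ltW l0).
    by rewrite subr_ge0 ler_pdivrMr // mul1r.
  have Dk : D (fun i => t1 i + k * u i).
    split=> //.
    have := hd (fun i => t1 i + k * u i) _.
    set X := r ^+ 2 - dst _; set Y := r ^+ 2 - dst _ => H.
    have : `|X - Y| < Y.
      apply: H => i; rewrite addrAC subrr add0r normrM gtr0_norm //.
      have ui : `|u i| <= m.
        by rewrite /m (bigD1 i) //= addrCA lerDl addr_ge0 // sumr_ge0.
      apply: le_lt_trans (_ : k * m < d); first by rewrite ler_pM2l.
      have := ler_pM2r m0 k (d / (2 * m)); rewrite kd => km.
      apply: le_lt_trans (_ : d / (2 * m) * m < d); first by rewrite km.
      have -> : d / (2 * m) * m = d / 2 by field; rewrite gt_eqF.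
      by lra.
    by rewrite ltr_norml => /andP[]; lra.
  have := max1 _ Dk; rewrite Qexp expr2.
  set p := \sum_j _; set q := rho * _ - _ => H.
  rewrite -(pmulr_rle0 _ k0); move: H; lra.
have first u l : 0 < l -> K (fun i => t1 i + l * u i) -> \sum_j eta j * A u j <= 0.
  move=> l0 Ku; have [l1 l10 hl1] := second _ _ l0 Ku.
  move: hl1; set p := \sum_j _; set q := rho * _ - _ => hl1.
  rewrite leNgt; apply/negP => p0.
  (* A step so short that the quadratic correction is smaller than the positive slope [p], which
     contradicts maximality. *)
  pose k := Num.min l1 (p / (2 * (1 + `|q|))).
  have q0 : 0 < 1 + `|q| by rewrite ltr_wpDr.
  have k0 : 0 < k by rewrite lt_min l10 divr_gt0 // mulr_gt0.
  have := hl1 k k0; rewrite ge_min lexx => /(_ isT).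
  have kp : k * (2 * (1 + `|q|)) <= p.
    by rewrite -ler_pdivlMr ?mulr_gt0 // ge_min lexx orbT.
  have : - `|q| <= q by rewrite lerNl -normrN ler_norm.
  by have := normr_ge0 q; nra.
have eta_le t : K t -> \sum_j eta j * A t j <= 0.
  move=> Kt; apply: (first t 1) => //.
  have -> : (fun i => t1 i + 1 * t i) = (fun i => 1 * t1 i + 1 * t i).
    by apply: boolp.funext => i; rewrite !mul1r.
  exact: coneK.
exists t1, eta; split=> //.
- move=> i; rewrite -(ltr_pXn2r (n := 2)) ?nnegrE ?normr_ge0 ?(ltW r0) //.
  by rewrite real_normK ?num_real // (le_lt_trans (dst_coord _ _)).
- apply/le_anti; rewrite eta_le //=.
  (* The point [t1] minus half of itself is in the cone, so [- t1] is an admissible direction and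
     gives the reverse inequality. *)
  have := first (fun i => - (1 * t1 i)) (1 / 2) _ _.
  have -> : \sum_j eta j * A (fun i => - (1 * t1 i)) j = - \sum_j eta j * A t1 j.
    rewrite -sumrN; apply: eq_bigr => j _.
    have -> : (fun i => - (1 * t1 i)) = fun i => (-1) * t1 i.
      by apply: boolp.funext => i; rewrite mul1r mulN1r.
    by rewrite A_scale mulN1r mulrN.
  rewrite oppr_le0; apply; first by lra.
  have -> : (fun i => t1 i + 1 / 2 * - (1 * t1 i)) = (fun i => (1/2) * t1 i + 0 * t1 i).
    by apply: boolp.funext => i; field.
  by apply: coneK => //; lra.
- move=> u l l0 Ku e0 ort.
  (* The slope and the penalty both vanish in this direction; only [rho * dotJ (A u) (A u)] is left,
     and maximality makes it nonpositive. *)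
  have h0 : h (A u) = 0 by rewrite /h big1 // => b _; rewrite /dotJ ort expr0n.
  have [l1 l10 hl1] := second _ _ l0 Ku.
  have := hl1 l1 l10 (lexx _); rewrite e0 h0 mulr0 subr0 add0r.
  rewrite pmulr_rle0 // pmulr_rle0 // => n0.
  by apply: dot_eq0; apply/le_anti; rewrite n0 dot_ge0.
Qed.

End ExposedPerturbation.

(** * Coefficients of quantifier elimination *)

Module QECoefficients.
Import ordered_qelim.ord qe_rcf_th qe_rcf.

Section Coefficients.
Variables (R : realType) (K : R -> Prop).
Hypothesis fieldK : is_subfield K.

Lemma subfield0 : K 0. Proof. by case: fieldK. Qed.
Lemma subfield1 : K 1. Proof. by case: fieldK => _ []. Qed.
Lemma subfieldB x y : K x -> K y -> K (x - y).
Proof. by case: fieldK => _ [_ [+ _]]; apply. Qed.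
Lemma subfieldM x y : K x -> K y -> K (x * y).
Proof. by case: fieldK => _ [_ [_ [+ _]]]; apply. Qed.
Lemma subfieldV x : K x -> K x^-1.
Proof. by case: fieldK => _ [_ [_ [_]]]; apply. Qed.
Lemma subfieldN x : K x -> K (- x).
Proof. by move=> Kx; rewrite -sub0r; apply: subfieldB => //; apply: subfield0. Qed.
Lemma subfieldD x y : K x -> K y -> K (x + y).
Proof.
by move=> Kx Ky; rewrite -[y]opprK; apply: subfieldB => //; apply: subfieldN.
Qed.
Lemma subfield_nat n : K n%:R.
Proof.
elim: n => [|n IHn]; first exact: subfield0.
by rewrite -natr1; apply: subfieldD => //; apply: subfield1.
Qed.
Lemma subfield_int (m : int) : K m%:~R.
Proof.
case: m => n; first exact: subfield_nat.
by rewrite NegzE mulrNz; apply: subfieldN; apply: (subfield_nat n.+1).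
Qed.
Lemma subfield_rat (x : rat) : K (ratr x).
Proof.
by rewrite /ratr; apply: subfieldM; [|apply: subfieldV]; apply: subfield_int.
Qed.

(** A [Prop]-valued counterpart of [all], because membership in [K] is not a boolean. *)
Fixpoint Pall T (P : T -> Prop) (s : seq T) : Prop :=
  if s is x :: s' then P x /\ Pall P s' else Logic.True.

Lemma Pall_cat T (P : T -> Prop) s1 s2 :
  Pall P s1 -> Pall P s2 -> Pall P (cat s1 s2).
Proof. by elim: s1 => //= x s1 IH [Px /IH h] /h. Qed.

Lemma Pall_map T U (P : T -> Prop) (Q : U -> Prop) (f : T -> U) s :
  (forall x, P x -> Q (f x)) -> Pall P s -> Pall Q (map f s).
Proof. by move=> PQ; elim: s => //= x s IH [/PQ ? /IH]. Qed.

Lemma Pall_nth T (P : T -> Prop) x0 s i : P x0 -> Pall P s -> P (nth x0 s i).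
Proof. by move=> P0; elim: s i => [|x s IH] [|i] //= [Px Ps] //; apply: IH. Qed.

Lemma Pall_mem (T : eqType) (P : T -> Prop) s :
  (forall x, x \in s -> P x) -> Pall P s.
Proof.
elim: s => //= x s IH h; split; first by apply: h; rewrite mem_head.
by apply: IH => y ys; apply: h; rewrite in_cons ys orbT.
Qed.

Lemma Pall_in (T : eqType) (P : T -> Prop) s x : Pall P s -> x \in s -> P x.
Proof.
by elim: s => //= y s IH [Py Ps]; rewrite in_cons => /orP[/eqP ->|/IH]; auto.
Qed.

(** * Constants in the root counting procedure *)

Fixpoint goodt (t : term R) : Prop :=
  match t with
  | Var _ => Logic.True
  | Const c => K c
  | NatConst _ => Logic.True
  | Add u v => goodt u /\ goodt v
  | Opp u => goodt u
  | NatMul u _ => goodt u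
  | Mul u v => goodt u /\ goodt v
  | Exp u _ => goodt u
  end.

Fixpoint goodf (f : formula R) : Prop :=
  match f with
  | Bool _ => Logic.True
  | Equal u v => goodt u /\ goodt v
  | Lt u v => goodt u /\ goodt v
  | Le u v => goodt u /\ goodt v
  | And f g => goodf f /\ goodf g
  | Or f g => goodf f /\ goodf g
  | Implies f g => goodf f /\ goodf g
  | Not f => goodf f
  end.

Local Notation goodp := (Pall goodt).

(** The procedure is written in continuation-passing style, which fixes the shape of the following
    lemmas: if the continuation yields formulas over [K] on every result that can be passed to it,
    so does the whole step. *)
Lemma good_Size p k : goodp p -> (forall n, goodf (k n)) -> goodf (Size p k).
Proof.
elim: p k => [|c p IH] k //= [gc gp] gk; rewrite /bind_def; apply: IH => //.
by case=> //=; do !split.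
Qed.

Lemma good_Isnull p k : goodp p -> (forall n, goodf (k n)) -> goodf (Isnull p k).
Proof. by move=> gp gk; apply: good_Size. Qed.

Lemma good_LtSize p q k : goodp p -> goodp q -> (forall n, goodf (k n)) ->
  goodf (LtSize p q k).
Proof. by move=> gp gq gk; apply: good_Size => // n; apply: good_Size. Qed.

Lemma good_LeadCoef p k : goodp p -> (forall t, goodt t -> goodf (k t)) ->
  goodf (LeadCoef p k).
Proof.
elim: p k => [|c p IH] k /= gp gk; first by apply: gk; apply: subfield0.
case: gp => gc gp; rewrite /bind_def; apply: IH => // t gt /=.
by do !split => //; apply: gk.
Qed.

Lemma good_AmulXn a n : goodt a -> goodp (AmulXn a n).
Proof. by move=> ga; elim: n => //= n IH; split=> //; apply: subfield0. Qed.

Lemma good_AddPoly p q : goodp p -> goodp q -> goodp (AddPoly p q).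
Proof.
elim: p q => //= a p IH [|b q] //= [ga gp] [gb gq]; do !split => //.
exact: IH.
Qed.

Lemma good_ScalPoly c p : goodt c -> goodp p -> goodp (ScalPoly c p).
Proof. by move=> gc; apply: Pall_map => t gt; split. Qed.

Lemma good_MulPoly p q : goodp p -> goodp q -> goodp (MulPoly p q).
Proof.
elim: p q => //= a p IH q [ga gp] gq; apply: good_AddPoly.
  exact: good_ScalPoly.
by split=> //; apply: IH.
Qed.

Lemma good_ExpPoly p n : goodp p -> goodp (ExpPoly p n).
Proof.
move=> gp; case: n => [|n]; first by do !split.
by rewrite /ExpPoly /iterop; elim: n => //= n IH; apply: good_MulPoly.
Qed.

Lemma good_OppPoly p : goodp p -> goodp (OppPoly p).
Proof.
by apply: good_ScalPoly; apply: subfieldN; apply: subfield1.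
Qed.

Lemma good_NatMulPoly n p : goodp p -> goodp (NatMulPoly n p).
Proof. exact: good_ScalPoly. Qed.

Lemma good_Deriv p : goodp p -> goodp (Deriv p).
Proof.
by elim: p => //= a p IH [ga gp]; apply: good_AddPoly => //; split=> //; apply: IH.
Qed.

Lemma good_Rediv_rec_loop q sq cq c qq r n k :
  goodp q -> goodt cq -> goodp qq -> goodp r ->
  (forall c qq r, goodp qq -> goodp r -> goodf (k (c, qq, r))) ->
  goodf (Rediv_rec_loop q sq cq c qq r n k).
Proof.
move=> gq gcq + + gk; elim: n c qq r => [|n IH] c qq r gqq gr /=;
  rewrite /bind_def; apply: good_Size => // sr; case: ifP => _; try exact: gk;
  apply: good_LeadCoef => // lr glr; [apply: gk|apply: IH];
  do ?[apply: good_AddPoly|apply: good_MulPoly|apply: good_OppPoly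
      |apply: good_AmulXn|by []].
Qed.

Lemma good_Rediv p q k : goodp p -> goodp q ->
  (forall c qq r, goodp qq -> goodp r -> goodf (k (c, qq, r))) ->
  goodf (Rediv p q k).
Proof.
move=> gp gq gk; apply: good_Isnull => // -[].
  by apply: gk => //=; split=> //; apply: subfield0.
apply: good_Size => // sq; apply: good_Size => // sp.
apply: good_LeadCoef => // lq glq; apply: good_Rediv_rec_loop => //=.
by split=> //; apply: subfield0.
Qed.

Lemma good_Rmod p q k : goodp p -> goodp q ->
  (forall r, goodp r -> goodf (k r)) -> goodf (Rmod p q k).
Proof. by move=> gp gq gk; apply: good_Rediv => // c qq r _; apply: gk. Qed.

Lemma good_Rscal p q k : goodp p -> goodp q ->
  (forall r, goodf (k r)) -> goodf (Rscal p q k).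
Proof. by move=> gp gq gk; apply: good_Rediv => // c qq r _ _; apply: gk. Qed.

Lemma good_Rgcd_loop n p q k : goodp p -> goodp q ->
  (forall r, goodp r -> goodf (k r)) -> goodf (Rgcd_loop n p q k).
Proof.
elim: n p q => [|n IH] p q gp gq gk /=; rewrite /bind_def;
  apply: good_Rmod => // r gr; apply: good_Isnull => // -[]; try exact: gk.
exact: IH.
Qed.

Lemma good_Rgcd p q k : goodp p -> goodp q ->
  (forall r, goodp r -> goodf (k r)) -> goodf (Rgcd p q k).
Proof.
move=> gp gq gk; apply: good_LtSize => // -[]; apply: good_Isnull => // -[];
  try exact: gk; apply: good_Size => // n; exact: good_Rgcd_loop.
Qed.

Lemma good_BigRgcd ps k : Pall goodp ps ->
  (forall r, goodp r -> goodf (k r)) -> goodf (BigRgcd ps k).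
Proof.
elim: ps k => [|p ps IH] k /= => [_|[gp gps]] gk.
  by apply: gk => /=; split=> //; apply: subfield0.
by apply: IH => // r gr; apply: good_Rgcd.
Qed.

Lemma good_Changes s k : goodp s -> (forall n, goodf (k n)) ->
  goodf (Changes s k).
Proof.
elim: s k => [|a s IH] k //= [ga gs] gk; apply: IH => // v.
suff : goodt (head 0%qfT s) by do !split.
by case: (s) gs => //= b ? [].
Qed.

Lemma good_SeqPInfty ps k : Pall goodp ps ->
  (forall s, goodp s -> goodf (k s)) -> goodf (SeqPInfty ps k).
Proof.
elim: ps k => [|p ps IH] k /= => [_|[gp gps]] gk; first exact: gk.
by apply: good_LeadCoef => // l gl; apply: IH => // ls gls; apply: gk.
Qed.

Lemma good_SeqMInfty ps k : Pall goodp ps ->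
  (forall s, goodp s -> goodf (k s)) -> goodf (SeqMInfty ps k).
Proof.
elim: ps k => [|p ps IH] k /= => [_|[gp gps]] gk; first exact: gk.
apply: good_LeadCoef => // l gl; apply: good_Size => // n.
apply: IH => // ls gls; apply: gk; do !split => //.
by apply: subfieldN; apply: subfield1.
Qed.

Lemma good_ChangesPoly ps k : Pall goodp ps -> (forall n, goodf (k n)) ->
  goodf (ChangesPoly ps k).
Proof.
move=> gps gk; apply: good_SeqMInfty => // mps gm.
apply: good_SeqPInfty => // pps gpp.
by apply: good_Changes => // v; apply: good_Changes.
Qed.

Lemma good_NextMod p q k : goodp p -> goodp q ->
  (forall r, goodp r -> goodf (k r)) -> goodf (NextMod p q k).
Proof.
move=> gp gq gk; apply: good_LeadCoef => // l gl; apply: good_Rscal => // n.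
by apply: good_Rmod => // r gr; apply: gk; apply: good_ScalPoly.
Qed.

Lemma good_ModsAux p q n k : goodp p -> goodp q ->
  (forall r, Pall goodp r -> goodf (k r)) -> goodf (ModsAux p q n k).
Proof.
elim: n p q k => [|n IH] p q k gp gq gk /=; first exact: gk.
apply: good_Isnull => // -[]; first exact: gk.
apply: good_NextMod => // r gr; apply: IH => // s gs.
by apply: gk; split.
Qed.

Lemma good_Mods p q k : goodp p -> goodp q ->
  (forall r, Pall goodp r -> goodf (k r)) -> goodf (Mods p q k).
Proof.
by move=> gp gq gk; do 2!(apply: good_Size => // ?); apply: good_ModsAux.
Qed.

Lemma good_PolyComb sq sc : Pall goodp sq -> goodp (PolyComb sq sc).
Proof.
move=> gs; rewrite /PolyComb; elim: iota => [|i s IH] /=; first by split.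
apply: good_MulPoly => //; apply: good_ExpPoly.
exact: (Pall_nth (P := goodp)).
Qed.

Lemma good_Pcq sq i : Pall goodp sq -> goodp (Pcq sq i).
Proof.
move=> gs; rewrite /Pcq; apply: (Pall_nth (P := goodp)) => //.
by elim: sg_tab => //= x s IH; split=> //; apply: good_PolyComb.
Qed.

Lemma good_TaqR p q k : goodp p -> goodp q -> (forall n, goodf (k n)) ->
  goodf (TaqR p q k).
Proof.
move=> gp gq gk; apply: good_Mods => // [|r gr].
  by apply: good_MulPoly => //; apply: good_Deriv.
exact: good_ChangesPoly.
Qed.

Lemma good_TaqsR p sq i k : goodp p -> Pall goodp sq ->
  (forall t, goodt t -> goodf (k t)) -> goodf (TaqsR p sq i k).
Proof.
move=> gp gq gk; apply: good_TaqR => //; first exact: good_Pcq.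
by move=> n; apply: gk; apply: subfield_int.
Qed.

Lemma good_BoundingPoly sq : Pall goodp sq -> goodp (BoundingPoly sq).
Proof.
move=> gs; apply: good_Deriv; elim: sq gs => [|p s IH] /= => [|[gp gs]].
  by split.
by apply: good_MulPoly => //; apply: IH.
Qed.

(* The coefficients are entries of the inverse of an integer matrix. *)
Lemma good_coefs n i : K (coefs R n i).
Proof.
rewrite /coefs; apply: (Pall_nth (P := K)); first exact: subfield0.
apply: (Pall_map (P := fun=> Logic.True)) => [j _|]; last by elim: (enum _) => //=.
rewrite castmxE.
have -> : map_mx (intr : int -> R) (ctmat n) =
    map_mx (ratr : rat -> R) (map_mx (intr : int -> rat) (ctmat n)).
  by apply/matrixP => a b; rewrite !mxE ratr_int.
by rewrite -map_invmx mxE; apply: subfield_rat.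
Qed.

Lemma good_Coefs n i : goodt (Coefs R n i).
Proof.
case: n => [|[|n]] /=; first exact: subfield_nat; last exact: good_coefs.
apply: (Pall_nth (P := K)) => /=; first exact: subfield0.
have K2 : K 2^-1 by apply: subfieldV; exact: (subfield_nat 2).
by do !split => //; exact: subfield0.
Qed.

Lemma good_CcountWeak p sq k : goodp p -> Pall goodp sq ->
  (forall t, goodt t -> goodf (k t)) -> goodf (CcountWeak p sq k).
Proof.
move=> gp gs gk; rewrite /CcountWeak.
have : goodt (0%qfT : term R) by [].
move: 0%qfT; elim: (3 ^ _)%N => [|n IH] s gs' /=; first exact: gk.
apply: good_TaqsR => // x gx; apply: IH => //=; do !split => //.
exact: good_Coefs.
Qed.

Lemma good_CcountGt0 sp sq : Pall goodp sp -> Pall goodp sq ->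
  goodf (CcountGt0 sp sq).
Proof.
move=> gsp gsq; apply: good_BigRgcd => // p gp; apply: good_Isnull => // -[] /=.
  apply: good_CcountWeak => //; first exact: good_BoundingPoly.
  move=> t gt /=; do !split => //.
    elim: (sq) gsq => //= q s IH [gq gs]; split; last exact: IH.
    by apply: good_LeadCoef.
  elim: (sq) gsq => //= q s IH [gq gs]; split; last exact: IH.
  by apply: good_Size => // n; apply: good_LeadCoef.
by apply: good_CcountWeak.
Qed.

Lemma good_abstrX i t : goodt t -> goodp (abstrX i t).
Proof.
elim: t => //=.
- by move=> n _; case: ifP.
- by move=> a IHa b IHb [/IHa ga /IHb gb]; apply: good_AddPoly.
- by move=> a IHa /IHa ga; apply: good_OppPoly.
- by move=> a IHa n /IHa ga; apply: good_NatMulPoly.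
- by move=> a IHa b IHb [/IHa ga /IHb gb]; apply: good_MulPoly.
- by move=> a IHa n /IHa ga; apply: good_ExpPoly.
Qed.

(** * Constants in general formulas and in the elimination *)

Fixpoint goodT (t : GRing.term R) : Prop :=
  match t with
  | GRing.Var _ => Logic.True
  | GRing.Const c => K c
  | GRing.NatConst _ => Logic.True
  | GRing.Add u v => goodT u /\ goodT v
  | GRing.Opp u => goodT u
  | GRing.NatMul u _ => goodT u
  | GRing.Mul u v => goodT u /\ goodT v
  | GRing.Inv u => goodT u
  | GRing.Exp u _ => goodT u
  end.

Fixpoint goodF (f : ordered_qelim.ord.formula R) : Prop :=
  match f with
  | ordered_qelim.ord.Bool _ => Logic.True
  | ordered_qelim.ord.Equal u v => goodT u /\ goodT v
  | ordered_qelim.ord.Lt u v => goodT u /\ goodT v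
  | ordered_qelim.ord.Le u v => goodT u /\ goodT v
  | ordered_qelim.ord.Unit u => goodT u
  | ordered_qelim.ord.And f g => goodF f /\ goodF g
  | ordered_qelim.ord.Or f g => goodF f /\ goodF g
  | ordered_qelim.ord.Implies f g => goodF f /\ goodF g
  | ordered_qelim.ord.Not f => goodF f
  | ordered_qelim.ord.Exists _ f => goodF f
  | ordered_qelim.ord.Forall _ f => goodF f
  end.

Lemma good_rterm t : goodt t -> goodT (rterm_to_term t).
Proof.
elim: t => //=.
- by move=> a IHa b IHb [/IHa ga /IHb gb]; split.
- by move=> a IHa b IHb [/IHa ga /IHb gb]; split.
Qed.

Lemma good_qfr f : goodf f -> goodF (qfr_to_formula f).
Proof.
elim: f => //= [t u [] *|t u [] *|t u [] *|f If g Ig [] *|f If g Ig [] *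
  |f If g Ig [] *]; split; by [exact: good_rterm|exact: If|exact: Ig].
Qed.

Lemma good_to_rterm t : goodT t -> goodt (to_rterm t).
Proof.
elim: t => //=.
- by move=> a IHa b IHb [/IHa ga /IHb gb]; split.
- by move=> a IHa b IHb [/IHa ga /IHb gb]; split.
Qed.

Lemma good_wproj n s : Pall goodT (fst s) -> Pall goodT (snd s) ->
  goodF (qfr_to_formula (wproj n s)).
Proof.
move=> g1 g2; apply: good_qfr; apply: good_CcountGt0;
  (apply: Pall_map; last eassumption);
  by move=> t gt /=; apply: good_abstrX; apply: good_to_rterm.
Qed.

Definition goodC (c : oclause R) := Pall goodT (terms_of_oclause c).

Lemma goodCE a b c d : goodC (Oclause a b c d) <->
  [/\ Pall goodT a, Pall goodT b, Pall goodT c & Pall goodT d].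
Proof.
rewrite /goodC /=; split => [h|[ga gb gc gd]]; last by do !apply: Pall_cat.
by split; apply: Pall_mem => x xs; apply: (Pall_in h); rewrite !mem_cat xs ?orbT.
Qed.

Lemma good_and_odnf s1 s2 : Pall goodC s1 -> Pall goodC s2 ->
  Pall goodC (and_odnf s1 s2).
Proof.
move=> g1 g2; rewrite /and_odnf; elim: s1 g1 => [_|c s1 IH /= [gc gs]].
  by rewrite big_nil.
rewrite big_cons; apply: Pall_cat; last exact: IH.
apply: Pall_map g2 => -[a2 b2 c2 d2]; case: c gc => a b c d.
by move=> /goodCE[????] /goodCE[????]; apply/goodCE; split; apply: Pall_cat.
Qed.

Lemma good_qf_to_odnf f neg : goodF f -> Pall goodC (qf_to_odnf f neg).
Proof.
elim: f neg => //=.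
- by move=> b neg _; case: (b (+) neg).
- by move=> u v [] [gu gv] /=; do !split.
- by move=> u v [] [gu gv] /=; do !split.
- by move=> u v [] [gu gv] /=; do !split.
- by move=> u [] _ /=; do !split.
- move=> f If g Ig [] [gf gg]; first by apply: Pall_cat; [apply: If|apply: Ig].
  by apply: good_and_odnf; [apply: If|apply: Ig].
- move=> f If g Ig [] [gf gg]; last by apply: Pall_cat; [apply: If|apply: Ig].
  by apply: good_and_odnf; [apply: If|apply: Ig].
- move=> f If g Ig [] [gf gg]; last by apply: Pall_cat; [apply: If|apply: Ig].
  by apply: good_and_odnf; [apply: If|apply: Ig].
- by move=> f If neg gf; apply: If.
- by move=> n f If [] _ /=; do !split.
- by move=> n f If [] _ /=; do !split.
Qed.

Lemma good_oclause_to_w c : goodC c ->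
  Pall (fun s => Pall goodT (fst s) /\ Pall goodT (snd s)) (oclause_to_w c).
Proof.
move=> gc; rewrite /oclause_to_w.
(* Eliminating disequalities and weak inequalities creates no terms but the old ones and negations
   of those in the list of disequalities. *)
have : Pall goodC (oclause_neq_leq_elim c).
  apply: Pall_mem => c' /terms_of_neq_leq_elim sub; apply: Pall_mem => t /sub.
  rewrite mem_cat => /orP[/(Pall_in gc)//|/mapP[u uc ->]] /=.
  by case: c gc {sub} uc => a b d e /goodCE[_ gb _ _] /= /(Pall_in gb).
by apply: Pall_map => -[a b d e] /goodCE[].
Qed.

Lemma good_foldr_Or fs : Pall goodF fs ->
  goodF (foldr (@ordered_qelim.ord.Or R) (ordered_qelim.ord.Bool false) fs).
Proof. by elim: fs => //= f fs IH [gf gfs]; split=> //; apply: IH. Qed.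

Lemma good_quantifier_elim f : goodF f ->
  goodF (quantifier_elim (fun n s => qfr_to_formula (wproj n s)) f).
Proof.
have aux n g : goodF g -> goodF (foldr (@ordered_qelim.ord.Or R)
    (ordered_qelim.ord.Bool false)
    (map (proj (fun n s => qfr_to_formula (wproj n s)) n) (qf_to_odnf g false))).
  move=> gg; apply: good_foldr_Or; apply: Pall_map (good_qf_to_odnf false gg).
  move=> c gc; rewrite /proj; apply: good_foldr_Or.
  by apply: Pall_map (good_oclause_to_w gc) => s []; apply: good_wproj.
elim: f => //=.
- by move=> f If g Ig [/If gf /Ig gg].
- by move=> f If g Ig [/If gf /Ig gg].
- by move=> f If g Ig [/If gf /Ig gg].
- by move=> n f If /If gf; apply: aux.
- by move=> n f If /If gf; apply: (aux n (ordered_qelim.ord.Not _)).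
Qed.

Lemma qe_over (f : ordered_qelim.ord.formula R) :
  rformula f -> goodF f -> exists g,
  [/\ qf_form g, rformula g, goodF g & forall e, holds e f <-> ordered_qelim.ord.qf_eval e g].
Proof.
move=> rf gf; exists (quantifier_elim (fun n s => qfr_to_formula (wproj n s)) f).
have wf := @wf_QE_wproj R; have val := @valid_QE_wproj R.
have /andP[q r] := quantifier_elim_wf wf rf.
split=> //; first exact: good_quantifier_elim.
move=> e; split=> [h|].
  by apply/(quantifier_elim_rformP wf val e rf).
by move/(quantifier_elim_rformP wf val e rf).
Qed.

End Coefficients.
End QECoefficients.

(** * Definable sets and generic points *)

Section Definability.
Variables (R : realType) (K : R -> Prop).
Implicit Types (I J : finType).

Definition env J (x : J -> R) : seq R := map x (enum J).

Lemma nth_env J (x : J -> R) j : nth 0 (env x) (enum_rank j) = x j.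
Proof.
by rewrite /env (nth_map j) ?nth_enum_rank // -cardE ltn_ord.
Qed.

Lemma size_env J (x : J -> R) : size (env x) = #|J|.
Proof. by rewrite size_map -cardE. Qed.

(** The variables of [J] keep their positions and those of [I] follow, so a block of quantifiers
    over [I] binds precisely the indices after those of [J]. *)
Lemma env_sum I J (z : J + I -> R) :
  env z = env (fun j => z (inl j)) ++ env (fun i => z (inr i)).
Proof.
rewrite /env; have -> : enum {: J + I} = map inl (enum J) ++ map inr (enum I).
  by rewrite !enumT [in LHS]unlock.
by rewrite map_cat -!map_comp.
Qed.

Lemma env_inv I (s : seq R) : size s = #|I| -> exists y : I -> R, env y = s.
Proof.
move=> sz; exists (fun i => nth 0 s (enum_rank i)).
apply: (@eq_from_nth _ 0); first by rewrite size_env.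
move=> k; rewrite size_env => kI.
by rewrite -{1}[k]/(val (Ordinal kI)) -[Ordinal kI]enum_valK nth_env enum_valK.
Qed.

(** The condition [rterm] excludes inverses, so these are the polynomial functions with coefficients
    from [K] and the integers. *)
Definition polyfun J (g : (J -> R) -> R) := exists t : GRing.term R,
  [/\ GRing.rterm t, QECoefficients.goodT K t &
      forall x, GRing.eval (env x) t = g x].

Definition definable J (S : (J -> R) -> Prop) :=
  exists f : ordered_qelim.ord.formula R,
  [/\ ordered_qelim.ord.rformula f, QECoefficients.goodF K f &
      forall x, S x <-> ordered_qelim.ord.holds (env x) f].

(** * Closure properties of definable sets *)

Section Combinators.
Variable J : finType.
Implicit Types (g h : (J -> R) -> R) (S T : (J -> R) -> Prop).

Lemma polyfun_ext g h : g =1 h -> polyfun g -> polyfun h.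
Proof. by move=> gh [t [r k e]]; exists t; split=> // x; rewrite e. Qed.

Lemma polyfun_var j : polyfun (fun x : J -> R => x j).
Proof.
by exists (GRing.Var _ (enum_rank j)); split=> // x; rewrite /= nth_env.
Qed.

Lemma polyfun_nat n : polyfun (fun _ : J -> R => n%:R).
Proof. by exists (GRing.NatConst _ n). Qed.

Lemma polyfunD g h : polyfun g -> polyfun h -> polyfun (fun x => g x + h x).
Proof.
move=> [t [r k e]] [t' [r' k' e']]; exists (GRing.Add t t'); split=> //=.
- by rewrite r r'.
- by move=> x; rewrite e e'.
Qed.

Lemma polyfunM g h : polyfun g -> polyfun h -> polyfun (fun x => g x * h x).
Proof.
move=> [t [r k e]] [t' [r' k' e']]; exists (GRing.Mul t t'); split=> //=.
- by rewrite r r'.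
- by move=> x; rewrite e e'.
Qed.

Lemma polyfunN g : polyfun g -> polyfun (fun x => - g x).
Proof.
by move=> [t [r k e]]; exists (GRing.Opp t); split=> //= x; rewrite e.
Qed.

Lemma polyfunB g h : polyfun g -> polyfun h -> polyfun (fun x => g x - h x).
Proof. by move=> pg ph; apply: polyfunD => //; apply: polyfunN. Qed.

Lemma polyfun_int (z : int) : polyfun (fun _ : J -> R => z%:~R).
Proof.
case: z => n; first exact: polyfun_nat.
apply: polyfun_ext (polyfunN (polyfun_nat n.+1)) => x.
by rewrite NegzE mulrNz.
Qed.

Lemma polyfun_sum (A : Type) (s : seq A) (P : pred A) (F : A -> (J -> R) -> R) :
  (forall a, polyfun (F a)) -> polyfun (fun t => \sum_(a <- s | P a) F a t).
Proof.
move=> cF; elim: s => [|a s IHs].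
  by apply: polyfun_ext (polyfun_nat 0) => t; rewrite big_nil.
case Pa: (P a).
  by apply: polyfun_ext (polyfunD (cF a) IHs) => t; rewrite big_cons Pa.
by apply: polyfun_ext IHs => t; rewrite big_cons Pa.
Qed.

Lemma definable_ext S T : (forall x, S x <-> T x) -> definable S -> definable T.
Proof.
by move=> ST [f [r k e]]; exists f; split=> // x; rewrite -ST.
Qed.

Lemma definable_eq g h : polyfun g -> polyfun h -> definable (fun x => g x = h x).
Proof.
move=> [t [r k e]] [t' [r' k' e']]; exists (ordered_qelim.ord.Equal t t').
by split=> [|//|x] /=; rewrite ?r ?r' ?e ?e'.
Qed.

Lemma definable_le g h : polyfun g -> polyfun h -> definable (fun x => g x <= h x).
Proof.
move=> [t [r k e]] [t' [r' k' e']]; exists (ordered_qelim.ord.Le t t').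
by split=> [|//|x] /=; rewrite ?r ?r' ?e ?e'.
Qed.

Lemma definable_and S T : definable S -> definable T ->
  definable (fun x => S x /\ T x).
Proof.
move=> [t [r k e]] [t' [r' k' e']]; exists (ordered_qelim.ord.And t t').
by split=> [|//|x] /=; rewrite ?r ?r' ?e ?e'.
Qed.

Lemma definable_imp S T : definable S -> definable T ->
  definable (fun x => S x -> T x).
Proof.
move=> [t [r k e]] [t' [r' k' e']]; exists (ordered_qelim.ord.Implies t t').
by split=> [|//|x] /=; rewrite ?r ?r' ?e ?e'.
Qed.

Lemma definable_true : definable (fun _ : J -> R => True).
Proof. by exists (ordered_qelim.ord.Bool true). Qed.

Lemma definable_impb (b : bool) S : (b -> definable S) ->
  definable (fun x => b -> S x).
Proof.
case: b => dS; first by apply: definable_ext (dS isT) => x; split; auto.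
by apply: definable_ext definable_true => x; split.
Qed.

Lemma definable_forallF I (S : I -> (J -> R) -> Prop) :
  (forall i, definable (S i)) -> definable (fun x => forall i, S i x).
Proof.
move=> dS.
suff /(_ (enum I)) : forall s : seq I, definable (fun x => forall i, i \in s -> S i x).
  apply: definable_ext => x; split=> h i; last by move=> _; apply: h.
  by apply: h; rewrite mem_enum.
elim=> [|i s IHs]; first by apply: definable_ext definable_true => x; split.
apply: definable_ext (definable_and (dS i) IHs) => x; split.
  by move=> [h1 h2] k; rewrite in_cons => /orP[/eqP ->|/h2].
by move=> h; split=> [|k ks]; apply: h; rewrite in_cons ?eqxx ?ks ?orbT.
Qed.

Lemma definable_not S : definable S -> definable (fun x => ~ S x).
Proof.
move=> [t [r k e]]; exists (ordered_qelim.ord.Not t).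
by split=> // x /=; rewrite e.
Qed.

End Combinators.

(** Each quantifier binds the first index beyond the current environment, so assigning a value
    appends one entry. *)
Lemma holds_exists_block m (e : seq R) f :
  ordered_qelim.ord.holds e
    (foldr (@ordered_qelim.ord.Exists R) f (iota (size e) m)) <->
  exists2 s, size s = m & ordered_qelim.ord.holds (e ++ s) f.
Proof.
elim: m e => [|m IH] e /=.
  split=> [h|[s /size0nil ->]]; last by rewrite cats0.
  by exists [::]; rewrite ?cats0.
have setE x : set_nth 0 e (size e) x = rcons e x.
  by elim: e {IH} => //= a e ->.
split=> [[x]|[[|x s] //= [sz] h]].
  rewrite setE -(size_rcons e x) => /IH[s sz h]; exists (x :: s); first by rewrite /= sz.
  by rewrite -cat_rcons.
exists x; rewrite setE -(size_rcons e x); apply/IH; exists s => //.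
by rewrite cat_rcons.
Qed.

Lemma definable_ex J I (S : (J -> R) -> (I -> R) -> Prop) :
  definable (fun z : J + I -> R => S (fun j => z (inl j)) (fun i => z (inr i))) ->
  definable (fun x => exists y, S x y).
Proof.
move=> [f [r k e]].
exists (foldr (@ordered_qelim.ord.Exists R) f (iota #|J| #|I|)); split.
- by elim: iota.
- by elim: iota.
move=> x; rewrite -(size_env x); split=> [[y Sxy]|/holds_exists_block[s sz h]].
  apply/holds_exists_block; exists (env y); first by rewrite size_env.
  have := e (fun ji => match ji with inl j => x j | inr i => y i end).
  by rewrite env_sum /= => -[H _]; apply: H.
have [y ey] := env_inv sz; exists y.
have := e (fun ji => match ji with inl j => x j | inr i => y i end).
by rewrite env_sum /= ey => -[_ H]; apply: H.
Qed.

Lemma definable_all J I (S : (J -> R) -> (I -> R) -> Prop) :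
  definable (fun z : J + I -> R => S (fun j => z (inl j)) (fun i => z (inr i))) ->
  definable (fun x => forall y, S x y).
Proof.
move=> /definable_not dS.
have := definable_not (definable_ex (S := fun x y => ~ S x y) dS).
apply: definable_ext => x; split=> [h y|h [y]]; last by apply.
by apply: boolp.contrapT => n; apply: h; exists y.
Qed.

(** * Transfer of definable properties to a generic point *)

Section Transfer.
Hypothesis fieldK : is_subfield K.

Section MPoly.
Variable n : nat.
Let mK (f : {mpoly R[n]}) := forall m, K f@_m.

Let mK_sum A (s : seq A) (P : pred A) (F : A -> R) :
  (forall a, K (F a)) -> K (\sum_(a <- s | P a) F a).
Proof.
move=> KF; elim/big_rec: _ => [|a x _ Kx].
  exact: (QECoefficients.subfield0 fieldK).
exact: (QECoefficients.subfieldD fieldK).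
Qed.

Let mK_nat k : mK k%:R.
Proof.
move=> m; rewrite -mpolyC_nat mcoeffC.
by apply: (QECoefficients.subfieldM fieldK); apply: (QECoefficients.subfield_nat fieldK).
Qed.

Let mKM f g : mK f -> mK g -> mK (f * g).
Proof.
move=> Kf Kg m; rewrite mcoeffM; apply: mK_sum => k.
exact: (QECoefficients.subfieldM fieldK).
Qed.

Lemma term_mpoly (t : GRing.term R) :
  GRing.rterm t -> QECoefficients.goodT K t ->
  exists2 f : {mpoly R[n]}, (forall m, K f@_m) &
    forall v : 'I_n -> R, GRing.eval [seq v k | k <- enum 'I_n] t = f.@[v].
Proof.
elim: t => //=.
- move=> i _ _; have [lt_in|le_ni] := ltnP i n.
    exists 'X_(Ordinal lt_in) => [m|v].
      by rewrite mcoeffX; apply: (QECoefficients.subfield_nat fieldK).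
    rewrite mevalXU (nth_map (Ordinal lt_in)) ?size_enum_ord //; congr (v _).
    by apply: val_inj; rewrite /= nth_enum_ord.
  (* A variable out of range evaluates to the default value 0 of [nth]. *)
  exists 0 => [m|v]; first exact: (mK_nat 0).
  by rewrite meval0 nth_default // size_map size_enum_ord.
- move=> c _ Kc; exists c%:MP => [m|v]; last by rewrite mevalC.
  rewrite mcoeffC; apply: (QECoefficients.subfieldM fieldK) => //.
  exact: (QECoefficients.subfield_nat fieldK).
- by move=> k _ _; exists k%:R => [|v]; [exact: mK_nat|rewrite -mpolyC_nat mevalC].
- move=> a IHa b IHb /andP[ra rb] [ga gb].
  have [f Kf ef] := IHa ra ga; have [g Kg eg] := IHb rb gb.
  exists (f + g) => [m|v]; last by rewrite ef eg mevalD.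
  by rewrite mcoeffD; apply: (QECoefficients.subfieldD fieldK).
- move=> a IHa ra ga; have [f Kf ef] := IHa ra ga.
  exists (- f) => [m|v]; last by rewrite ef mevalN.
  by rewrite mcoeffN; apply: (QECoefficients.subfieldN fieldK).
- move=> a IHa k ra ga; have [f Kf ef] := IHa ra ga.
  exists (k%:R * f) => [|v]; first exact: mKM.
  by rewrite ef mevalM -mpolyC_nat mevalC mulr_natl.
- move=> a IHa b IHb /andP[ra rb] [ga gb].
  have [f Kf ef] := IHa ra ga; have [g Kg eg] := IHb rb gb.
  by exists (f * g) => [|v]; [exact: mKM | rewrite ef eg mevalM].
- move=> a IHa k ra ga; have [f Kf ef] := IHa ra ga.
  exists (f ^+ k) => [|v]; last by rewrite ef rmorphXn.
  elim: k => [|k IHk]; first exact: (mK_nat 1).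
  by rewrite exprS; apply: mKM.
Qed.
End MPoly.

Lemma econt_term J (t : GRing.term R) : GRing.rterm t ->
  econt (fun x : J -> R => GRing.eval (env x) t).
Proof.
elim: t => //=.
- move=> i _; have [lt_iJ|le_Ji] := ltnP i #|J|.
    apply: econt_ext (econt_coord (enum_val (Ordinal lt_iJ))) => x.
    by rewrite -nth_env enum_valK.
  apply: econt_ext (econt_const 0) => x.
  by rewrite nth_default // size_env.
- by move=> c _; exact: econt_const.
- by move=> c _; exact: econt_const.
- by move=> a IHa b IHb /andP[/IHa ca /IHb cb]; apply: econtD.
- by move=> a IHa /IHa ca; apply: econtN.
- move=> a IHa k /IHa ca; apply: econt_ext (econtM (econt_const k%:R) ca) => x.
  by rewrite mulr_natl.
- by move=> a IHa b IHb /andP[/IHa ca /IHb cb]; apply: econtM.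
- by move=> a IHa k /IHa ca; apply: econt_exp.
Qed.

Variables (V : finType) (d : nat) (S : (V -> 'cV[R]_d) -> Prop).
Variable (p0 : V -> 'cV[R]_d).
Hypothesis gen : generic_in K S p0.

Definition flat (q : V -> 'cV[R]_d) (x : V * 'I_d) : R := q x.1 x.2 0.

Let close r (q : V -> 'cV[R]_d) := forall x, `|flat q x - flat p0 x| < r.

Let term_stable (t : GRing.term R) :
  GRing.rterm t -> QECoefficients.goodT K t -> exists2 r, 0 < r &
  forall q, S q -> close r q ->
    Num.sg (GRing.eval (env (flat q)) t) = Num.sg (GRing.eval (env (flat p0)) t).
Proof.
move=> rt gt; have [f Kf ef] := term_mpoly #|{: V * 'I_d}| rt gt.
have envE q : env (flat q) = [seq coords q k | k <- enum 'I_#|{: V * 'I_d}|].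
  apply: (@eq_from_nth _ 0); first by rewrite size_env size_map size_enum_ord.
  move=> k; rewrite size_env => kn.
  rewrite -{1}[k]/(val (Ordinal kn)) -[Ordinal kn]enum_valK nth_env.
  rewrite (nth_map (Ordinal kn)) ?size_enum_ord //.
  have -> : nth (Ordinal kn) (enum 'I_#|{: V * 'I_d}|) k = Ordinal kn.
    by apply: val_inj; rewrite /= nth_enum_ord.
  by [].
have [z|nz] := eqVneq (GRing.eval (env (flat p0)) t) 0.
  exists 1 => // q Sq _; suff -> : GRing.eval (env (flat q)) t = 0 by rewrite z.
  case: gen => _ nof; apply/eqP; apply: boolp.contrapT.
  move=> nq; apply: nof; exists f; split=> //; split.
    by rewrite -ef -envE.
  by exists q; split=> //; rewrite -ef -envE; apply/negP.
have e0 : 0 < `|GRing.eval (env (flat p0)) t| by rewrite normr_gt0.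
have [r r0 hr] := econt_term (J := (V * 'I_d)%type) rt (flat p0) e0.
exists r => // q _ /hr.
move: (GRing.eval (env (flat p0)) t) nz => a nz; move: (GRing.eval _ t) => b.
have [a0|a0|/eqP] := ltgtP a 0; last by rewrite (negPf nz).
  rewrite (ltr0_norm a0) ltr_norml => /andP[_ h].
  by rewrite !ltr0_sg //; move: h; lra.
rewrite (gtr0_norm a0) ltr_norml => /andP[h _].
by rewrite !gtr0_sg //; move: h; lra.
Qed.

Let qf_stable (f : ordered_qelim.ord.formula R) :
  ordered_qelim.ord.qf_form f -> ordered_qelim.ord.rformula f ->
  QECoefficients.goodF K f -> exists2 r, 0 < r & forall q, S q -> close r q ->
  ordered_qelim.ord.qf_eval (env (flat q)) f =
  ordered_qelim.ord.qf_eval (env (flat p0)) f.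
Proof.
have bin (P Q : (V -> 'cV[R]_d) -> Prop) :
    (exists2 r, 0 < r & forall q, S q -> close r q -> P q) ->
    (exists2 r, 0 < r & forall q, S q -> close r q -> Q q) ->
    exists2 r, 0 < r & forall q, S q -> close r q -> P q /\ Q q.
  move=> [r r0 hr] [s s0 hs]; exists (Num.min r s); first by rewrite lt_min r0.
  move=> q Sq cq; split; [apply: hr|apply: hs] => // x;
  by have := cq x; rewrite lt_min => /andP[].
have sub (t u : GRing.term R) : GRing.rterm t && GRing.rterm u ->
    QECoefficients.goodT K t /\ QECoefficients.goodT K u ->
    exists2 r, 0 < r & forall q, S q -> close r q ->
    Num.sg (GRing.eval (env (flat q)) u - GRing.eval (env (flat q)) t) =
    Num.sg (GRing.eval (env (flat p0)) u - GRing.eval (env (flat p0)) t).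
  move=> /andP[rt ru] [gt gu].
  by apply: (term_stable (t := GRing.Add u (GRing.Opp t))); rewrite /= ?rt ?ru.
elim: f => //=.
- by move=> b _ _ _; exists 1.
- move=> t u _ rtu gtu; have [r r0 hr] := sub _ _ rtu gtu.
  exists r => // q Sq cq.
  by rewrite eq_sym -subr_eq0 -sgr_eq0 hr // sgr_eq0 subr_eq0 eq_sym.
- move=> t u _ rtu gtu; have [r r0 hr] := sub _ _ rtu gtu.
  by exists r => // q Sq cq; rewrite -subr_gt0 -sgr_gt0 hr // sgr_gt0 subr_gt0.
- move=> t u _ rtu gtu; have [r r0 hr] := sub _ _ rtu gtu.
  by exists r => // q Sq cq; rewrite -subr_ge0 -sgr_ge0 hr // sgr_ge0 subr_ge0.
- move=> f If g Ig /andP[qf qg] /andP[rf rg] [gf gg].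
  have [r r0 hr] := bin _ _ (If qf rf gf) (Ig qg rg gg).
  by exists r => // q Sq cq; have [-> ->] := hr q Sq cq.
- move=> f If g Ig /andP[qf qg] /andP[rf rg] [gf gg].
  have [r r0 hr] := bin _ _ (If qf rf gf) (Ig qg rg gg).
  by exists r => // q Sq cq; have [-> ->] := hr q Sq cq.
- move=> f If g Ig /andP[qf qg] /andP[rf rg] [gf gg].
  have [r r0 hr] := bin _ _ (If qf rf gf) (Ig qg rg gg).
  by exists r => // q Sq cq; have [-> ->] := hr q Sq cq.
- move=> f If qf rf gf; have [r r0 hr] := If qf rf gf.
  by exists r => // q Sq cq; rewrite hr.
Qed.

(* A polynomial over K that does not vanish at p0 keeps its sign near p0 and
   one that does vanishes on all of S, so no K-definable set has p0 in its
   boundary relative to S. *)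
Lemma generic_transfer (P : (V * 'I_d -> R) -> Prop) : definable P ->
  (forall r, 0 < r -> exists q, [/\ S q, P (flat q) &
     forall x, `|flat q x - flat p0 x| < r]) ->
  P (flat p0).
Proof.
move=> [f [rf gf ef]] hP.
have [g [qg rg gg eg]] := QECoefficients.qe_over fieldK rf gf.
have [r r0 hr] := qf_stable qg rg gg.
have [q [Sq Pq cq]] := hP r r0.
by apply/ef/eg; rewrite -(hr q Sq cq); apply/eg/ef.
Qed.

End Transfer.
End Definability.

(** * Positive semidefinite kernels *)

Section Kernels.
Variables (R : realType) (V : finType).
Implicit Types (X : V -> V -> R) (u v : V -> R).

Definition bil X v u := \sum_i \sum_j v i * u j * X i j.

Definition psdk X := (forall i j, X i j = X j i) /\ forall v, 0 <= bil X v v.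

Definition unitv (k i : V) : R := (i == k)%:R.

Lemma sum_unitv k (F : V -> R) : \sum_i unitv k i * F i = F k.
Proof.
rewrite (bigD1 k) //= /unitv eqxx mul1r big1 ?addr0 // => i /negPf ->.
by rewrite mul0r.
Qed.

Lemma bilE X v u : bil X v u = \sum_i v i * \sum_j u j * X i j.
Proof.
by apply: eq_bigr => i _; rewrite mulr_sumr; apply: eq_bigr => j _; ring.
Qed.

Lemma bil_unitl X k u : bil X (unitv k) u = \sum_j u j * X k j.
Proof. by rewrite bilE (sum_unitv k (fun i => \sum_j u j * X i j)). Qed.

Lemma bil_unit X i j : bil X (unitv i) (unitv j) = X i j.
Proof. by rewrite bil_unitl (sum_unitv j (fun l => X i l)). Qed.

Lemma bilC X v u : (forall i j, X i j = X j i) -> bil X v u = bil X u v.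
Proof.
move=> sX; rewrite /bil exchange_big; apply: eq_bigr => i _.
by apply: eq_bigr => j _; rewrite sX; ring.
Qed.

Lemma bilDZ X v u a : (forall i j, X i j = X j i) ->
  bil X (fun i => v i + a * u i) (fun i => v i + a * u i) =
  bil X v v + 2 * a * bil X v u + a ^+ 2 * bil X u u.
Proof.
move=> sX.
have -> : 2 * a * bil X v u = a * bil X v u + a * bil X u v.
  by rewrite (bilC u v sX); ring.
rewrite /bil !mulr_sumr -!big_split; apply: eq_bigr => i _ /=.
by rewrite !mulr_sumr -!big_split; apply: eq_bigr => j _ /=; ring.
Qed.

Lemma quadratic_discr (a b c : R) :
  (forall x, 0 <= c + 2 * x * b + x ^+ 2 * a) -> b ^+ 2 <= c * a.
Proof.
move=> h; have c0 : 0 <= c by have := h 0; rewrite !(mulr0, mul0r, expr0n, addr0).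
have [a0|a0] := leP a 0.
  have [b0|b0] := eqVneq b 0.
    subst b; have [c00|cn] := eqVneq c 0; first by rewrite c00 mul0r expr0n.
    have a00 : a = 0.
      apply/le_anti; rewrite a0 /=; rewrite leNgt; apply/negP => an.
      have := h ((c + 1) / - a + 1).
      set y := (c + 1) / - a.
      have yE : y * - a = c + 1 by rewrite /y divfK // oppr_eq0 lt_eqF.
      have y0 : 0 < y by rewrite /y divr_gt0 ?oppr_gt0 //; lra.
      have : (y + 1) ^+ 2 * a = - (c + 1) * (y + 2) + a by rewrite -yE; ring.
      by move=> ->; nra.
    by rewrite a00 mulr0 expr0n.
  have := h (- (c + 1) / b).
  have -> : 2 * (- (c + 1) / b) * b = - 2 * (c + 1) by field.
  have : (- (c + 1) / b) ^+ 2 * a <= 0.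
    by apply: mulr_ge0_le0 => //; apply: sqr_ge0.
  lra.
have := h (- b / a).
have -> : c + 2 * (- b / a) * b + (- b / a) ^+ 2 * a = (c * a - b ^+ 2) / a.
  by field; rewrite gt_eqF.
by rewrite pmulr_lge0 ?invr_gt0 // subr_ge0.
Qed.

Lemma psdk_CS X v u : psdk X -> bil X v u ^+ 2 <= bil X v v * bil X u u.
Proof.
by move=> [sX pX]; apply: quadratic_discr => x; rewrite -bilDZ.
Qed.

Lemma psdk_null X v : psdk X -> bil X v v = 0 -> forall u, bil X v u = 0.
Proof.
move=> pX v0 u; have := psdk_CS v u pX; rewrite v0 mul0r => h.
by apply/eqP; rewrite -sqrf_eq0; apply/eqP/le_anti; rewrite h sqr_ge0.
Qed.

Lemma bil_comb a b X Y v u :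
  bil (fun i j => a * X i j + b * Y i j) v u = a * bil X v u + b * bil Y v u.
Proof.
rewrite /bil !mulr_sumr -!big_split; apply: eq_bigr => i _ /=.
by rewrite !mulr_sumr -!big_split; apply: eq_bigr => j _ /=; ring.
Qed.

Lemma bil_rank1 (c : V -> R) v :
  bil (fun i j => c i * c j) v v = (\sum_i v i * c i) ^+ 2.
Proof.
rewrite bilE expr2 mulr_suml; apply: eq_bigr => i _.
rewrite -mulrA; congr (_ * _); rewrite mulr_sumr; apply: eq_bigr => j _; ring.
Qed.

Lemma psdk_diag X i : psdk X -> 0 <= X i i.
Proof. by move=> [_ pX]; rewrite -(bil_unit X i i). Qed.

(* Symmetric Gaussian elimination; the number of nonzero diagonal entries
   decreases at each step. *)
Lemma gram_factor X : psdk X -> exists m (c : 'I_m -> V -> R),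
  forall i j, X i j = \sum_k c k i * c k j.
Proof.
have [n] := ubnP #|[set i | X i i != 0]|; elim: n X => // n IH X lt_n pX.
have [a /= aX|X0] := pickP (fun i => X i i != 0); last first.
  exists 0%N, (fun _ _ => 0) => i j; rewrite big_ord0 -(bil_unit X i j).
  by apply: psdk_null => //; rewrite bil_unit; apply/eqP/negPn; rewrite X0.
have [sX posX] := pX.
have a0 : 0 < X a a by rewrite lt_neqAle eq_sym aX psdk_diag.
(* The pivot column, scaled so that subtracting [c i * c j] clears row and column [a]. *)
pose c i := X i a / Num.sqrt (X a a).
have cc i j : c i * c j = X i a * X a j / X a a.
  rewrite /c mulrACA -invfM -expr2 sqr_sqrtr ?(ltW a0) //.
  by rewrite (sX j a).
pose X' i j := 1 * X i j + (-1) * (c i * c j).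
(* Semidefiniteness of the Schur complement is the Cauchy-Schwarz inequality for [X] between [v] and
   the [a]-th unit vector. *)
have pX' : psdk X'.
  split=> [i j|v]; first by rewrite /X' sX (mulrC (c i)).
  rewrite (bil_comb 1 (-1)) bil_rank1 mul1r mulN1r subr_ge0.
  have -> : \sum_i v i * c i = bil X v (unitv a) / Num.sqrt (X a a).
    rewrite (bilC _ _ sX) bil_unitl mulr_suml; apply: eq_bigr => i _.
    by rewrite /c sX mulrA.
  rewrite expr_div_n sqr_sqrtr ?(ltW a0) // ler_pdivrMr //.
  by rewrite -[X in _ <= _ * X](bil_unit X a a); apply: psdk_CS.
have X'0 i : X i i = 0 -> X' i i = 0.
  move=> i0; have ia : X i a = 0.
    rewrite -(bil_unit X i a); apply: psdk_null => //.
    by rewrite bil_unit.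
  by rewrite /X' i0 cc ia !mul0r !mulr0 addr0.
have X'a : X' a a = 0.
  by rewrite /X' cc mulfK // mul1r mulN1r subrr.
have [|m [e he]] := IH X' _ pX'.
  rewrite -ltnS; apply: leq_trans lt_n; rewrite ltnS; apply: proper_card.
  apply/properP; split.
    apply/subsetP => i; rewrite !inE; apply: contra => /eqP /X'0 ->.
    by rewrite eqxx.
  by exists a; rewrite !inE ?X'a ?eqxx.
exists m.+1, (fun k => oapp e c (unlift ord0 k)) => i j.
rewrite big_ord_recl unlift_none /=.
have -> : X i j = c i * c j + X' i j by rewrite /X'; ring.
by rewrite he; congr (_ + _); apply: eq_bigr => k _; rewrite liftK.
Qed.

(** * Weighted Laplacians and their quadratic forms *)

Variable E : rel V.
Hypothesis Esym : forall i j, E i j = E j i.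
Implicit Types (om : V -> V -> R).

Definition lapk om i j : R :=
  (i == j)%:R * (\sum_l (E i l)%:R * om i l) - (E i j)%:R * om i j.

(** Ordered pairs are summed, so every edge counts twice; hence the factor 2 in front of the
    Laplacian [lapk] below. *)
Definition form om v := \sum_i \sum_j (E i j)%:R * om i j * (v i - v j) ^+ 2.

Lemma lapk_sym om : (forall i j, om i j = om j i) ->
  forall i j, lapk om i j = lapk om j i.
Proof.
move=> so i j; rewrite /lapk Esym so eq_sym; case: eqP => [->|] //.
by rewrite !mul0r.
Qed.

Lemma bil_lapk om v u : bil (lapk om) v u =
  \sum_i v i * \sum_j (E i j)%:R * om i j * (u i - u j).
Proof.
rewrite bilE; apply: eq_bigr => i _; congr (_ * _).
under eq_bigr do rewrite /lapk mulrBr.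
rewrite sumrB; under [RHS]eq_bigr do rewrite mulrBr.
rewrite sumrB; congr (_ - _); last by apply: eq_bigr => j _; ring.
rewrite (bigD1 i) //= eqxx mul1r [X in _ + X]big1 ?addr0; last first.
  by move=> j /negPf ji; rewrite eq_sym ji mul0r mulr0.
by rewrite mulr_sumr; apply: eq_bigr => j _; ring.
Qed.

(** Summation by parts: by symmetry in [i] and [j], the terms with [v i] and those with [- v j]
    contribute equally. *)
Lemma form_polar om v u : (forall i j, om i j = om j i) ->
  \sum_i \sum_j (E i j)%:R * om i j * ((v i - v j) * (u i - u j)) =
  2 * bil (lapk om) v u.
Proof.
move=> so; rewrite bil_lapk.
have h : \sum_i v i * \sum_j (E i j)%:R * om i j * (u i - u j) =
    \sum_i \sum_j (E i j)%:R * om i j * (u i - u j) * v i.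
  by apply: eq_bigr => i _; rewrite mulr_sumr; apply: eq_bigr => j _; ring.
have h' : \sum_i v i * \sum_j (E i j)%:R * om i j * (u i - u j) =
    \sum_i \sum_j (E i j)%:R * om i j * (u i - u j) * (- v j).
  rewrite h exchange_big; apply: eq_bigr => i _; apply: eq_bigr => j _.
  by rewrite Esym so; ring.
rewrite mulr2n mulrDl !mul1r {1}h h' -big_split; apply: eq_bigr => i _ /=.
by rewrite -big_split; apply: eq_bigr => j _ /=; ring.
Qed.

Lemma form_bil om v : (forall i j, om i j = om j i) ->
  form om v = 2 * bil (lapk om) v v.
Proof.
by move=> so; rewrite -form_polar //; do 2!(apply: eq_bigr => ? _); rewrite expr2.
Qed.

(** The difference [D] of the kernels satisfies [D i i + D j j = 2 * D i j] and has zero row sums.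
    Summing over [j] and then over [i] kills first the trace, then the diagonal, then all of [D]. *)
Lemma centered_kernel_inj X Y : (forall i j, X i j = X j i) ->
  (forall i j, Y i j = Y j i) ->
  (forall i, \sum_j X i j = 0) -> (forall i, \sum_j Y i j = 0) ->
  (forall i j, X i i + X j j - 2 * X i j = Y i i + Y j j - 2 * Y i j) ->
  forall i j, X i j = Y i j.
Proof.
move=> sX sY cX cY h.
pose D i j := X i j - Y i j.
have hD i j : D i i + D j j = 2 * D i j by have := h i j; rewrite /D; lra.
have cD i : \sum_j D i j = 0 by rewrite sumrB cX cY subrr.
pose T := \sum_j D j j.
have h1 i : #|V|%:R * D i i + T = 0.
  have : \sum_j (D i i + D j j) = 0.
    by under eq_bigr do rewrite hD; rewrite -mulr_sumr cD mulr0.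
  by rewrite big_split sumr_const -[_ *+ _]mulr_natl.
have hT : T = 0.
  have : \sum_i (#|V|%:R * D i i + T) = 0 by rewrite big1.
  rewrite big_split /= -mulr_sumr sumr_const -[T *+ _]mulr_natl -/T -mulr2n.
  move=> /eqP; rewrite mulrn_eq0 /= mulf_eq0 pnatr_eq0 => /orP[/eqP V0|/eqP //].
  by rewrite /T big_pred0 // => i; have := fintype0 i V0.
move=> i j.
have D0 k : D k k = 0.
  have := h1 k; rewrite hT addr0 => /eqP; rewrite mulf_eq0 pnatr_eq0.
  by case/orP=> [/eqP V0|/eqP //]; have := fintype0 k V0.
by have := hD i j; rewrite !D0 /D; lra.
Qed.

End Kernels.

Section QuadraticBound.
Variables (R : realType) (d : nat).
Implicit Types (x y : 'cV[R]_d) (M : 'M[R]_d).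

Definition dotv x y : R := (x^T *m y) 0 0.

Lemma dotvE x y : dotv x y = \sum_a x a 0 * y a 0.
Proof. by rewrite /dotv mxE; apply: eq_bigr => a _; rewrite mxE. Qed.

Lemma dotvC x y : dotv x y = dotv y x.
Proof. by rewrite !dotvE; apply: eq_bigr => a _; rewrite mulrC. Qed.

Lemma dotv_ge0 x : 0 <= dotv x x.
Proof. by rewrite dotvE sumr_ge0 // => a _; rewrite -expr2 sqr_ge0. Qed.

Lemma dotv_eq0 x : dotv x x = 0 -> x = 0.
Proof.
rewrite dotvE => /eqP; rewrite psumr_eq0; last by move=> a _; rewrite -expr2 sqr_ge0.
move=> /allP h; apply/matrixP => a b; rewrite ord1 mxE.
by have /= := h a (mem_index_enum _); rewrite mulf_eq0 orbb => /eqP.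
Qed.

Lemma dotv_mxE x M y : dotv x (M *m y) = \sum_a \sum_b x a 0 * M a b * y b 0.
Proof.
rewrite dotvE; apply: eq_bigr => a _; rewrite mxE mulr_sumr.
by apply: eq_bigr => b _; rewrite mulrA.
Qed.

Lemma dotv_trmx x M y : dotv x (M *m y) = dotv (M^T *m x) y.
Proof. by rewrite /dotv trmx_mul trmxK mulmxA. Qed.

Lemma dotvBl x x' y : dotv (x - x') y = dotv x y - dotv x' y.
Proof. by rewrite /dotv linearB mulmxBl !mxE. Qed.
Lemma dotvBr x y y' : dotv x (y - y') = dotv x y - dotv x y'.
Proof. by rewrite /dotv mulmxBr !mxE. Qed.
Lemma dotvZl a x y : dotv (a *: x) y = a * dotv x y.
Proof. by rewrite /dotv linearZ -scalemxAl mxE. Qed.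
Lemma dotvZr a x y : dotv x (a *: y) = a * dotv x y.
Proof. by rewrite /dotv -scalemxAr mxE. Qed.
Lemma dotv_suml (I : Type) (r : seq I) (P : pred I) (F : I -> 'cV[R]_d) y :
  dotv (\sum_(i <- r | P i) F i) y = \sum_(i <- r | P i) dotv (F i) y.
Proof. by rewrite /dotv raddf_sum mulmx_suml summxE. Qed.
Lemma dotv_sumr (I : Type) (r : seq I) (P : pred I) (F : I -> 'cV[R]_d) x :
  dotv x (\sum_(i <- r | P i) F i) = \sum_(i <- r | P i) dotv x (F i).
Proof. by rewrite /dotv mulmx_sumr summxE. Qed.

Lemma sqnormB x y : sqnorm (x - y) = dotv x x + dotv y y - 2 * dotv x y.
Proof.
rewrite /sqnorm -/(dotv _ _) dotvBl !dotvBr (dotvC y x); ring.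
Qed.

Lemma dotv_bound M : exists2 C, 0 < C & forall y, `|dotv y (M *m y)| <= C * dotv y y.
Proof.
exists (1 + \sum_a \sum_b `|M a b|) => [|y].
  by rewrite ltr_pwDl // sumr_ge0 // => a _; rewrite sumr_ge0.
rewrite mulrDl mul1r dotv_mxE.
apply: le_trans (_ : (\sum_a \sum_b `|M a b|) * dotv y y <= _); last first.
  by rewrite lerDr dotv_ge0.
apply: le_trans (ler_norm_sum _ _ _) _; rewrite mulr_suml; apply: ler_sum => a _.
apply: le_trans (ler_norm_sum _ _ _) _; rewrite mulr_suml; apply: ler_sum => b _.
rewrite !normrM (mulrC `|y a 0|) -mulrA; apply: ler_wpM2l => //.
have h c : `|y c 0| ^+ 2 <= dotv y y.
  rewrite real_normK ?num_real // dotvE (bigD1 c) //= -expr2 lerDl.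
  by apply: sumr_ge0 => k _; rewrite -expr2 sqr_ge0.
have := h a; have := h b; have := sqr_ge0 (`|y a 0| - `|y b 0|); nra.
Qed.

End QuadraticBound.

(** * The symmetric cone and invariant stresses *)

Section Cone.
Variables (R : realType) (gT : finGroupType) (V : finType).
Variables (act : gT -> V -> V) (E : rel V) (sigma : V -> V -> int).
Implicit Types (X s : V -> V -> R) (i j : V) (g : gT).

Definition slackable i j := E i j && (sigma i j != 0).

(** Universal rigidity controls all kernels, hence [cone0]; the perturbation takes place among the
    invariant ones, in [cone], so that the nearby configuration is again compatible with the point
    group. *)
Definition cone0 X s :=
  [/\ psdk X, forall i, \sum_j X i j = 0, forall i j, 0 <= s i j &
      forall i j, ~~ slackable i j -> s i j = 0].

Definition cone X s :=
  [/\ cone0 X s, forall i j, s i j = s j i,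
      forall g i j, X (act g i) (act g j) = X i j &
      forall g i j, s (act g i) (act g j) = s i j].

(** For the Gram matrix of [q] this is the squared edge length of [q] plus the signed slack. A
    configuration dominated by [p], with its slacks, therefore has the same image as the Gram matrix
    of [p] with zero slacks. *)
Definition edgemap X s i j : R :=
  (E i j)%:R * (X i i + X j j - 2 * X i j + (sigma i j)%:~R * s i j).

Definition zerok (_ _ : V) : R := 0.

Lemma edgemap_comb a b X s Y r i j :
  edgemap (fun i j => a * X i j + b * Y i j) (fun i j => a * s i j + b * r i j)
    i j = a * edgemap X s i j + b * edgemap Y r i j.
Proof. by rewrite /edgemap; ring. Qed.

Lemma psdk_comb a b X Y : 0 <= a -> 0 <= b -> psdk X -> psdk Y ->
  psdk (fun i j => a * X i j + b * Y i j).
Proof.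
move=> a0 b0 [sX pX] [sY pY]; split=> [i j|v]; first by rewrite sX sY.
by rewrite bil_comb addr_ge0 ?mulr_ge0.
Qed.

Lemma cone0_comb a b X s Y r : 0 <= a -> 0 <= b -> cone0 X s -> cone0 Y r ->
  cone0 (fun i j => a * X i j + b * Y i j) (fun i j => a * s i j + b * r i j).
Proof.
move=> a0 b0 [pX cX s0 sE] [pY cY r0 rE]; split.
- exact: psdk_comb.
- by move=> i; rewrite big_split /= -!mulr_sumr cX cY !mulr0 addr0.
- by move=> i j; rewrite addr_ge0 ?mulr_ge0.
- by move=> i j nij; rewrite sE // rE // !mulr0 addr0.
Qed.

Lemma cone_comb a b X s Y r : 0 <= a -> 0 <= b -> cone X s -> cone Y r ->
  cone (fun i j => a * X i j + b * Y i j) (fun i j => a * s i j + b * r i j).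
Proof.
move=> a0 b0 [cX s1 gX gs] [cY r1 gY gr]; split; first exact: cone0_comb.
- by move=> i j; rewrite s1 r1.
- by move=> g i j; rewrite gX gY.
- by move=> g i j; rewrite gs gr.
Qed.

Lemma psdk0 : psdk zerok.
Proof.
by split=> // v; rewrite /bil big1 // => i _; rewrite big1 // => j _; rewrite mulr0.
Qed.

Hypotheses (act1 : forall i, act 1%g i = i)
  (actM : forall g h i, act (g * h)%g i = act g (act h i))
  (Esym : forall i j, E i j = E j i)
  (EG : forall g i j, E (act g i) (act g j) = E i j)
  (sigma_sym : forall i j, E i j -> sigma i j = sigma j i)
  (sigmaG : forall g i j, E i j -> sigma (act g i) (act g j) = sigma i j).

Lemma act_inj g : injective (act g).
Proof.
by move=> i j /(congr1 (act g^-1%g)); rewrite -!actM mulVg !act1.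
Qed.

Lemma sum_act g (F : V -> R) : \sum_i F (act g i) = \sum_i F i.
Proof. by rewrite [RHS](reindex_inj (@act_inj g)). Qed.

Lemma sum2_act g (F : V -> V -> R) :
  \sum_i \sum_j F (act g i) (act g j) = \sum_i \sum_j F i j.
Proof.
rewrite -(sum_act g (fun i => \sum_j F i j)); apply: eq_bigr => i _.
exact: (sum_act g (fun j => F (act g i) j)).
Qed.

Lemma sum_group_r (h : gT) (F : gT -> R) : \sum_g F (g * h)%g = \sum_g F g.
Proof. by rewrite [RHS](reindex_inj (mulIg h)). Qed.

Lemma slackable_sym i j : slackable i j = slackable j i.
Proof.
by rewrite /slackable Esym; case e : (E j i) => //=; rewrite (sigma_sym e).
Qed.

Lemma slackable_act g i j : slackable (act g i) (act g j) = slackable i j.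
Proof.
by rewrite /slackable EG; case e : (E i j) => //=; rewrite sigmaG.
Qed.

Lemma Esigma_sym i j :
  (E i j)%:R * (sigma i j)%:~R = (E j i)%:R * (sigma j i)%:~R :> R.
Proof. by rewrite Esym; case e : (E j i) => /=; rewrite ?mul0r ?(sigma_sym e). Qed.

Lemma Esigma_act g i j :
  (E (act g i) (act g j))%:R * (sigma (act g i) (act g j))%:~R =
  (E i j)%:R * (sigma i j)%:~R :> R.
Proof. by rewrite EG; case e : (E i j) => /=; rewrite ?mul0r ?sigmaG. Qed.

Lemma edgemap_sym X s i j : (forall i j, X i j = X j i) ->
  (forall i j, s i j = s j i) -> edgemap X s i j = edgemap X s j i.
Proof.
move=> sX ss; rewrite /edgemap !mulrDr !mulrA Esigma_sym (sX i) (ss i) Esym.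
by ring.
Qed.

Lemma edgemap_act X s g i j :
  (forall g i j, X (act g i) (act g j) = X i j) ->
  (forall g i j, s (act g i) (act g j) = s i j) ->
  edgemap X s (act g i) (act g j) = edgemap X s i j.
Proof.
move=> gX gs; rewrite /edgemap ![(_)%:R * (_ + _)]mulrDr !mulrA Esigma_act.
by rewrite !gX gs EG.
Qed.

(** * Invariant stresses and their test elements *)

Definition pair2 (om A : V -> V -> R) := \sum_i \sum_j om i j * A i j.

Lemma pair2_comb om a b A A' : pair2 om (fun i j => a * A i j + b * A' i j) =
  a * pair2 om A + b * pair2 om A'.
Proof.
rewrite /pair2 !mulr_sumr -big_split; apply: eq_bigr => i _ /=.
by rewrite !mulr_sumr -big_split; apply: eq_bigr => j _ /=; ring.
Qed.

Lemma eq_pair2 om A A' : (forall i j, A i j = A' i j) -> pair2 om A = pair2 om A'.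
Proof. by move=> e; apply: eq_bigr => i _; apply: eq_bigr => j _; rewrite e. Qed.

(** Summing over the group and over both orientations changes the functional on invariant symmetric
    arguments only by a factor; the minus sign turns nonpositive on the cone into nonnegative. *)
Definition symstress (eta : V -> V -> R) i j : R :=
  - \sum_g (eta (act g i) (act g j) + eta (act g j) (act g i)).

Lemma symstress_sym eta i j : symstress eta i j = symstress eta j i.
Proof. by congr (- _); apply: eq_bigr => g _; rewrite addrC. Qed.

Lemma symstress_act eta g i j :
  symstress eta (act g i) (act g j) = symstress eta i j.
Proof.
congr (- _); rewrite -[RHS](sum_group_r g).
by apply: eq_bigr => h _; rewrite !actM.
Qed.

Lemma pair2_symstress eta (A : V -> V -> R) :
  (forall i j, A i j = A j i) -> (forall g i j, A (act g i) (act g j) = A i j) ->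
  pair2 (symstress eta) A = - (2 * #|gT|%:R) * pair2 eta A.
Proof.
move=> sA gA.
have -> : pair2 (symstress eta) A =
    - \sum_g (\sum_i \sum_j (eta (act g i) (act g j) * A (act g i) (act g j)) +
              \sum_i \sum_j (eta (act g j) (act g i) * A (act g j) (act g i))).
  rewrite /pair2 -sumrN.
  under eq_bigr do (under eq_bigr do rewrite /symstress mulNr mulr_suml -sumrN).
  under eq_bigr do rewrite exchange_big.
  rewrite exchange_big; apply: eq_bigr => g _ /=.
  rewrite -big_split -sumrN; apply: eq_bigr => i _ /=.
  rewrite -big_split -sumrN; apply: eq_bigr => j _ /=.
  by rewrite !gA (sA j); ring.
rewrite (eq_bigr (fun=> 2 * pair2 eta A)) => [|g _].
  by rewrite sumr_const -[_ *+ _]mulr_natl; ring.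
rewrite (sum2_act g (fun i j => eta i j * A i j)).
rewrite (sum2_act g (fun i j => eta j i * A j i)) [X in _ + X]exchange_big /=.
by rewrite /pair2; ring.
Qed.

Definition center (v : V -> R) i := v i - (#|V|%:R)^-1 * \sum_j v j.

Lemma sum_center v : (0 < #|V|)%N -> \sum_i center v i = 0.
Proof.
move=> V0; rewrite sumrB sumr_const -[_ *+ _]mulr_natl mulrA divff ?mul1r ?subrr //.
by rewrite pnatr_eq0 -lt0n.
Qed.

(** An unnormalized group sum of rank one kernels. It lies in the invariant cone and tests an
    invariant stress against the single vector [v]; centering makes the row sums zero. *)
Definition avgk (v : V -> R) i j := \sum_g center v (act g i) * center v (act g j).

Lemma bil_avgk v u :
  bil (avgk v) u u = \sum_g (\sum_i u i * center v (act g i)) ^+ 2.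
Proof.
rewrite /bil; under eq_bigr do (under eq_bigr do rewrite /avgk mulr_sumr).
under eq_bigr do rewrite exchange_big.
rewrite exchange_big; apply: eq_bigr => g _ /=.
exact: (bil_rank1 (fun i => center v (act g i)) u).
Qed.

Lemma cone_avgk v : (0 < #|V|)%N -> cone (avgk v) zerok.
Proof.
move=> V0; split=> //; first split=> //.
- split=> [i j|u].
    by apply: eq_bigr => g _; rewrite mulrC.
  by rewrite bil_avgk sumr_ge0 // => g _; apply: sqr_ge0.
- move=> i; rewrite exchange_big big1 // => g _ /=.
  by rewrite -mulr_sumr (sum_act g (center v)) sum_center // mulr0.
- move=> g i j; rewrite -[RHS](sum_group_r g); apply: eq_bigr => h _.
  by rewrite !actM.
Qed.

(** Edge values are squared differences, which centering does not change, and by invariance all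
    group translates contribute equally. *)
Lemma pair2_avgk om v : (forall g i j, om (act g i) (act g j) = om i j) ->
  pair2 om (edgemap (avgk v) zerok) = #|gT|%:R * form E om v.
Proof.
move=> gom.
have -> : pair2 om (edgemap (avgk v) zerok) = \sum_g \sum_i \sum_j
    (E (act g i) (act g j))%:R * om (act g i) (act g j) *
    (v (act g i) - v (act g j)) ^+ 2.
  rewrite /pair2; under eq_bigr => i _.
    under eq_bigr => j _.
      have -> : om i j * edgemap (avgk v) zerok i j = \sum_g
        (E (act g i) (act g j))%:R * om (act g i) (act g j) *
        (v (act g i) - v (act g j)) ^+ 2.
        rewrite /edgemap /zerok /avgk mulr0 addr0 mulr_sumr -big_split -sumrB /=.
        rewrite !mulr_sumr; apply: eq_bigr => g _; rewrite gom EG /center.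
        by ring.
      over.
    rewrite exchange_big; over.
  by rewrite exchange_big.
rewrite (eq_bigr (fun=> form E om v)) => [|g _].
  by rewrite sumr_const -[_ *+ _]mulr_natl.
exact: (sum2_act g (fun i j => (E i j)%:R * om i j * (v i - v j) ^+ 2)).
Qed.

(** A slack supported on the orbit of the edge [i j], in both orientations; it tests the sign of an
    invariant stress on that edge. *)
Definition orbk (i j k l : V) : R :=
  \sum_g ((unitv R (act g i) k * unitv R (act g j) l) +
          (unitv R (act g j) k * unitv R (act g i) l)).

Lemma unitv_ge0 (i k : V) : 0 <= unitv R i k.
Proof. exact: ler0n. Qed.

Lemma orbk_ge0 i j k l : 0 <= orbk i j k l.
Proof.
by apply: sumr_ge0 => g _; rewrite addr_ge0 // mulr_ge0 // unitv_ge0.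
Qed.

Lemma orbk_gt0 i j : 0 < orbk i j i j.
Proof.
rewrite /orbk (bigD1 1%g) //= !act1 /unitv !eqxx mulr1.
apply: ltr_pwDl; last first.
  by apply: sumr_ge0 => g _; rewrite addr_ge0 // mulr_ge0 // ler0n.
by rewrite ltr_pwDl // mulr_ge0 // ler0n.
Qed.

Lemma cone_orbk i j : slackable i j -> cone zerok (orbk i j).
Proof.
move=> sij; split=> //; first split=> //.
- exact: psdk0.
- by move=> k; rewrite big1.
- by move=> k l; apply: orbk_ge0.
- move=> k l nkl; rewrite /orbk big1 // => g _; rewrite /unitv.
  case: (k =P act g i) => [ek|_]; case: (l =P act g j) => [el|_];
  case: (k =P act g j) => [ek'|_]; case: (l =P act g i) => [el'|_];
  rewrite ?mulr0 ?mul0r ?addr0 //; exfalso; move/negP: nkl; apply;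
  by [rewrite ek el slackable_act | rewrite ek' el' slackable_act slackable_sym].
- by move=> k l; apply: eq_bigr => g _; rewrite addrC mulrC [X in _ + X]mulrC.
- move=> g k l; rewrite /orbk (reindex_inj (mulgI g)) /=.
  apply: eq_bigr => h _; rewrite !actM /unitv !(inj_eq (@act_inj g)) //.
Qed.

Lemma pair2_orbk om i j : (forall i j, om i j = om j i) ->
  (forall g i j, om (act g i) (act g j) = om i j) -> E i j ->
  pair2 om (edgemap zerok (orbk i j)) = 2 * #|gT|%:R * ((sigma i j)%:~R * om i j).
Proof.
move=> som gom eij.
pose F k l := (E k l)%:R * (sigma k l)%:~R * om k l.
have Fsym k l : F k l = F l k by rewrite /F Esigma_sym som.
have Fact g k l : F (act g k) (act g l) = F k l by rewrite /F Esigma_act gom.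
have -> : pair2 om (edgemap zerok (orbk i j)) =
    \sum_g (F (act g i) (act g j) + F (act g j) (act g i)).
  transitivity (\sum_k \sum_l F k l * orbk i j k l).
    apply: eq_bigr => k _; apply: eq_bigr => l _.
    by rewrite /edgemap /zerok /F; ring.
  under eq_bigr do (under eq_bigr do rewrite /orbk mulr_sumr).
  under eq_bigr do rewrite exchange_big.
  rewrite exchange_big; apply: eq_bigr => g _ /=.
  have h a b : \sum_k \sum_l F k l * (unitv R a k * unitv R b l) = F a b.
    transitivity (\sum_k unitv R a k * F k b); last exact: sum_unitv.
    apply: eq_bigr => k _; rewrite -(sum_unitv b (F k)) mulr_sumr.
    by apply: eq_bigr => l _; ring.
  rewrite -[F _ _]h -[X in _ + X]h -big_split; apply: eq_bigr => k _ /=.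
  by rewrite -big_split; apply: eq_bigr => l _ /=; rewrite mulrDr.
rewrite (eq_bigr (fun=> 2 * F i j)) => [|g _]; last first.
  by rewrite !Fact (Fsym j); ring.
by rewrite sumr_const -[_ *+ _]mulr_natl /F eij /= mulr1n; ring.
Qed.

End Cone.

(** * Configurations compatible with the point group *)

Section InvariantForms.
Variables (R : realType) (gT : finGroupType) (d : nat) (theta : gT -> 'M[R]_d).
Hypothesis thetaM : forall g h, theta (g * h)%g = theta g *m theta h.

Definition invform (M : 'M[R]_d) :=
  M^T = M /\ forall g, (theta g)^T *m M *m theta g = M.

Lemma invform_lin k (c : 'I_k -> R) (M : 'I_k -> 'M[R]_d) :
  (forall b, invform (M b)) -> invform (\sum_b c b *: M b).
Proof.
move=> iM; split=> [|g].
  rewrite raddf_sum; apply: eq_bigr => b _ /=; rewrite linearZ /=.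
  by have [-> _] := iM b.
rewrite mulmx_sumr mulmx_suml; apply: eq_bigr => b _.
by rewrite -scalemxAr -scalemxAl; have [_ ->] := iM b.
Qed.

Let gen (a b : 'I_d) : 'M[R]_d :=
  \sum_g (theta g)^T *m (delta_mx a b + delta_mx b a) *m theta g.

Let gen_inv a b : invform (gen a b).
Proof.
split=> [|h].
  rewrite /gen raddf_sum; apply: eq_bigr => g _ /=.
  by rewrite !trmx_mul trmxK linearD /= !trmx_delta addrC mulmxA.
rewrite /gen mulmx_sumr mulmx_suml (reindex_inj (mulIg h^-1%g)) /=.
apply: eq_bigr => g _.
have -> : theta g = theta (g * h^-1)%g *m theta h by rewrite -thetaM mulgKV.
by rewrite trmx_mul !mulmxA.
Qed.

(** Expanding a symmetric [M] in symmetrized matrix units gives [2 *: M], and summing an invariant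
    matrix over the group multiplies it by the order of the group. *)
Let gen_span M : invform M -> (2 * #|gT|%:R) *: M = \sum_a \sum_b M a b *: gen a b.
Proof.
move=> [sM iM].
have -> : \sum_a \sum_b M a b *: gen a b =
    \sum_g (theta g)^T *m (\sum_a \sum_b M a b *: (delta_mx a b + delta_mx b a))
      *m theta g.
  under eq_bigr do (under eq_bigr do rewrite /gen scaler_sumr).
  under eq_bigr do rewrite exchange_big.
  rewrite exchange_big; apply: eq_bigr => g _ /=.
  rewrite mulmx_sumr mulmx_suml; apply: eq_bigr => a _.
  rewrite mulmx_sumr mulmx_suml; apply: eq_bigr => b _.
  by rewrite -scalemxAr -scalemxAl.
have -> : \sum_a \sum_b M a b *: (delta_mx a b + delta_mx b a) = 2 *: M.
  have e2 : \sum_a \sum_b M a b *: delta_mx b a = M.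
    rewrite exchange_big -[RHS]sM [RHS]matrix_sum_delta.
    by apply: eq_bigr => a _; apply: eq_bigr => b _; rewrite mxE.
  under eq_bigr do (under eq_bigr do rewrite scalerDr); under eq_bigr do rewrite big_split.
  by rewrite big_split /= e2 -matrix_sum_delta scaler_nat mulr2n.
under eq_bigr do rewrite -scalemxAr -scalemxAl iM.
by rewrite sumr_const -scaler_nat scalerA mulrC.
Qed.

Lemma invform_basis : exists k (M : 'I_k -> 'M[R]_d),
  [/\ forall b, invform (M b),
      forall N, invform N -> exists c : 'I_k -> R, N = \sum_b c b *: M b &
      forall c : 'I_k -> R, \sum_b c b *: M b = 0 -> forall b, c b = 0].
Proof.
pose X := [seq gen ab.1 ab.2 | ab <- enum {: 'I_d * 'I_d}].
pose U : {vspace 'M[R]_d} := <<X>>%VS.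
have inU a b : gen a b \in U.
  by apply: memv_span; apply/mapP; exists (a, b); rewrite ?mem_enum.
exists (\dim U), (fun b => (vbasis U)`_b); split.
- move=> b; have : (vbasis U)`_b \in U.
    by apply: vbasis_mem; apply: mem_nth; rewrite size_tuple.
  move=> /coord_span ->; apply: invform_lin => i.
  by rewrite -tnth_nth tnth_map; apply: gen_inv.
- move=> N iN; exists (fun b => coord (vbasis U) b N).
  apply: coord_vbasis; have G0 : 2 * #|gT|%:R != 0 :> R.
    have g0 : (0 < #|gT|)%N by apply/card_gt0P; exists 1%g.
    by rewrite gt_eqF // mulr_gt0 // ltr0n.
  rewrite -[N](scalerK G0); apply: memvZ; rewrite gen_span //.
  by apply: memv_suml => a _; apply: memv_suml => b _; apply: memvZ.
- by apply/freeP; apply: basis_free; apply: vbasisP.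
Qed.

End InvariantForms.

(** * Gram kernels and directions along the minimal face *)

Section Config.
Variables (R : realType) (gT : finGroupType) (V : finType).
Variables (act : gT -> V -> V) (E : rel V) (sigma : V -> V -> int).
Hypotheses (act1 : forall i, act 1%g i = i)
  (actM : forall g h i, act (g * h)%g i = act g (act h i))
  (Esym : forall i j, E i j = E j i)
  (EG : forall g i j, E (act g i) (act g j) = E i j)
  (sigma_sym : forall i j, E i j -> sigma i j = sigma j i)
  (sigmaG : forall g i j, E i j -> sigma (act g i) (act g j) = sigma i j).
Variables (d : nat) (theta : gT -> 'M[R]_d).
Hypotheses (thetaM : forall g h, theta (g * h)%g = theta g *m theta h)
  (thetaO : forall g, (theta g)^T *m theta g = 1%:M).

Local Notation cone0 := (@cone0 R V E sigma).
Local Notation cone := (@cone R gT V act E sigma).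
Local Notation edgemap := (@edgemap R V E sigma).
Local Notation zerok := (@zerok R V).

Definition equivariant (q : V -> 'cV[R]_d) :=
  (forall g i, theta g *m q i = q (act g i)) /\ \sum_i q i = 0.

(** The Gram matrix of [q] for [M = 1]. At [q = p0], with [M] running over the invariant forms,
    these kernels form the span W of the minimal face. *)
Definition gk (q : V -> 'cV[R]_d) (M : 'M[R]_d) i j := dotv (q i) (M *m q j).

Lemma gk_sym q M i j : M^T = M -> gk q M i j = gk q M j i.
Proof. by move=> sM; rewrite /gk dotv_trmx sM dotvC. Qed.

Lemma gk_center q M i : \sum_i q i = 0 -> \sum_j gk q M i j = 0.
Proof.
move=> cq; rewrite /gk -dotv_sumr -mulmx_sumr cq mulmx0.
by rewrite /dotv mulmx0 mxE.
Qed.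

Lemma gk_act q M g i j : equivariant q -> invform theta M ->
  gk q M (act g i) (act g j) = gk q M i j.
Proof.
move=> [eq _] [_ iM]; rewrite /gk -!eq /dotv trmx_mul.
by rewrite -[in RHS](iM g) !mulmxA.
Qed.

Lemma gk_lin q k (c : 'I_k -> R) (M : 'I_k -> 'M[R]_d) i j :
  gk q (\sum_b c b *: M b) i j = \sum_b c b * gk q (M b) i j.
Proof.
rewrite /gk mulmx_suml dotv_sumr; apply: eq_bigr => b _.
by rewrite -scalemxAl dotvZr.
Qed.

Definition comb (q : V -> 'cV[R]_d) (v : V -> R) := \sum_i v i *: q i.

Lemma bil_gk q M v u : bil (gk q M) v u = dotv (comb q v) (M *m comb q u).
Proof.
rewrite /comb mulmx_sumr dotv_suml; apply: eq_bigr => i _.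
rewrite dotv_sumr; apply: eq_bigr => j _.
by rewrite -scalemxAr dotvZl dotvZr mulrA.
Qed.

Lemma edgemap_gk_lin q k (c : 'I_k -> R) (M : 'I_k -> 'M[R]_d) i j :
  edgemap (gk q (\sum_b c b *: M b)) zerok i j =
  \sum_b c b * edgemap (gk q (M b)) zerok i j.
Proof.
rewrite /edgemap !gk_lin /zerok mulr0 addr0 mulr_sumr -big_split -sumrB mulr_sumr.
by apply: eq_bigr => b _ /=; ring.
Qed.

(** The perturbation is bounded by a multiple of [dotv (comb q v) (comb q v)], hence of the form of
    [Y]; a short step of either sign cannot destroy semidefiniteness. *)
Lemma psdk_perturb (Y : V -> V -> R) q M D : psdk Y -> M^T = M ->
  (forall v, dotv (comb q v) (comb q v) <= D * bil Y v v) ->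
  exists2 l, 0 < l & forall k, `|k| <= l ->
    psdk (fun i j => Y i j + k * gk q M i j).
Proof.
move=> [sY pY] sM hD; have [C C0 hC] := dotv_bound M.
have D1 : 0 < C * (`|D| + 1) by rewrite mulr_gt0 // ltr_wpDl.
exists (C * (`|D| + 1))^-1 => [|k hk]; first by rewrite invr_gt0.
split=> [i j|v]; first by rewrite sY (gk_sym _ _ _ sM).
have -> : (fun i j => Y i j + k * gk q M i j) =
    (fun i j => 1 * Y i j + k * gk q M i j).
  by apply: boolp.funext => i; apply: boolp.funext => j; rewrite mul1r.
rewrite bil_comb mul1r bil_gk.
set y := comb q v; have h1 := hC y; have h2 := hD v; rewrite -/y in h2.
have h3 := pY v; set Q := bil Y v v in h2 h3 *.
have h4 : dotv y y <= (`|D| + 1) * Q.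
  by apply: le_trans h2 _; apply: ler_wpM2r => //; rewrite (le_trans (ler_norm D)) // lerDl.
have h5 : `|k * dotv y (M *m y)| <= Q.
  rewrite normrM; apply: le_trans (_ : (C * (`|D| + 1))^-1 * (C * ((`|D| + 1) * Q)) <= _).
    apply: ler_pM => //; apply: le_trans h1 _; rewrite ler_pM2l //.
  by rewrite (mulrA C) mulKf // gt_eqF.
by move: h5; rewrite ler_norml => /andP[h5 _]; lra.
Qed.

Variable p0 : V -> 'cV[R]_d.
Hypotheses (equi_p0 : equivariant p0)
  (span_p0 : forall u : 'cV[R]_d, (forall i, dotv u (p0 i) = 0) -> u = 0).
Local Notation z0 := (gk p0 1%:M).

Hypothesis rigid_p0 : forall X s, cone0 X s ->
  (forall i j, edgemap X s i j = edgemap z0 zerok i j) ->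
  (forall i j, X i j = z0 i j) /\ (forall i j, s i j = 0).

Lemma invform1 : invform theta 1%:M.
Proof. by split=> [|g]; rewrite ?trmx1 // mulmx1. Qed.

Lemma psdk_z0 : psdk z0.
Proof.
split=> [i j|v]; first by rewrite gk_sym ?trmx1.
by rewrite bil_gk mul1mx dotv_ge0.
Qed.

Lemma cone_z0 : cone z0 zerok.
Proof.
split=> //; first split=> //; first exact: psdk_z0.
- by move=> i; apply: gk_center; case: equi_p0.
- by move=> g i j; apply: gk_act => //; apply: invform1.
Qed.

(** A small multiple of [X] minus [gk p0 M] can be added to [z0] inside [cone0] without changing the
    image, so uniqueness at [z0] forces the difference and the slack to vanish. No sign of [M] is
    assumed, so uniqueness extends to the whole span of the face. *)
Lemma rigid_dir X s M : cone0 X s -> M^T = M ->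
  (forall i j, edgemap X s i j = edgemap (gk p0 M) zerok i j) ->
  (forall i j, X i j = gk p0 M i j) /\ (forall i j, s i j = 0).
Proof.
move=> cX sM hA.
have [|l l0 hl] := psdk_perturb (q := p0) (D := 1) psdk_z0 sM.
  by move=> v; rewrite mul1r bil_gk mul1mx.
have [pX cenX s0 sE] := cX.
pose X' i j := 1 * (z0 i j + (- l) * gk p0 M i j) + l * X i j.
have cX' : cone0 X' (fun i j => 1 * zerok i j + l * s i j).
  apply: cone0_comb => //; first exact: ltW.
  split=> //.
    by apply: hl; rewrite normrN gtr0_norm.
  move=> i; rewrite big_split /= -mulr_sumr !gk_center ?mulr0 ?addr0 //;
  by case: equi_p0.
have [|hX hs] := rigid_p0 cX'.
  move=> i j; rewrite edgemap_comb hA.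
  have -> : (fun i j => z0 i j + - l * gk p0 M i j) =
      (fun i j => 1 * z0 i j + - l * gk p0 M i j).
    by apply: boolp.funext => a; apply: boolp.funext => b; rewrite mul1r.
  have -> : zerok = (fun i j => 1 * zerok i j + (- l) * zerok i j).
    by apply: boolp.funext => a; apply: boolp.funext => b; rewrite /zerok !mulr0 addr0.
  rewrite edgemap_comb.
  have -> : (fun i j => 1 * zerok i j + (- l) * zerok i j) = zerok.
    by apply: boolp.funext => a; apply: boolp.funext => b; rewrite /zerok !mulr0 addr0.
  by ring.
have ln : l != 0 by rewrite gt_eqF.
split=> i j.
  apply: (mulfI ln); have := hX i j; rewrite /X'; lra.
apply: (mulfI ln); have := hs i j; rewrite /zerok; lra.
Qed.

(** * Reading a configuration off a kernel *)

Definition covar : 'M[R]_d := \sum_i p0 i *m (p0 i)^T.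

Lemma mul_outer (x y u : 'cV[R]_d) : x *m y^T *m u = dotv y u *: x.
Proof.
rewrite -mulmxA [y^T *m u]mx11_scalar mul_mx_scalar.
by rewrite /dotv.
Qed.

Lemma covar_mul (u : 'cV[R]_d) : covar *m u = \sum_i dotv (p0 i) u *: p0 i.
Proof. by rewrite mulmx_suml; apply: eq_bigr => i _; rewrite mul_outer. Qed.

Lemma covar_sym : covar^T = covar.
Proof.
rewrite /covar raddf_sum; apply: eq_bigr => i _ /=.
by rewrite trmx_mul trmxK.
Qed.

Lemma covar_unit : covar \in unitmx.
Proof.
rewrite -row_free_unit; apply: inj_row_free => v vB.
have Bv : covar *m v^T = 0.
  by rewrite -covar_sym -trmx_mul vB trmx0.
apply: trmx_inj; rewrite trmx0; apply: span_p0 => i.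
have : dotv v^T (covar *m v^T) = 0 by rewrite Bv /dotv mulmx0 mxE.
rewrite covar_mul dotv_sumr => /eqP; rewrite psumr_eq0; last first.
  by move=> k _; rewrite dotvZr (dotvC v^T) -expr2 sqr_ge0.
move=> /allP /(_ i (mem_index_enum _)) /=.
by rewrite dotvZr (dotvC v^T) mulf_eq0 orbb => /eqP.
Qed.

Definition icov := invmx covar.

Lemma icov_sym : icov^T = icov.
Proof. by rewrite /icov trmx_inv covar_sym. Qed.

Lemma icovK (u : 'cV[R]_d) : icov *m (covar *m u) = u.
Proof. by rewrite mulmxA mulVmx ?covar_unit // mul1mx. Qed.

Lemma covar_theta g : theta g *m covar = covar *m theta g.
Proof.
have h : theta g *m covar *m (theta g)^T = covar.
  rewrite /covar mulmx_sumr mulmx_suml.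
  rewrite [RHS](reindex_inj (act_inj act1 actM (g := g))); apply: eq_bigr => i _.
  by have [<- _] := equi_p0; rewrite trmx_mul !mulmxA.
by rewrite -[in RHS]h -mulmxA thetaO mulmx1.
Qed.

Lemma icov_theta g : theta g *m icov = icov *m theta g.
Proof.
apply: (can_inj (mulKmx covar_unit)); rewrite [RHS]mulmxA mulmxV ?covar_unit //.
by rewrite mul1mx mulmxA -covar_theta -mulmxA mulmxV ?covar_unit // mulmx1.
Qed.


(* (P P^T)^-1 P X for the matrix P with columns p0: this is P itself at
   X = P^T P, and it inherits the symmetry and the kernel of X. *)
Definition qof (X : V -> V -> R) i : 'cV[R]_d := icov *m \sum_j X i j *: p0 j.

Lemma qof_equivariant X : (forall i j, X i j = X j i) ->
  (forall i, \sum_j X i j = 0) ->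
  (forall g i j, X (act g i) (act g j) = X i j) -> equivariant (qof X).
Proof.
move=> sX cX gX; split=> [g i|].
  rewrite /qof mulmxA icov_theta -mulmxA; congr (_ *m _).
  rewrite mulmx_sumr [RHS](reindex_inj (act_inj act1 actM (g := g))).
  by apply: eq_bigr => j _; rewrite -scalemxAr gX; have [-> _] := equi_p0.
rewrite /qof -mulmx_sumr exchange_big big1 ?mulmx0 // => j _ /=.
by rewrite -scaler_suml; under eq_bigr do rewrite sX; rewrite cX scale0r.
Qed.

Lemma qof_z0 i : qof z0 i = p0 i.
Proof.
rewrite -[RHS]icovK covar_mul; congr (_ *m _); apply: eq_bigr => j _.
by rewrite /gk mul1mx dotvC.
Qed.

Lemma qof_coord X i a :
  qof X i a 0 = \sum_j X i j * (icov *m p0 j) a 0.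
Proof.
rewrite /qof mulmx_sumr summxE; apply: eq_bigr => j _.
by rewrite -scalemxAr mxE.
Qed.

Lemma comb_qof X v a :
  comb (qof X) v a 0 = bil X v (fun j => (icov *m p0 j) a 0).
Proof.
rewrite /comb summxE bilE; apply: eq_bigr => i _; rewrite mxE qof_coord.
by congr (_ * _); apply: eq_bigr => j _; rewrite mulrC.
Qed.

(** Each coordinate of [comb (qof X) v] is a value of the bilinear form of [X] at [v], so
    Cauchy-Schwarz applies. With [psdk_perturb] this makes every [gk (qof X) M] with symmetric [M] a
    two-sided direction at [X]. *)
Lemma comb_qof_bound X : psdk X -> exists D, forall v,
  dotv (comb (qof X) v) (comb (qof X) v) <= D * bil X v v.
Proof.
move=> pX; pose c a j := (icov *m p0 j) a 0.
exists (\sum_a bil X (c a) (c a)) => v.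
rewrite dotvE mulr_suml; apply: ler_sum => a _.
by rewrite comb_qof -expr2 mulrC; apply: psdk_CS.
Qed.

(* The k-th basis vector minus its projection to the row space of p0. *)
Definition offspan k i : R := unitv R k i - dotv (p0 i) (icov *m p0 k).

Lemma comb_offspan k : comb p0 (offspan k) = 0.
Proof.
rewrite /comb; under eq_bigr do rewrite /offspan scalerBl.
rewrite sumrB -covar_mul mulmxA mulmxV ?covar_unit // mul1mx.
rewrite (bigD1 k) //= /unitv eqxx scale1r big1 ?addr0 ?subrr // => i /negPf ->.
by rewrite scale0r.
Qed.

Lemma bil_offspan X k (v : V -> R) : (forall i j, X i j = X j i) ->
  bil X v (offspan k) =
  \sum_i v i * (X i k - dotv (\sum_j X i j *: p0 j) (icov *m p0 k)).
Proof.
move=> sX; rewrite bilE; apply: eq_bigr => i _; congr (_ * _).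
under eq_bigr do rewrite /offspan mulrBl.
rewrite sumrB (sum_unitv k (fun j => X i j)) dotv_suml; congr (_ - _).
by apply: eq_bigr => j _; rewrite dotvZl mulrC.
Qed.

(** Vanishing on all [offspan k] means that [X] sees vectors only through their projection to the
    row space of [p0]. With P the matrix of columns [p0], the form is [icov] times P X P^T times
    [icov], and invariance follows since [icov] commutes with the point group. *)
Lemma face_form X : psdk X -> (forall g i j, X (act g i) (act g j) = X i j) ->
  (forall k, bil X (offspan k) (offspan k) = 0) ->
  exists2 M, invform theta M & forall i j, X i j = gk p0 M i j.
Proof.
move=> pX gX h0; have [sX _] := pX.
pose y i := \sum_j X i j *: p0 j.
have XE i k : X i k = dotv (y i) (icov *m p0 k).
  have := psdk_null pX (h0 k) (unitv R i); rewrite (bilC _ _ sX) bil_offspan //.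
  by rewrite (sum_unitv i (fun l => X l k - _)) => /eqP; rewrite subr_eq0 => /eqP.
pose N := \sum_j p0 j *m (y j)^T.
have NE : N = \sum_i \sum_j X i j *: (p0 i *m (p0 j)^T).
  apply: eq_bigr => i _; rewrite /y raddf_sum mulmx_sumr.
  by apply: eq_bigr => j _; rewrite /= linearZ /= -scalemxAr.
have sN : N^T = N.
  rewrite NE raddf_sum /= exchange_big; apply: eq_bigr => i _.
  rewrite raddf_sum /=; apply: eq_bigr => j _.
  by rewrite linearZ /= trmx_mul trmxK sX.
have yE i : y i = N *m (icov *m p0 i).
  rewrite mulmx_suml {1}/y; apply: eq_bigr => j _.
  by rewrite mul_outer -XE sX.
have gN g : theta g *m N *m (theta g)^T = N.
  rewrite NE mulmx_sumr mulmx_suml.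
  rewrite [RHS](reindex_inj (act_inj act1 actM (g := g))); apply: eq_bigr => i _.
  rewrite mulmx_sumr mulmx_suml.
  rewrite [RHS](reindex_inj (act_inj act1 actM (g := g))); apply: eq_bigr => j _.
  rewrite -scalemxAr -scalemxAl gX; have [eqp _] := equi_p0.
  by rewrite -!eqp trmx_mul !mulmxA.
exists (icov *m N *m icov).
  split=> [|g]; first by rewrite !trmx_mul sN icov_sym mulmxA.
  have tI : (theta g)^T *m icov = icov *m (theta g)^T.
    by rewrite -[in LHS]icov_sym -trmx_mul -icov_theta trmx_mul icov_sym.
  rewrite !mulmxA tI -!mulmxA -icov_theta; congr (_ *m _).
  rewrite -[in LHS](gN g) !mulmxA thetaO mul1mx; congr (_ *m _).
  by rewrite -mulmxA thetaO mulmx1.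
by move=> i j; rewrite XE yE /gk /dotv !trmx_mul sN icov_sym !mulmxA.
Qed.

(* The last clause bounds the image of the face exposed by om under the edge
   map.  It replaces the maximality of the rank because it can be established
   near p0 without knowing that the nearby points are universally rigid. *)
Definition superstable_at (q : V -> 'cV[R]_d) := exists om : V -> V -> R,
  [/\ forall i j, om i j = om j i,
      forall g i j, om (act g i) (act g j) = om i j,
      forall v, 0 <= form E om v &
  [/\ forall i a, \sum_j (E i j)%:R * om i j * (q i a 0 - q j a 0) = 0,
      forall i j, E i j -> 0 <= (sigma i j)%:~R * om i j &
      forall X s, cone X s -> pair2 om (edgemap X s) = 0 ->
        exists2 M : 'M[R]_d, M^T = M &
        forall i j, edgemap X s i j = edgemap (gk q M) zerok i j]].

Lemma edgemap_add X s Y r k i j :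
  edgemap (fun i j => X i j + k * Y i j) (fun i j => s i j + k * r i j) i j =
  edgemap X s i j + k * edgemap Y r i j.
Proof. by rewrite /edgemap; ring. Qed.

Lemma pair2_add (om A A' : V -> V -> R) k : pair2 om (fun i j => A i j + k * A' i j) =
  pair2 om A + k * pair2 om A' :> R.
Proof.
rewrite -[pair2 om A]mul1r -pair2_comb; apply: eq_pair2 => i j.
by rewrite mul1r.
Qed.

Lemma pair2C (A A' : V -> V -> R) : pair2 A A' = pair2 A' A.
Proof. by apply: eq_bigr => i _; apply: eq_bigr => j _; rewrite mulrC. Qed.

Lemma pair2_sum (om : V -> V -> R) k (c : 'I_k -> R) (A : 'I_k -> V -> V -> R) :
  pair2 om (fun i j => \sum_b c b * A b i j) = \sum_b c b * pair2 om (A b).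
Proof.
rewrite /pair2; under eq_bigr do (under eq_bigr do rewrite mulr_sumr).
under eq_bigr do rewrite exchange_big.
rewrite exchange_big; apply: eq_bigr => b _ /=; rewrite mulr_sumr.
apply: eq_bigr => i _; rewrite mulr_sumr; apply: eq_bigr => j _; ring.
Qed.

Lemma pair2_form_gk (om : V -> V -> R) q : pair2 om (edgemap (gk q 1%:M) zerok) =
  \sum_a form E om (fun i => q i a 0).
Proof.
rewrite /form exchange_big; apply: eq_bigr => i _ /=.
rewrite exchange_big; apply: eq_bigr => j _ /=.
rewrite /edgemap /zerok mulr0 addr0 /gk !mul1mx.
have -> : dotv (q i) (q i) + dotv (q j) (q j) - 2 * dotv (q i) (q j) =
    \sum_a (q i a 0 - q j a 0) ^+ 2.
  rewrite !dotvE mulr_sumr -big_split -sumrB; apply: eq_bigr => a _ /=; ring.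
by rewrite mulrA [om i j * _]mulrC mulr_sumr.
Qed.

Hypothesis V_gt0 : (0 < #|V|)%N.

Let G0 : 0 < #|gT|%:R :> R.
Proof. by rewrite ltr0n; apply/card_gt0P; exists 1%g. Qed.

(** The symmetrized negative of [eta] is the stress. Nonnegativity on the cone gives
    semidefiniteness and the signs through the test elements, and vanishing along two-sided
    directions gives equilibrium. For the face condition, solvability allows the subtraction of a
    kernel [gk q N] that makes the rest transversal, where the second order condition applies. *)
Lemma superstable_of_exposed Xh sh eta k (M : 'I_k -> 'M[R]_d) :
  cone Xh sh -> (forall b, invform theta (M b)) ->
  (forall X s, cone X s -> pair2 eta (edgemap X s) <= 0) ->
  pair2 eta (edgemap Xh sh) = 0 ->
  (forall X s l, 0 < l ->
     cone (fun i j => Xh i j + l * X i j) (fun i j => sh i j + l * s i j) ->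
     pair2 eta (edgemap X s) = 0 ->
     (forall b, pair2 (edgemap X s) (edgemap (gk p0 (M b)) zerok) = 0) ->
     forall i j, edgemap X s i j = 0) ->
  (forall rhs : 'I_k -> R, exists c : 'I_k -> R, forall b,
     \sum_b' c b' * pair2 (edgemap (gk p0 (M b)) zerok)
       (edgemap (gk (qof Xh) (M b')) zerok) = rhs b) ->
  superstable_at (qof Xh).
Proof.
move=> cXh iM eta_le eta0 second solve.
have [[[sXh pXh] cenXh s0 sE] ssh gXh gsh] := cXh.
have eq := qof_equivariant sXh cenXh gXh; set q := qof Xh in eq solve *.
pose om := symstress act eta.
have om_sym i j : om i j = om j i := symstress_sym act eta i j.
have om_act g i j : om (act g i) (act g j) = om i j.
  exact: symstress_act.
have omE X s : (forall i j, X i j = X j i) -> (forall i j, s i j = s j i) ->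
    (forall g i j, X (act g i) (act g j) = X i j) ->
    (forall g i j, s (act g i) (act g j) = s i j) ->
    pair2 om (edgemap X s) = - (2 * #|gT|%:R) * pair2 eta (edgemap X s).
  move=> sX ss gX gs; apply: pair2_symstress => // [i j|g i j].
    exact: edgemap_sym.
  exact: edgemap_act.
have omcone X s : cone X s ->
    pair2 om (edgemap X s) = - (2 * #|gT|%:R) * pair2 eta (edgemap X s).
  by move=> [[[sX _] _ _ _] ss gX gs]; apply: omE.
have omcone_ge0 X s : cone X s -> 0 <= pair2 om (edgemap X s).
  move=> cX; rewrite omcone // mulNr oppr_ge0 mulr_ge0_le0 ?eta_le //.
  by rewrite mulr_ge0 // ltW.
have twoside N : invform theta N -> exists2 l, 0 < l & forall x, `|x| <= l ->
    cone (fun i j => Xh i j + x * gk q N i j) sh.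
  move=> iN; have [sN _] := iN.
  have [D hD] := comb_qof_bound (conj sXh pXh).
  have [l l0 hl] := psdk_perturb (conj sXh pXh) sN hD.
  exists l => // x hx; split=> //; first split=> //; first exact: hl.
    move=> i; rewrite big_split /= -mulr_sumr cenXh gk_center ?mulr0 ?addr0 //.
    by case: eq.
  by move=> g i j; rewrite gXh gk_act.
have shE x : sh = (fun i j => sh i j + x * zerok i j).
  by apply: boolp.funext => i; apply: boolp.funext => j; rewrite mulr0 addr0.
(* A linear functional that is nonpositive on a segment and zero at its midpoint vanishes along
   it. *)
have eta_gk N : invform theta N -> pair2 eta (edgemap (gk q N) zerok) = 0.
  move=> iN; have [l l0 hl] := twoside N iN.
  have h x : `|x| <= l -> x * pair2 eta (edgemap (gk q N) zerok) <= 0.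
    move=> hx; have := eta_le _ _ (hl x hx); rewrite (shE x).
    rewrite (eq_pair2 _ (edgemap_add Xh sh (gk q N) zerok x)) pair2_add eta0.
    by rewrite add0r.
  apply/le_anti/andP; split.
    by rewrite -(pmulr_rle0 _ l0) h // gtr0_norm.
  by rewrite -oppr_le0 -(pmulr_rle0 _ l0) mulrN -mulNr h // normrN gtr0_norm.
have form_ge0 v : 0 <= form E om v.
  have h : pair2 om (edgemap (avgk act v) zerok) = #|gT|%:R * form E om v.
    exact: pair2_avgk.
  by rewrite -(pmulr_rge0 _ G0) -h; apply: omcone_ge0; apply: cone_avgk.
exists om; split=> //; split.
(* The forms of the coordinate functions are nonnegative and sum to zero, so each coordinate is a
   null vector of a semidefinite Laplacian, hence in its kernel. *)
- move=> i a; pose v l := q l a 0.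
  have v0 : form E om v = 0.
    have : \sum_a form E om (fun i => q i a 0) = 0.
      rewrite -pair2_form_gk omE ?eta_gk ?mulr0 //; first exact: invform1.
      - by move=> l m; rewrite gk_sym ?trmx1.
      - by move=> g l m; rewrite gk_act //; apply: invform1.
    move=> /eqP; rewrite psumr_eq0 => [/allP /(_ a (mem_index_enum _)) /eqP //|b _].
    exact: form_ge0.
  have pL : psdk (lapk E om).
    split=> [l m|u]; first exact: lapk_sym.
    by have := form_ge0 u; rewrite form_bil // pmulr_rge0.
  have b0 : bil (lapk E om) v v = 0.
    by move: v0; rewrite form_bil // => /eqP; rewrite mulf_eq0 pnatr_eq0 => /eqP.
  have := psdk_null pL b0 (unitv R i).
  rewrite bilC; last exact: lapk_sym.
  by rewrite bil_lapk (sum_unitv i (fun i => \sum_j (E i j)%:R * om i j * (v i - v j))).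
- move=> i j eij; have [->|sn] := eqVneq (sigma i j) 0; first by rewrite mul0r.
  have sl : slackable E sigma i j by rewrite /slackable eij.
  have c : cone zerok (orbk R act i j) by apply: cone_orbk.
  have := omcone_ge0 _ _ c.
  have -> : pair2 om (edgemap zerok (orbk R act i j)) =
      2 * #|gT|%:R * ((sigma i j)%:~R * om i j) by apply: pair2_orbk.
  by rewrite pmulr_rge0 // mulr_gt0.
- move=> X s cX; rewrite omcone // => /eqP.
  rewrite mulf_eq0 oppr_eq0 mulf_eq0 pnatr_eq0 /= gt_eqF //= => /eqP etaX.
  (* The coefficients make [X] and [gk q N] pair equally with the image of the face at [p0], so
     their difference [Y] satisfies the orthogonality asked for by [second]. *)
  have [c hc] := solve (fun b => pair2 (edgemap (gk p0 (M b)) zerok) (edgemap X s)).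
  pose N := \sum_b c b *: M b; have iN : invform theta N by apply: invform_lin.
  have [l l0 hl] := twoside N iN.
  exists N; first by case: iN.
  pose Y i j := X i j + (-1) * gk q N i j.
  pose s' i j := s i j + (-1) * zerok i j.
  have YE i j : edgemap Y s' i j = edgemap X s i j + (-1) * edgemap (gk q N) zerok i j.
    exact: edgemap_add.
  suff h i j : edgemap Y s' i j = 0.
    by move=> i j; have := h i j; rewrite YE mulN1r => /eqP; rewrite subr_eq0 => /eqP.
  move: i j; apply: (second Y s' l) => //.
  + have -> : (fun i j => Xh i j + l * Y i j) =
      (fun i j => 1 * (Xh i j + (- l) * gk q N i j) + l * X i j).
      by apply: boolp.funext => i; apply: boolp.funext => j; rewrite /Y; ring.
    have -> : (fun i j => sh i j + l * s' i j) = (fun i j => 1 * sh i j + l * s i j).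
      by apply: boolp.funext => i; apply: boolp.funext => j; rewrite /s' /zerok; ring.
    apply: cone_comb => //; first exact: ltW.
    by apply: hl; rewrite normrN gtr0_norm.
  + by rewrite (eq_pair2 _ YE) pair2_add etaX eta_gk // mulr0 addr0.
  + move=> b; rewrite pair2C (eq_pair2 _ YE) pair2_add -hc.
    rewrite (eq_pair2 _ (fun i j => edgemap_gk_lin q c M i j)).
    by rewrite (pair2_sum _ c (fun b => edgemap (gk q (M b)) zerok)) mulN1r subrr.
Qed.

(** * Existence of superstable configurations near p0 *)

Local Notation idx := (V * V + V * V)%type.
(** A pair of kernel and slack is packed into one function on a finite index type, the format of
    [exposed_perturbation]. *)
Let tX (t : idx -> R) i j := t (inl (i, j)).
Let tS (t : idx -> R) i j := t (inr (i, j)).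
Let mk (X s : V -> V -> R) (k : idx) :=
  match k with inl ij => X ij.1 ij.2 | inr ij => s ij.1 ij.2 end.

Let econt_tX i j : econt (fun t => tX t i j).
Proof. exact: econt_coord. Qed.
Let econt_tS i j : econt (fun t => tS t i j).
Proof. exact: econt_coord. Qed.

Let lin_bil v u : lin (fun t => bil (tX t) v u).
Proof. by do 2!(apply: lin_sum => ?); apply: linZ; apply: lin_coord. Qed.

Let eclosed_cone : eclosed (fun t => cone (tX t) (tS t)).
Proof.
have H1 : eclosed (fun t => psdk (tX t)).
  apply: eclosed_and.
    by do 2!(apply: eclosed_forall => ?); apply: eclosed_eq.
  by apply: eclosed_forall => v; apply: eclosed_ge0; apply: lin_econt.
have H2 : eclosed (fun t => forall i, \sum_j tX t i j = 0).
  apply: eclosed_forall => i; apply: eclosed_eq; last exact: econt_const.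
  exact: econt_sum.
have H3 : eclosed (fun t => forall i j, 0 <= tS t i j).
  by do 2!(apply: eclosed_forall => ?); apply: eclosed_ge0.
have H4 : eclosed (fun t => forall i j, ~~ slackable E sigma i j -> tS t i j = 0).
  do 2!(apply: eclosed_forall => ?); apply: eclosed_imp; apply: eclosed_eq => //.
  exact: econt_const.
have H5 : eclosed (fun t => forall i j, tS t i j = tS t j i).
  by do 2!(apply: eclosed_forall => ?); apply: eclosed_eq.
have H6 : eclosed (fun t => forall g i j, tX t (act g i) (act g j) = tX t i j).
  by do 3!(apply: eclosed_forall => ?); apply: eclosed_eq.
have H7 : eclosed (fun t => forall g i j, tS t (act g i) (act g j) = tS t i j).
  by do 3!(apply: eclosed_forall => ?); apply: eclosed_eq.
apply: eclosed_iff (eclosed_and (eclosed_and (eclosed_and H1 H2)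
  (eclosed_and H3 H4)) (eclosed_and H5 (eclosed_and H6 H7))) => t.
by split=> [[[[h1 h2] [h3 h4]] [h5 [h6 h7]]]|[[h1 h2 h3 h4] h5 h6 h7]] //.
Qed.

Let lin_edgemap i j : lin (fun t => edgemap (tX t) (tS t) i j).
Proof.
apply: linZ; apply: linD; last by apply: linZ; apply: lin_coord.
apply: linB; last by apply: linZ; apply: lin_coord.
by apply: linD; apply: lin_coord.
Qed.

Let econt_qof i a : econt (fun t => qof (tX t) i a 0).
Proof.
apply: econt_ext (fun t => esym (qof_coord (tX t) i a)) _.
by apply: econt_sum => j; apply: econtM => //; apply: econt_const.
Qed.

Let econt_gk_qof M i j : econt (fun t => gk (qof (tX t)) M i j).
Proof.
apply: econt_ext (fun t => esym (dotv_mxE _ _ _)) _.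
apply: econt_sum => a; apply: econt_sum => b; apply: econtM => //.
by apply: econtM => //; apply: econt_const.
Qed.

Let econt_edgemap_gk M i j :
  econt (fun t => edgemap (gk (qof (tX t)) M) zerok i j).
Proof.
apply: econtM; first exact: econt_const.
apply: econtD; last exact: econt_const.
apply: econtB; first exact: econtD.
by apply: econtM => //; apply: econt_const.
Qed.

(** Pairings of the image of the face at [p0] with its analogue at [q]; invertibility of this matrix
    is the solvability needed at the nearby configuration. *)
Let psi k (M : 'I_k -> 'M[R]_d) (q : V -> 'cV[R]_d) : 'M[R]_k :=
  \matrix_(b, b') pair2 (edgemap (gk p0 (M b)) zerok) (edgemap (gk q (M b')) zerok).

Let pair2_eq0 (A : V -> V -> R) : pair2 A A = 0 -> forall i j, A i j = 0.
Proof.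
move=> /eqP; rewrite psumr_eq0; last first.
  by move=> i _; apply: sumr_ge0 => j _; rewrite -expr2 sqr_ge0.
move=> /allP h i j; have := h i (mem_index_enum _) => /=.
rewrite psumr_eq0; last by move=> l _; rewrite -expr2 sqr_ge0.
by move=> /allP /(_ j (mem_index_enum _)) /=; rewrite mulf_eq0 orbb => /eqP.
Qed.

(** At [p0] this is the Gram matrix of the images of the basis, so the edge map must be injective on
    the span of the face. A form with zero image is compared with the zero point of the cone by
    [rigid_dir]; its kernel then vanishes, and so does the form, as [p0] spans. *)
Let psi_p0 k (M : 'I_k -> 'M[R]_d) : (forall b, invform theta (M b)) ->
  (forall c : 'I_k -> R, \sum_b c b *: M b = 0 -> forall b, c b = 0) ->
  \det (psi M p0) != 0.
Proof.
move=> iM freeM; rewrite -unitfE -/(_ \in unitmx) -[_ \in _]unitmx_tr -row_free_unit.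
apply: inj_row_free => v vP; apply/matrixP => x b; rewrite ord1 mxE => {x}.
pose N := \sum_b v 0 b *: M b.
have [sN _] : invform theta N by apply: invform_lin.
have ort b' : pair2 (edgemap (gk p0 (M b')) zerok) (edgemap (gk p0 N) zerok) = 0.
  rewrite (eq_pair2 _ (fun i j => edgemap_gk_lin p0 (v 0) M i j)).
  rewrite (pair2_sum _ (v 0) (fun b => edgemap (gk p0 (M b)) zerok)).
  have := congr1 (fun A : 'rV[R]_k => A 0 b') vP; rewrite !mxE => {2}<-.
  by apply: eq_bigr => l _; rewrite !mxE.
have z : forall i j, edgemap (gk p0 N) zerok i j = 0.
  apply: pair2_eq0; rewrite {1}(_ : edgemap (gk p0 N) zerok =
    fun i j => \sum_b v 0 b * edgemap (gk p0 (M b)) zerok i j); last first.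
    by apply: boolp.funext => i; apply: boolp.funext => j; rewrite edgemap_gk_lin.
  rewrite pair2C (pair2_sum _ (v 0) (fun b => edgemap (gk p0 (M b)) zerok)).
  by rewrite big1 // => l _; rewrite pair2C ort mulr0.
have c00 : cone0 zerok zerok.
  by split=> //; [exact: psdk0|move=> i; rewrite big1].
have [|hN _] := rigid_dir c00 sN.
  by move=> i j; rewrite z /edgemap /zerok; ring.
have z2 (u : 'cV[R]_d) : covar *m (N *m (covar *m u)) = 0.
  rewrite !covar_mul big1 // => i _; rewrite mulmx_sumr dotv_sumr big1 ?scale0r //.
  move=> j _; rewrite -scalemxAr dotvZr.
  by have := hN i j; rewrite /gk /zerok => <-; rewrite mulr0.
have N0 : N = 0.
  have z3 : covar *m (N *m covar) = 0.
    apply/matrixP => m l.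
    have := congr1 (fun u : 'cV[R]_d => u m 0) (z2 (delta_mx l 0)).
    by rewrite !mulmxA -colE !mxE.
  have := congr1 (fun A => icov *m A *m icov) z3.
  by rewrite mulmx0 mul0mx !mulmxA mulVmx ?covar_unit // mul1mx mulmxK ?covar_unit.
exact: (freeM (v 0) N0 b).
Qed.

Lemma superstable_near r : 0 < r -> exists q,
  [/\ equivariant q, forall i a, `|q i a 0 - p0 i a 0| < r & superstable_at q].
Proof.
move=> r0.
have [k [M [iM spanM freeM]]] := invform_basis thetaM.
pose t0 := mk z0 zerok.
have qt0 : qof (tX t0) = p0.
  by apply: boolp.funext => i; rewrite -[RHS]qof_z0.
have cdet : econt (fun t => \det (psi M (qof (tX t)))).
  apply: econt_det => b b'; apply: econt_ext (fun t => esym (mxE _ _ _ _)) _.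
  apply: econt_sum => i; apply: econt_sum => j.
  by apply: econtM => //; apply: econt_const.
have det0 : \det (psi M (qof (tX t0))) != 0 by rewrite qt0 psi_p0.
(* Within [r1] the determinant moves by less than its absolute value at [t0], so it stays
   nonzero. *)
have [|r1 r10 hr1] := cdet t0 `|\det (psi M (qof (tX t0)))|.
  by rewrite normr_gt0.
have [r2 r20 hr2] : exists2 r2, 0 < r2 & forall t, (forall x, `|t x - t0 x| < r2) ->
    forall i a, `|qof (tX t) i a 0 - p0 i a 0| < r.
  have H : forall ia : V * 'I_d, exists2 r2, 0 < r2 &
      forall t, (forall x, `|t x - t0 x| < r2) ->
      `|qof (tX t) ia.1 ia.2 0 - p0 ia.1 ia.2 0| < r.
    by move=> ia; rewrite -qt0; apply: econt_qof.
  (* One radius is chosen per coordinate; starting the minimum from 1 keeps it positive when there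
     is none. *)
  have [rr hrr] := boolp.choice (fun ia => match H ia with ex_intro2 a b c => ex_intro (fun a => 0 < a /\ _) a (conj b c) end).
  exists (\big[Num.min/1]_ia rr ia).
    by elim/big_rec: _ => // ia x _ x0; rewrite lt_min x0 (hrr ia).1.
  move=> t ht i a; apply: (hrr (i, a)).2 => x; apply: lt_le_trans (ht x) _.
  exact: bigmin_le.
(* Nonnegative on the cone, and zero exactly when all slacks vanish and the kernel is null on every
   [offspan l], that is, on the minimal face of [z0]. *)
pose tau t := \sum_l bil (tX t) (offspan l) (offspan l) + \sum_i \sum_j tS t i j.
pose A t (ij : V * V) := edgemap (tX t) (tS t) ij.1 ij.2.
pose w b := mk (gk p0 (M b)) zerok.
have pairA (eta : V * V -> R) (B : V -> V -> R) :
    \sum_ij eta ij * B ij.1 ij.2 = pair2 (fun i j => eta (i, j)) B.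
  by rewrite /pair2 pair_bigA; apply: eq_bigr => -[].
have [] := @exposed_perturbation R _ _ _ (fun t => cone (tX t) (tS t)) A t0 tau w
  _ _ _ _ _ _ _ _ _ (Num.min r1 r2).
- exact: eclosed_cone.
- by move=> t u a b ct cu a0 b0; apply: cone_comb.
- by move=> ij; apply: lin_edgemap.
- apply: linD; first by apply: lin_sum => l; apply: lin_bil.
  by do 2!(apply: lin_sum => ?); apply: lin_coord.
- exact: cone_z0.
- move=> t [ct _ _ _] hA; have [|h1 h2] := rigid_p0 ct.
    by move=> i j; apply: (hA (i, j)).
  by case=> -[i j]; [exact: h1|exact: h2].
- move=> t [[pX _ s0 _] _ _ _]; apply: addr_ge0.
    by apply: sumr_ge0 => l _; have [_] := pX; apply.
  by do 2!(apply: sumr_ge0 => ? _).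
- rewrite /tau big1 => [|l _]; last first.
    by rewrite -[bil _ _ _]/(bil z0 (offspan l) (offspan l)) bil_gk comb_offspan /dotv trmx0 mul0mx mxE.
  by rewrite add0r big1 // => i _; rewrite big1.
- move=> t [[pX cX s0 _] _ gX _] /eqP; have [_ posX] := pX.
  have ge1 : 0 <= \sum_l bil (tX t) (offspan l) (offspan l) by apply: sumr_ge0.
  have ge2 : 0 <= \sum_i \sum_j tS t i j by do 2!(apply: sumr_ge0 => ? _).
  rewrite paddr_eq0 // psumr_eq0 // psumr_eq0; last by move=> i _; apply: sumr_ge0.
  move=> /andP[/allP hb /allP hs].
  have [|N iN hN] := face_form pX gX.
    by move=> l; apply/eqP; apply: (hb l (mem_index_enum _)).
  have [c hc] := spanM N iN; exists c => -[] [i j].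
    by rewrite -[LHS]/(tX t i j) hN hc gk_lin.
  rewrite big1 => [|b _]; last by rewrite /= /zerok mulr0.
  have := hs i (mem_index_enum _); rewrite /= psumr_eq0 // => /allP.
  by move=> /(_ j (mem_index_enum _)) /eqP.
- by rewrite lt_min r10.
move=> t1 [eta [ct1 near1 eta_le eta0 second]].
exists (qof (tX t1)); have [[[sX pX] cX _ _] _ gX _] := ct1.
split; first exact: qof_equivariant.
  by apply: hr2 => x; apply: lt_le_trans (near1 x) _; rewrite ge_min lexx orbT.
apply: (superstable_of_exposed (sh := tS t1) (eta := fun i j => eta (i, j)) (M := M)) => //.
- by move=> X s cXs; rewrite -pairA; apply: (eta_le (mk X s)).
- by rewrite -pairA.
- move=> X s l l0 cl eX ort i j.
  apply: (second (mk X s) l l0 _ _ _ (i, j)); first exact: cl.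
    by rewrite -[RHS]eX -pairA.
  by move=> b; rewrite -[RHS](ort b) /pair2 pair_bigA; apply: eq_bigr => -[].
- move=> rhs.
  have U : psi M (qof (tX t1)) \in unitmx.
    rewrite unitmxE unitfE; apply/eqP => d0.
    have := hr1 t1; rewrite d0 sub0r normrN ltxx => h; apply: notF; apply: h => x.
    by apply: lt_le_trans (near1 x) _; rewrite ge_min lexx.
  pose c := invmx (psi M (qof (tX t1))) *m (\col_b rhs b).
  exists (fun b => c b 0) => b.
  have := congr1 (fun C : 'cV[R]_k => C b 0) (mulKVmx U (\col_b rhs b)).
  rewrite -/c [RHS]mxE [LHS]mxE => <-; apply: eq_bigr => b' _.
  by rewrite [psi _ _ b b']mxE mulrC.
Qed.

(** * Consequences of the face condition at p0 *)

Section FaceAtP0.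
Variable om : V -> V -> R.
Hypotheses (om_sym : forall i j, om i j = om j i)
  (om_act : forall g i j, om (act g i) (act g j) = om i j)
  (om_face : forall X s, cone X s -> pair2 om (edgemap X s) = 0 ->
     exists2 M : 'M[R]_d, M^T = M &
     forall i j, edgemap X s i j = edgemap (gk p0 M) zerok i j).

(** Were the stress zero on this edge, the orbit slack [orbk] would lie in the exposed face; by
    [rigid_dir] it would vanish, but it is positive at the edge itself. *)
Lemma slack_stress_neq0 i j : E i j -> sigma i j != 0 -> om i j != 0.
Proof.
move=> eij sij; apply/eqP => om0.
have sl : slackable E sigma i j by rewrite /slackable eij.
have c : cone zerok (orbk R act i j) by apply: cone_orbk.
have [|M sM hM] := om_face c.
  have -> : pair2 om (edgemap zerok (orbk R act i j)) =
      2 * #|gT|%:R * ((sigma i j)%:~R * om i j) by apply: pair2_orbk.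
  by rewrite om0 !mulr0.
have [c0 _ _ _] := c; have [_ h] := rigid_dir c0 sM hM.
by have := orbk_gt0 R act1 i j; rewrite h ltxx.
Qed.

(** The kernel [avgk act v] of a null vector lies in the exposed face, so [rigid_dir] makes it a
    form in [p0], null on every [offspan k]. Its summand for the identity then vanishes there as
    well, which places [center v] in the row space of [p0]. *)
Lemma null_affine v : form E om v = 0 ->
  exists c y, forall k, v k = c + dotv y (p0 k).
Proof.
move=> v0; have c : cone (avgk act v) zerok by apply: cone_avgk.
have [|M sM hM] := om_face c.
  have -> : pair2 om (edgemap (avgk act v) zerok) = #|gT|%:R * form E om v.
    exact: pair2_avgk.
  by rewrite v0 mulr0.
have [c0 _ _ _] := c; have [h _] := rigid_dir c0 sM hM.
exists ((#|V|%:R)^-1 * \sum_j v j), (icov *m comb p0 (center v)) => k.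
have : bil (avgk act v) (offspan k) (offspan k) = 0.
  have -> : avgk act v = gk p0 M.
    by apply: boolp.funext => i; apply: boolp.funext => j; apply: h.
  by rewrite bil_gk comb_offspan /dotv trmx0 mul0mx mxE.
rewrite bil_avgk => /eqP; rewrite psumr_eq0 => [|g _]; last exact: sqr_ge0.
move=> /allP /(_ 1%g (mem_index_enum _)) /=; rewrite sqrf_eq0 => /eqP.
under eq_bigr do rewrite act1 /offspan mulrBl.
rewrite sumrB (sum_unitv k (center v)) => /eqP; rewrite subr_eq0 => /eqP ck.
have -> : v k = (#|V|%:R)^-1 * \sum_j v j + center v k.
  by rewrite /center addrC subrK.
rewrite ck; congr (_ + _).
rewrite -[in RHS]icov_sym -dotv_trmx dotv_suml.
by apply: eq_bigr => i _; rewrite dotvZl mulrC.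
Qed.

End FaceAtP0.

End Config.

(** * Definability of superstability *)

Section SuperstableDefinable.
Variables (R : realType) (K : R -> Prop) (gT : finGroupType) (V : finType).
Variables (act : gT -> V -> V) (E : rel V) (sigma : V -> V -> int) (d : nat).

Lemma polyfun0 (J : finType) : polyfun K (fun _ : J -> R => 0).
Proof. exact: polyfun_ext (polyfun_nat K J 0). Qed.

Lemma polyfun_sqr (J : finType) (g : (J -> R) -> R) :
  polyfun K g -> polyfun K (fun x => g x ^+ 2).
Proof. by move=> pg; apply: polyfun_ext (polyfunM pg pg) => x; rewrite expr2. Qed.

Ltac polyfun_tac := repeat first
  [ exact: polyfun_var | exact: polyfun_nat | exact: polyfun_int | exact: polyfun0
  | apply: polyfun_sum => ? | apply: polyfunB | apply: polyfunD | apply: polyfunN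
  | apply: polyfunM | apply: polyfun_sqr ].

Local Notation idx := (V * V + V * V)%type.

Lemma definable_cone (J : finType) (f : idx -> J) : definable K (fun z : J -> R =>
  @cone R gT V act E sigma (fun i j => z (f (inl (i, j))))
    (fun i j => z (f (inr (i, j))))).
Proof.
pose tX (z : J -> R) i j := z (f (inl (i, j))).
pose tS (z : J -> R) i j := z (f (inr (i, j))).
have H0 : definable K (fun z => forall i j, tX z i j = tX z j i).
  by do 2!(apply: definable_forallF => ?); apply: definable_eq; polyfun_tac.
have H1 : definable K (fun z => forall v : V -> R, 0 <= bil (tX z) v v).
  by apply: definable_all; apply: definable_le; polyfun_tac.
have H2 : definable K (fun z => forall i, \sum_j tX z i j = 0).
  by apply: definable_forallF => i; apply: definable_eq; polyfun_tac.
have H3 : definable K (fun z => forall i j, 0 <= tS z i j).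
  by do 2!(apply: definable_forallF => ?); apply: definable_le; polyfun_tac.
have H4 : definable K (fun z => forall i j, ~~ slackable E sigma i j -> tS z i j = 0).
  do 2!(apply: definable_forallF => ?); apply: definable_impb => _.
  by apply: definable_eq; polyfun_tac.
have H5 : definable K (fun z => forall i j, tS z i j = tS z j i).
  by do 2!(apply: definable_forallF => ?); apply: definable_eq; polyfun_tac.
have H6 : definable K (fun z => forall g i j, tX z (act g i) (act g j) = tX z i j).
  by do 3!(apply: definable_forallF => ?); apply: definable_eq; polyfun_tac.
have H7 : definable K (fun z => forall g i j, tS z (act g i) (act g j) = tS z i j).
  by do 3!(apply: definable_forallF => ?); apply: definable_eq; polyfun_tac.
apply: definable_ext (definable_and (definable_and (definable_and H0 H1)
  (definable_and H2 (definable_and H3 H4))) (definable_and H5 (definable_and H6 H7))).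
move=> z; split=> [[[[h0 h1] [h2 [h3 h4]]] [h5 [h6 h7]]]|].
  by [].
by case=> -[[h0 h1] h2 h3 h4] h5 h6 h7.
Qed.

Definition unflat (x : V * 'I_d -> R) (i : V) : 'cV[R]_d := \col_a x (i, a).

Lemma unflat_flat q : unflat (flat q) = q.
Proof.
by apply: boolp.funext => i; apply/matrixP => a b; rewrite mxE ord1.
Qed.

Lemma gk_unflat x M i j : gk (unflat x) M i j =
  \sum_a \sum_b x (i, a) * M a b * x (j, b).
Proof.
rewrite /gk dotv_mxE; apply: eq_bigr => a _; apply: eq_bigr => b _.
by rewrite !mxE.
Qed.

(** Stress, test vectors, cone points and forms all range over finitely many real unknowns, and only
    integer constants from [E] and [sigma] occur, so quantification over them is first order over
    any [K]. *)
Lemma definable_superstable : definable K (fun x : V * 'I_d -> R =>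
  superstable_at act E sigma (unflat x)).
Proof.
pose Phi (x : V * 'I_d -> R) (om : V * V -> R) :=
 (((forall i j, om (i, j) = om (j, i)) /\
   (forall g i j, om (act g i, act g j) = om (i, j))) /\
  (forall v : V -> R, 0 <= \sum_i \sum_j (E i j)%:R * om (i, j) * (v i - v j) ^+ 2)) /\
 (((forall i a, \sum_j (E i j)%:R * om (i, j) * (x (i, a) - x (j, a)) = 0) /\
   (forall i j, E i j -> 0 <= (sigma i j)%:~R * om (i, j))) /\
  (forall t : idx -> R, @cone R gT V act E sigma (fun i j => t (inl (i, j)))
    (fun i j => t (inr (i, j))) ->
    \sum_i \sum_j om (i, j) * edgemap E sigma (fun i j => t (inl (i, j)))
    (fun i j => t (inr (i, j))) i j = 0 ->
    exists M : 'I_d * 'I_d -> R, (forall a b, M (b, a) = M (a, b)) /\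
      forall i j, edgemap E sigma (fun i j => t (inl (i, j)))
        (fun i j => t (inr (i, j))) i j =
      edgemap E sigma (fun i j => \sum_a \sum_b x (i, a) * M (a, b) * x (j, b))
       (@zerok R V) i j)).
suff : definable K (fun x => exists om, Phi x om).
  apply: definable_ext => x; split.
    move=> [om [[[h1 h2] h3] [[h4 h5] h6]]]; exists (fun i j => om (i, j)).
    split=> //; split=> //.
      by move=> i a; rewrite -[RHS](h4 i a); apply: eq_bigr => j _; rewrite !mxE.
    move=> X s cX pX.
    pose t k := match k with inl ij => X ij.1 ij.2 | inr ij => s ij.1 ij.2 end.
    have [M [sM hM]] := h6 t cX pX.
    exists (\matrix_(a, b) M (a, b)); first by apply/matrixP => a b; rewrite !mxE.
    move=> i j; rewrite [LHS](hM i j); congr (edgemap E sigma _ _ i j).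
    apply: boolp.funext => k; apply: boolp.funext => l; rewrite gk_unflat.
    by do 2!(apply: eq_bigr => ? _); rewrite mxE.
  move=> [om [h1 h2 h3 [h4 h5 h6]]]; exists (fun ij => om ij.1 ij.2).
  split; first by split; first by split.
  split; first split=> //.
    by move=> i a; rewrite -[RHS](h4 i a); apply: eq_bigr => j _; rewrite !mxE.
  move=> t ct pt; have [M sM hM] := h6 _ _ ct pt.
  exists (fun ab => M ab.1 ab.2); split=> [a b|i j] /=; first by rewrite -{1}sM mxE.
  rewrite hM; congr (edgemap E sigma _ _ i j).
  by apply: boolp.funext => k; apply: boolp.funext => l; rewrite gk_unflat.
apply: definable_ex; apply: definable_and.
  apply: definable_and; first apply: definable_and.
  - by do 2!(apply: definable_forallF => ?); apply: definable_eq; polyfun_tac.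
  - by do 3!(apply: definable_forallF => ?); apply: definable_eq; polyfun_tac.
  - by apply: definable_all; apply: definable_le; polyfun_tac.
apply: definable_and; first apply: definable_and.
- by do 2!(apply: definable_forallF => ?); apply: definable_eq; polyfun_tac.
- do 2!(apply: definable_forallF => ?); apply: definable_impb => _.
  by apply: definable_le; polyfun_tac.
apply: definable_all; apply: definable_imp.
  exact: (definable_cone (fun k => inr k)).
apply: definable_imp.
  apply: definable_eq; last exact: polyfun0.
  by do 2!(apply: polyfun_sum => ?); rewrite /edgemap; polyfun_tac.
apply: definable_ex; apply: definable_and.
  by do 2!(apply: definable_forallF => ?); apply: definable_eq; polyfun_tac.
do 2!(apply: definable_forallF => ?); apply: definable_eq;
  by rewrite /edgemap /zerok; polyfun_tac.
Qed.

End SuperstableDefinable.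

(** * The stress matrix *)

Section StressMatrix.
Variables (R : realType) (V : finType) (E : rel V) (om : V -> V -> R).
Hypotheses (Esym : forall i j, E i j = E j i)
  (om_sym : forall i j, om i j = om j i).

Lemma sum_pairs_half (F : V -> V -> R) : (forall i j, F i j = F j i) ->
  (forall i, F i i = 0) -> \sum_i \sum_j F i j =
  2 * \sum_i \sum_(j | (enum_rank i < enum_rank j)%N) F i j.
Proof.
move=> sF dF.
have e i j : F i j = (if (enum_rank i < enum_rank j)%N then F i j else 0) +
    (if (enum_rank j < enum_rank i)%N then F i j else 0).
  case: ltngtP => [_|_|/val_inj/enum_rank_inj ->].
  - by rewrite addr0.
  - by rewrite add0r.
  - by rewrite dF addr0.
under eq_bigr do (under eq_bigr do rewrite e).
under eq_bigr do rewrite big_split; rewrite big_split /=.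
have -> : \sum_i \sum_j (if (enum_rank j < enum_rank i)%N then F i j else 0) =
    \sum_i \sum_j (if (enum_rank i < enum_rank j)%N then F i j else 0).
  by rewrite exchange_big; do 2!(apply: eq_bigr => ? _); rewrite sF.
under [in RHS]eq_bigr do rewrite big_mkcond.
by ring.
Qed.

(** The matrix counts each edge once, via the order of [enum_rank], and the polarized form counts it
    twice; comparing the doubled sides removes the choice of orientation. *)
Lemma stress_laplacian_bil (u v : 'cV[R]_#|V|) :
  (u^T *m stress_laplacian E om *m v) 0 0 =
  bil (lapk E om) (fun i => u (enum_rank i) 0) (fun i => v (enum_rank i) 0).
Proof.
pose F i j := (E i j)%:R * om i j * ((u (enum_rank i) 0 - u (enum_rank j) 0) *
  (v (enum_rank i) 0 - v (enum_rank j) 0)).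
have two : (2 : R) != 0 by rewrite pnatr_eq0.
apply: (mulfI two); rewrite -form_polar // -/(F _ _).
have -> : \sum_i \sum_j (E i j)%:R * om i j *
    ((u (enum_rank i) 0 - u (enum_rank j) 0) *
     (v (enum_rank i) 0 - v (enum_rank j) 0)) = \sum_i \sum_j F i j by [].
rewrite (sum_pairs_half (F := F)); last first.
- by move=> i; rewrite /F !subrr mulr0 mulr0.
- by move=> i j; rewrite /F Esym om_sym; ring.
congr (_ * _); rewrite /stress_laplacian mulmx_sumr mulmx_suml summxE.
apply: eq_bigr => i _; rewrite mulmx_sumr mulmx_suml summxE.
rewrite big_mkcondl; apply: eq_bigr => j _ /=.
rewrite /F; case: (E i j); last by rewrite !mul0r.
rewrite mul1r -scalemxAr -scalemxAl mxE; congr (_ * _).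
have outer (x : 'cV[R]_#|V|) :
    (u^T *m (x *m x^T) *m v) 0 0 = dotv u x * dotv v x.
  by rewrite mulmxA -mulmxA [LHS]mxE big_ord1 [dotv v x]dotvC.
have db (w : 'cV[R]_#|V|) k : dotv w (basis_vec R k) = w (enum_rank k) 0.
  by rewrite /dotv -colE !mxE.
by rewrite outer !dotvBr !db.
Qed.

End StressMatrix.

Theorem theorem4p2 (R : realType) (gT : finGroupType) (Vhat : finType) (d : nat)
  (theta : mx_representation R [set: gT] d)
  (I : finType) (deg : I -> nat)
  (rep : forall i : I, mx_representation R [set: gT] (deg i))
  (E : rel (gT * Vhat)) (sigma : gT * Vhat -> gT * Vhat -> int)
  (p : gT * Vhat -> 'cV[R]_d) :
  point_group theta ->
  irr_rep_system rep ->
  simple_graph E ->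
  sign_function E sigma ->
  (d + 2 <= #|{: gT * Vhat}|)%N ->
  theta_symmetric E sigma theta p ->
  generic_mod_symmetry theta rep p ->
  affinely_spans p ->
  universally_rigid E sigma p ->
  exists omega : gT * Vhat -> gT * Vhat -> R,
    is_stress E omega /\
    equilibrium_stress E p omega /\
    strictly_proper E sigma omega /\
    psd (stress_laplacian E omega) /\
    \rank (stress_laplacian E omega) = (#|{: gT * Vhat}| - d - 1)%N.
Proof.
move=> thO _ [_ Esym] sgn nV [l0 [l1 [lm cp]]] gen aff UR.
pose V : finType := (gT * Vhat)%type.
pose act (g : gT) (x : V) : V := ((g * x.1)%g, x.2).
have act1 i : act 1%g i = i by case: i => a v; rewrite /act mul1g.
have actM g h i : act (g * h)%g i = act g (act h i) by rewrite /act /= mulgA.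
have V_gt0 : (0 < #|V|)%N by apply: leq_trans nV; rewrite addn2.
(* A lift depends on the group components only through [a^-1 * b], which left translation
   preserves. *)
have signG s g i j : s \in [:: (-1); 0; 1] ->
    edges_of_sign E sigma s (act g i) (act g j) = edges_of_sign E sigma s i j.
  have inv (F : rel V) : is_lift F -> F (act g i) (act g j) = F i j.
    by move=> [Eh [_ hE]]; rewrite !hE /Defs.lift /act /= invgM mulgA mulgKV.
  by rewrite !inE => /or3P[] /eqP ->; apply: inv.
have sigma_sym i j : E i j -> sigma i j = sigma j i by move=> /sgn[].
have E_sign i j : E i j -> edges_of_sign E sigma (sigma i j) i j.
  by rewrite /edges_of_sign eqxx andbT.
(* Every edge carries one of the three signs, so [E] inherits invariance from the three sign
   classes. *)
have EG g i j : E (act g i) (act g j) = E i j.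
  apply/idP/idP => e; have [_ s] := sgn _ _ e; have := E_sign _ _ e.
    by rewrite signG // => /andP[].
  by rewrite -(signG _ g) // => /andP[].
have sigmaG g i j : E i j -> sigma (act g i) (act g j) = sigma i j.
  move=> e; have [_ s] := sgn _ _ e; have := E_sign _ _ e.
  by rewrite -(signG _ g) // => /andP[_ /eqP].
have thM g h : theta (g * h)%g = theta g *m theta h by rewrite repr_mxM ?inE.
pose p0 := centered p.
have p0B i j : p0 i - p0 j = p i - p j.
  by rewrite /p0 /centered opprB addrA subrK.
have equi : equivariant act (fun g => theta g) p0.
  have [[cp0 sp0] _] := gen; split=> // g [a v]; exact: cp0.
have span (u : 'cV[R]_d) : (forall i, dotv u (p0 i) = 0) -> u = 0.
  move=> hu; pose c := (#|V|%:R)^-1 *: \sum_j p j.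
  have up i : dotv u (p i) = dotv u c.
    by have := hu i; rewrite /p0 /centered dotvBr => /eqP; rewrite subr_eq0 => /eqP.
  (* A functional that is constant on the points of [p] is constant on their affine span, which is
     everything; a constant linear functional is zero. *)
  have uz z : dotv u z = dotv u c.
    have [lam [sl ->]] := aff z; rewrite dotv_sumr.
    under eq_bigr do rewrite dotvZr up.
    by rewrite -mulr_suml sl mul1r.
  by apply: dotv_eq0; rewrite uz -(uz 0) /dotv mulmx0 mxE.
have rigid X s : cone0 E sigma X s ->
    (forall i j, edgemap E sigma X s i j =
      edgemap E sigma (gk p0 1%:M) (@zerok R V) i j) ->
    (forall i j, X i j = gk p0 1%:M i j) /\ (forall i j, s i j = 0).
  move=> [pX cX s0 sE] hA.
  have [sX _] := pX; have [m [c hc]] := gram_factor pX.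
  (* The Gram vectors of [X] live in a dimension [m] unrelated to [d]; padding with [d] zeros gives
     an ambient dimension at least [d]. *)
  pose q i : 'cV[R]_(d + m) := col_mx (0 : 'cV[R]_d) (\col_k c k i).
  have sq i j : sqnorm (q i - q j) = X i i + X j j - 2 * X i j.
    have dq k l : dotv (q k) (q l) = X k l.
      rewrite dotvE big_split_ord /= big1 ?add0r => [|a _].
        by rewrite hc; apply: eq_bigr => a _; rewrite !col_mxEd !mxE.
      by rewrite !col_mxEu mxE mul0r.
    by rewrite sqnormB !dq.
  have sp i j : sqnorm (p i - p j) =
      gk p0 1%:M i i + gk p0 1%:M j j - 2 * gk p0 1%:M i j.
    by rewrite -p0B sqnormB /gk !mul1mx.
  have edge i j : E i j ->
      sqnorm (p i - p j) = sqnorm (q i - q j) + (sigma i j)%:~R * s i j.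
    move=> e; have := hA i j.
    rewrite /edgemap e /= mulr1n !mul1r /zerok mulr0 addr0 sq sp => <-.
    by ring.
  have dom : dominates E sigma p q.
    move=> i j e; have h := edge i j e; rewrite /enorm h.
    split=> [s1|]; last split=> [s1|s1].
    - by apply: ler_wsqrtr; rewrite s1 mul1r lerDl.
    - by rewrite s1 mul0r addr0.
    - by apply: ler_wsqrtr; rewrite s1 mulN1r gerBl.
  have cong := UR (d + m)%N (leq_addr _ _) q dom.
  have eqs i j : sqnorm (p i - p j) = sqnorm (q i - q j).
    have := congr1 (fun x => x ^+ 2) (cong i j).
    by rewrite /enorm !sqr_sqrtr //; apply: dotv_ge0.
  split.
    apply: centered_kernel_inj => // [i j|i|i j].
    - by rewrite gk_sym ?trmx1.
    - by apply: gk_center; case: equi.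
    - by rewrite -sq -eqs sp.
  move=> i j; have [sl|/sE//] := boolP (slackable E sigma i j).
  have /andP[e sn] := sl; have := edge i j e; rewrite eqs => /eqP.
  rewrite -subr_eq0 opprD addrA subrr sub0r oppr_eq0 mulf_eq0 intr_eq0.
  by rewrite (negPf sn) => /eqP.
have fieldK : is_subfield (Q_theta_Gamma theta rep).
  split; first by move=> S [].
  split; first by move=> S [_ []].
  split; first by move=> x y hx hy S fS gS; have [_ [_ [h _]]] := fS;
    apply: h; [exact: hx|exact: hy].
  split; first by move=> x y hx hy S fS gS; have [_ [_ [_ [h _]]]] := fS;
    apply: h; [exact: hx|exact: hy].
  by move=> x hx S fS gS; have [_ [_ [_ [_ h]]]] := fS; apply: h; exact: hx.
have : superstable_at act E sigma p0.
  rewrite -[p0]unflat_flat.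
  apply: (generic_transfer fieldK gen (P := fun x => superstable_at act E sigma
    (unflat x))); first exact: definable_superstable.
  move=> r r0; have [q [[eq sq] nq ssq]] := superstable_near act1 actM Esym EG
    sigma_sym sigmaG thM (fun g => thO g) equi span rigid V_gt0 r0.
  exists q; split; last by move=> [i a]; apply: nq.
    by split=> // g a v; apply: (eq g (a, v)).
  by rewrite unflat_flat.
move=> [om [om_sym om_act om_form [om_eq om_sign om_face]]].
exists om; split; first by move=> i j _; apply: om_sym.
split.
  move=> i; apply/matrixP => a b; rewrite ord1 mxE summxE -[RHS](om_eq i a).
  rewrite big_mkcond; apply: eq_bigr => j _ /=; case: (E i j); last by rewrite !mul0r.
  by rewrite /= mulr1n mul1r mxE -p0B !mxE.
split.
  move=> i j e; have h := om_sign i j e; split=> // sn.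
  rewrite lt_neqAle h andbT eq_sym mulf_neq0 ?intr_eq0 //.
  exact: (slack_stress_neq0 act1 actM Esym EG sigma_sym sigmaG equi rigid).
have bil_form v : 2 * bil (lapk E om) v v = form E om v by rewrite form_bil.
split.
  move=> v; rewrite stress_laplacian_bil // -(pmulr_rge0 _ (ltr0n R 2)) bil_form.
  exact: om_form.
set L := stress_laplacian E om.
pose ev (w : 'rV[R]_#|V|) (i : V) := w 0 (enum_rank i).
have LE (w : 'rV[R]_#|V|) (v : 'cV[R]_#|V|) :
    (w *m L *m v) 0 0 = bil (lapk E om) (ev w) (fun i => v (enum_rank i) 0).
  have := stress_laplacian_bil Esym om_sym w^T v; rewrite trmxK => ->.
  by congr (bil _ _ _); apply: boolp.funext => i; rewrite mxE.
have rowL (w : 'rV[R]_#|V|) :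
    (forall i, \sum_j (E i j)%:R * om i j * (ev w i - ev w j) = 0) -> w *m L = 0.
  move=> hw; apply/matrixP => a b; rewrite ord1 [RHS]mxE.
  have := LE w (delta_mx b 0); rewrite -colE mxE => ->.
  rewrite bilC; last exact: lapk_sym.
  by rewrite bil_lapk big1 // => i _; rewrite hw mulr0.
(* The rows are the constant vector and the [d] coordinate functions of [p0]. They are independent,
   and their span turns out to be the kernel of the stress matrix. *)
pose F : 'M[R]_(1 + d, #|V|) :=
  col_mx (const_mx 1) (\matrix_(a, k) p0 (enum_val k) a 0).
have FL : F *m L = 0.
  rewrite mul_col_mx -[RHS]vsubmxK; congr col_mx; rewrite linear0.
    apply: rowL => i; rewrite big1 // => j _.
    by rewrite /ev !mxE subrr mulr0.
  apply/row_matrixP => a; rewrite row_mul row0; apply: rowL => i.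
  rewrite -[RHS](om_eq i a); apply: eq_bigr => j _.
  by rewrite /ev !mxE !enum_rankK.
have dotF c (y : 'cV[R]_d) i :
    (row_mx (const_mx c : 'M_1) y^T *m F) 0 (enum_rank i) = c + dotv y (p0 i).
  rewrite mul_row_col mxE mxE big_ord1 !mxE mulr1; congr (_ + _).
  by rewrite dotvE; apply: eq_bigr => a _; rewrite !mxE enum_rankK.
have rmxE (w : 'rV[R]_(1 + d)) :
    w = row_mx (const_mx (lsubmx w 0 0) : 'M_1) ((rsubmx w)^T)^T.
  rewrite trmxK -[LHS]hsubmxK; congr row_mx.
  by apply/matrixP => a b; rewrite [RHS]mxE !ord1.
have sum_p0 : \sum_i p0 i = 0 by case: equi.
have freeF : row_free F.
  apply: inj_row_free => w; rewrite [w in w *m F]rmxE => wF.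
  move: wF; set c := lsubmx w 0 0; set y := (rsubmx w)^T => wF.
  have hy i : c + dotv y (p0 i) = 0 by rewrite -dotF wF mxE.
  (* Summing over all vertices removes the linear part, since [p0] is centered. *)
  have c0 : c = 0.
    have : \sum_(i : V) (c + dotv y (p0 i)) = 0 by rewrite big1.
    rewrite big_split /= -dotv_sumr sum_p0 /dotv mulmx0 mxE addr0 sumr_const.
    move=> /eqP; rewrite mulrn_eq0 => /orP[|/eqP //].
    by move/eqP => V0; move: V_gt0; rewrite V0.
  have y0 : y = 0 by apply: span => i; have := hy i; rewrite c0 add0r.
  rewrite [w]rmxE -/c -/y c0 y0 trmx0.
  by rewrite (_ : const_mx 0 = 0) ?row_mx0 //; apply/matrixP => a b; rewrite !mxE.
have kerF : (kermx L :=: F)%MS.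
  apply/eqmxP/andP; split; last by apply/sub_kermxP.
  apply/rV_subP => w /sub_kermxP wL.
  have v0 : form E om (ev w) = 0.
    rewrite -bil_form; have := LE w w^T; rewrite wL mul0mx mxE => h.
    have e : (fun i => w^T (enum_rank i) 0) = ev w.
      by apply: boolp.funext => i; rewrite mxE.
    by rewrite -{2}e -h mulr0.
  have [c [y hcy]] := null_affine act1 actM EG equi span rigid V_gt0 om_act om_face v0.
  apply/submxP; exists (row_mx (const_mx c : 'M_1) y^T).
  apply/matrixP => a k; rewrite ord1 -[k]enum_valK dotF.
  exact: (hcy (enum_val k)).
have := mxrank_ker L; rewrite kerF.
have /eqP -> := freeF.
(* The bound of the rank by the number of vertices undoes the truncated subtraction in the dimension
   formula for the kernel. *)
have := rank_leq_row L; move: (\rank L) => x; rewrite -[#|{: gT * Vhat}|]/#|V|.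
by move: #|V| => n; lia.
Qed.
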